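(* For every integer $x\geq 1$ there exists an integer $\tau=\tau(x)\geq 1$ with the following property. Let $G\in\mathcal{C}_x$ and assume that $V(G)=D_1\cup D_2\cup Y$, where $Y$ is a stable set with $|Y|=\tau$, $D_1$ and $D_2$ are components of $G\setminus Y$, and $N(D_1)=N(D_2)=Y$. Assume that $Y\cap\operatorname{Hub}(G)=\emptyset$. Then there exist $X\subseteq Y$ with $|X|=x$ and induced subgraphs $H_1\subseteq D_1$ and $H_2\subseteq D_2$ (possibly with the roles of $D_1$ and $D_2$ reversed) such that: $(H_1,X)$ is a triangular connectifier or a triangular alignment; $(H_2,X)$ is a stellar connectifier, a spiky connectifier, a spiky alignment or a wide alignment; and if $(H_1,X)$ is a triangular alignment, then $(H_2,X)$ is not a wide alignment. Moreover, if neither of $(H_1,X),(H_2,X)$ is a stellar connectifier, then the orders given on $X$ by $(H_1,X)$ and by $(H_2,X)$ are the same.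
   Context: Graphs are finite and simple; a path is an induced path. A hole is an induced cycle on at least four vertices; a theta is three internally vertex-disjoint paths between two vertices, each of length at least 2, with pairwise anticomplete interiors; a prism consists of three vertex-disjoint paths $a_i\text{-}\dots\text{-}b_i$, each of length at least 1, with $a_1a_2a_3$, $b_1b_2b_3$ triangles and no other edges between them; a wheel $(H,v)$ is a hole $H$ and a vertex $v$ with at least three neighbors in $H$, even if that number is even. $\mathcal{C}$: graphs with no induced $C_4$, theta, prism or even wheel; $\mathcal{C}_x$: graphs in $\mathcal{C}$ with no clique of size $x$. A wheel $(H,v)$ is a twin wheel if $N(v)\cap H$ induces a path of length two, a short pyramid if $|N(v)\cap H|=3$ and $v$ has exactly two adjacent neighbors in $H$, proper otherwise; $\operatorname{Hub}(G)$ is the set of $v$ such that $(H,v)$ is a proper wheel for some hole $H$. Alignments: for a path $P=p_1\text{-}\dots\text{-}p_n$ of $G$ and $X=\{x_1,\dots,x_k\}\subseteq V(G)\setminus V(P)$, $(P,X)$ is an alignment (with order $x_1,\dots,x_k$ on $X$) if $N_P(x_1)=\{p_1\}$, $N_P(x_k)=\{p_n\}$, every vertex of $X$ has a neighbor in $P$, and there exist $1<j_2<\dots<j_k=n$ with $N_P(x_i)\subseteq\{p_{j_i},\dots,p_{j_{i+1}-1}\}$ for $i\in\{2,\dots,k-1\}$. It is wide if each of $x_2,\dots,x_{k-1}$ has two non-adjacent neighbors in $P$; spiky if each of them has a unique neighbor in $P$; triangular if each of them has exactly two neighbors in $P$ and they are adjacent. Connectifiers: a branch vertex has degree more than two; a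 caterpillar is a tree of maximum degree three with a path containing all branch vertices, and its spine is a maximal such path; a subdivided star is a subdivision of $K_{1,\delta}$, $\delta\geq 3$; $\mathcal{Z}(H)$ is the set of simplicial vertices of $H$. If $H$ is an induced subgraph of $G$ that is a caterpillar, the line graph of a caterpillar, or a subdivided star, and $X\subseteq V(G)\setminus V(H)$ is such that every vertex of $X$ has a unique neighbor in $H$ and $V(H)\cap N(X)=\mathcal{Z}(H)$, then $(H,X)$ is a spiky, triangular, or stellar connectifier, respectively. For $H$ a caterpillar let $P(H)$ be its spine; for $H$ the line graph of a caterpillar $C$ let $P(H)$ be the path of $H$ formed by the vertices corresponding to edges of the spine of $C$; the legs of $H$ are the components of $H\setminus P(H)$. For a spiky or triangular connectifier $(H,X)$: let $x_1,\dots,x_k$ be the vertices of $H\setminus P(H)$ with neighbors in $P(H)$, ordered according to the positions of their neighbors along $P(H)$; the order on $X$ given by $(H,X)$ is $s_0,s_1,\dots,s_k,s_{k+1}$, where for $1\le i\le k$, $s_i$ has a neighbor in the leg containing $x_i$, and $s_0,s_{k+1}$ are the vertices of $X$ adjacent to the two ends of $P(H)$, in the order of traversal of $P(H)$.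
   Formalization: A single vertex H adjacent to all of X also counts as a stellar connectifier (a subdivided star without legs); without this the claim fails when D_2 is one vertex complete to Y and D_1 is a path where each vertex of Y sees its own pair of consecutive vertices. *)

(* Defs.v *)
From HB Require Import structures.
From mathcomp Require Import all_boot.

Set Implicit Arguments.
Unset Strict Implicit.
Unset Printing Implicit Defensive.

Record sgraph := SGraph {
  svert :> finType;
  sedge : rel svert;
  sedge_sym : symmetric sedge;
  sedge_irrefl : irreflexive sedge }.

Notation "x -- y" := (sedge x y) (at level 30, no associativity).

Section Graphs.
Variable G : sgraph.
Implicit Types (u v w : G) (A D H K X Y : {set G}) (p c P s : seq G).

Definition nbr v : {set G} := [set w | v -- w].
Definition nbrs A : {set G} := [set v | (v \notin A) && [exists u in A, u -- v]].

Definition clique K := [forall u in K, forall w in K, (u != w) ==> u -- w].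
Definition stable A := [forall u in A, forall w in A, ~~ (u -- w)].
Definition anticomplete A D :=
  [disjoint A & D] && [forall u in A, forall w in D, ~~ (u -- w)].

Definition is_component A D :=
  exists2 u, u \in A &
    D = [set w | connect [rel y z | [&& y \in A, z \in A & y -- z]] u w].

(* Paths are induced and nonempty; the default [x0] of [nth] is irrelevant. *)
Definition ipath p :=
  [/\ p != [::], uniq p &
      forall x0 i j, i < j -> j < size p ->
        (nth x0 p i -- nth x0 p j) = (j == i.+1)].

Definition hole c :=
  [/\ 4 <= size c, uniq c &
      forall x0 i j, i < j -> j < size c ->
        (nth x0 c i -- nth x0 c j) =
          (j == i.+1) || ((i == 0) && (j == (size c).-1))].

Definition nbr_in v c : {set G} := nbr v :&: [set:: c].

Definition has_C4 := exists2 c, hole c & size c = 4.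

(* [P i] lists the interior of the i-th path. *)
Definition has_theta :=
  exists (a b : G) (P : 'I_3 -> seq G),
    (forall i, ipath (a :: rcons (P i) b) /\ P i != [::]) /\
    (forall i j, i != j -> anticomplete [set:: P i] [set:: P j]).

Definition has_prism :=
  exists (a b : 'I_3 -> G) (P : 'I_3 -> seq G),
    (forall i, [/\ ipath (P i), 2 <= size (P i),
                   head (a i) (P i) = a i & last (a i) (P i) = b i]) /\
    (forall i j, i != j ->
      [disjoint P i & P j] /\
      forall u w, u \in P i -> w \in P j ->
        u -- w = ((u == a i) && (w == a j)) || ((u == b i) && (w == b j))).

Definition wheel c v := hole c /\ 3 <= #|nbr_in v c|.

Definition has_even_wheel := exists c v, wheel c v /\ ~~ odd #|nbr_in v c|.

Definition twin_wheel c v :=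
  wheel c v /\ exists p, [/\ ipath p, size p = 3 & nbr_in v c = [set:: p]].

Definition short_pyramid c v :=
  [/\ wheel c v, #|nbr_in v c| = 3 &
      exists a b d, [/\ nbr_in v c = [set a; b; d], a -- b, ~~ (a -- d)
                      & ~~ (b -- d)]].

Definition proper_wheel c v :=
  [/\ wheel c v, ~ twin_wheel c v & ~ short_pyramid c v].

Definition Hub v := exists c, proper_wheel c v.

Definition class_C :=
  [/\ ~ has_C4, ~ has_theta, ~ has_prism & ~ has_even_wheel].

Definition class_Cx (x : nat) :=
  class_C /\ ~ exists2 K, clique K & #|K| = x.

Definition branch v := 2 < #|nbr v|.

Definition is_tree :=
  [/\ 0 < #|G|, forall u v : G, connect (@sedge G) u v &
      forall c, ucycle (@sedge G) c -> size c <= 2].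

Definition branch_path p := ipath p /\ {subset branch <= p}.

Definition caterpillar :=
  [/\ is_tree, \max_(v : G) #|nbr v| = 3 & exists p, branch_path p].

Definition spine p :=
  branch_path p /\
  forall q, branch_path q -> {subset p <= q} -> {subset q <= p}.

Definition induced_rel H : rel {v : G | v \in H} :=
  [rel y z | val y -- val z].

Lemma induced_sym H : symmetric (@induced_rel H).
Proof. by move=> y z; rewrite /induced_rel /= sedge_sym. Qed.

Lemma induced_irrefl H : irreflexive (@induced_rel H).
Proof. by move=> y; rewrite /induced_rel /= sedge_irrefl. Qed.

Definition induced H : sgraph :=
  SGraph (@induced_sym H) (@induced_irrefl H).

Definition induced_val H (y : induced H) : G := sval y.

Definition edges : {set {set G}} :=
  [set E | [exists u, exists v, (u -- v) && (E == [set u; v])]].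

Definition line_rel : rel {E : {set G} | E \in edges} :=
  [rel E F | (E != F) && (val E :&: val F != set0)].

Lemma line_sym : symmetric line_rel.
Proof. by move=> E F; rewrite /line_rel /= eq_sym setIC. Qed.

Lemma line_irrefl : irreflexive line_rel.
Proof. by move=> E; rewrite /line_rel /= eqxx. Qed.

Definition line_graph : sgraph := SGraph line_sym line_irrefl.

Definition ends_of (E : line_graph) : {set G} := sval E.

Definition simplicial H : {set G} := [set v in H | clique (nbr v :&: H)].

End Graphs.

Definition is_iso (F G : sgraph) (f : F -> G) :=
  bijective f /\ forall u v, f u -- f v = u -- v.

(* The vertex [None] is the centre of K_{1,d}. *)
Definition star_rel (d : nat) : rel (option 'I_d) :=
  [rel y z | isSome y (+) isSome z].

Lemma star_sym d : symmetric (@star_rel d).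
Proof. by move=> y z; rewrite /star_rel /= addbC. Qed.

Lemma star_irrefl d : irreflexive (@star_rel d).
Proof. by move=> y; rewrite /star_rel /= addbb. Qed.

Definition star d : sgraph := SGraph (@star_sym d) (@star_irrefl d).

(* [P u v] is the list of subdivision vertices placed on the edge [u -- v],
   read from [u] to [v]. *)
Definition subdivision (F G : sgraph) :=
  exists (f : F -> G) (P : F -> F -> seq G),
  let Q u v := f u :: rcons (P u v) (f v) in
  [/\ injective f /\ (forall u v, P v u = rev (P u v)),
      forall u v, u -- v -> uniq (Q u v) /\ forall w, f w \notin P u v,
      forall u v u' v', u -- v -> u' -- v' -> [set u; v] != [set u'; v'] ->
        [disjoint P u v & P u' v'],
      forall w, (exists u, w = f u) \/
                (exists u v, u -- v /\ w \in P u v) &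
      forall w z, w -- z <-> exists u v, u -- v /\ infix [:: w; z] (Q u v)].

Definition subdivided_star (G : sgraph) :=
  exists2 d, 3 <= d & subdivision (star d) G.

Section Connectifiers.
Variable G : sgraph.
Implicit Types (H X L : {set G}) (P s : seq G).

Definition attached H X :=
  [/\ [disjoint X & H], forall y, y \in X -> #|nbr y :&: H| = 1 &
      H :&: nbrs X = simplicial H].

Definition caterpillar_line_iso H (C : sgraph)
    (f : line_graph C -> induced H) :=
  caterpillar C /\ is_iso f.

Definition spiky_connectifier H X :=
  caterpillar (induced H) /\ attached H X.

Definition triangular_connectifier H X :=
  (exists (C : sgraph) (f : line_graph C -> induced H),
     caterpillar_line_iso f) /\ attached H X.

(* A single vertex (a star without legs) counts as a degenerate subdivided
   star: a component consisting of one vertex complete to Y contains no other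
   connectifier or alignment. *)
Definition stellar_connectifier H X :=
  (subdivided_star (induced H) \/ #|H| = 1) /\ attached H X.

(* The spine of a caterpillar, and its traversal direction, need not be unique,
   so [P(H)] is a relation between [H] and the vertex sequence [P]. *)
Definition spiky_spine H P :=
  exists2 p : seq (induced H), spine p & P = map (@induced_val G H) p.

Definition triangular_spine H P :=
  exists (C : sgraph) (f : line_graph C -> induced H) (p : seq C),
    [/\ caterpillar_line_iso f, spine p, ipath P &
        forall v, v \in P <->
          exists2 E : line_graph C, ends_of E \subset p &
            v = induced_val (f E)].

(* [s0 :: rcons ss s1] is s_0, ..., s_{k+1} and [xs] is x_1, ..., x_k. *)
Definition connectifier_order H X P s :=
  exists (s0 s1 : G) (ss xs : seq G),
    [/\ s = s0 :: rcons ss s1 /\ size ss = size xs,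
        uniq s /\ s =i X,
        uniq xs /\
        (forall v, (v \in xs) =
           (v \in H :\: [set:: P]) && [exists u in P, v -- u]),
        forall x0 i j, i < j -> j < size xs ->
          forall u w, u \in P -> w \in P ->
            nth x0 xs i -- u -> nth x0 xs j -- w -> index u P <= index w P &
        (s0 -- head s0 P /\ s1 -- last s1 P) /\
        forall x0 i, i < size xs ->
          exists L, [/\ is_component (H :\: [set:: P]) L, nth x0 xs i \in L &
                        exists2 u, u \in L & nth x0 ss i -- u]].

(* Positions are 1-based: [x i] is the i-th vertex of [s], [q i] that of [P];
   [(index u P).+1] is the position of [u] on [P]. *)
Definition alignment P s :=
  let k := size s in let n := size P in
  [/\ ipath P /\ 0 < k, uniq s /\ [disjoint s & P],
      forall y, y \in s -> nbr_in y P != set0 &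
      forall x0, let x i := nth x0 s i.-1 in let q i := nth x0 P i.-1 in
        [/\ nbr_in (x 1) P = [set q 1], nbr_in (x k) P = [set q n] &
            exists j : nat -> nat,
              [/\ 1 < j 2, forall i, 2 <= i < k -> j i < j i.+1, j k = n &
                  forall i u, 2 <= i < k -> u \in nbr_in (x i) P ->
                    j i <= (index u P).+1 < j i.+1]]].

Definition alignment_on H X P s :=
  [/\ alignment P s, H = [set:: P] & X = [set:: s]].

(* x_2, ..., x_{k-1} *)
Definition inner s := behead (take (size s).-1 s).

Definition wide_alignment H X :=
  exists P s, alignment_on H X P s /\
    forall y, y \in inner s ->
      exists u w, [/\ u \in nbr_in y P, w \in nbr_in y P, u != w &
                      ~~ (u -- w)].

Definition spiky_alignment H X :=
  exists P s, alignment_on H X P s /\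
    forall y, y \in inner s -> #|nbr_in y P| = 1.

Definition triangular_alignment H X :=
  exists P s, alignment_on H X P s /\
    forall y, y \in inner s ->
      exists u w, nbr_in y P = [set u; w] /\ u -- w.

Definition gives_order H X s :=
  [\/ spiky_connectifier H X /\
        (exists2 P, spiky_spine H P & connectifier_order H X P s),
      triangular_connectifier H X /\
        (exists2 P, triangular_spine H P & connectifier_order H X P s) |
      exists P, alignment_on H X P s].

End Connectifiers.

(* Main.v *)
(* Inside D1 take a minimal connected set A that meets the neighbourhood of each
   of many vertices of Y. A vertex of A with many neighbours in Y, or in A (stable
   ones, by Ramsey, as cliques are small), is the centre of a star whose rays lead
   to Y. If all these degrees are bounded, a breadth-first tree of A has a long
   geodesic P from which many branches leave, each towards a private vertex of Y.
   This gives a ladder: pairwise anticomplete legs, possibly empty, from vertices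
   of Y to P. Two vertices of Y that see P around a common gap would create a theta
   or a prism with a path through D2, so the legs reach P in disjoint intervals, and
   by the pigeonhole principle all in the same way: in a single vertex, in an edge
   (triangular), or in two nonadjacent vertices (wide). Nonempty wide legs are
   removed by rerouting P through them.

   Doing this in D1 and then in D2, with the orders matched by Ramsey, leaves three
   vertices y1, y2, y3 of Y joined on each side by a path from y1 to y3 with a leg
   from y2. Two triangular sides form a prism, or, if neither has a leg, a hole
   through y1 and y3 for which y2 is a hub. Two nontriangular sides form a theta or
   such a hole, and a triangular and a wide side without legs form such a hole. Hence exactly one side is triangular. A ladder with empty
   legs contains an alignment, one with nonempty legs a comb, that is, a caterpillar
   or the line graph of one, and a star is a stellar connectifier. *)

(* Minimality of [A] is used in one way only: if [B] is a connected proper subset, some vertex of Y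
   has no neighbour in [B], so all its neighbours in [A] lie in the part that was removed. Removing
   pairwise anticomplete parts, one at a time and each with connected complement, thus yields
   distinct vertices of Y, each reached inside its own part; both the rays of stars and the nonempty
   legs of ladders arise so. The path P is a geodesic because a vertex at distance d from the root
   can see only the positions d-1, d, d+1 of P. Hence legs whose first vertices have distances
   differing by at least 3 see disjoint stretches of P, and a wide leg sees both d-1 and d+1, so
   that its first vertex can replace the one at position d. Stars and ladders are compared through
   one reduced form, a path between two vertices of Y with a leg from a third, which makes the
   exclusion of pairs a finite case analysis. Three vertices are needed for this; if x is at most 2,
   any edge already contains a forbidden clique. *)
Require Import Defs.
From mathcomp Require Import all_boot zify.

Set Implicit Arguments.
Unset Strict Implicit.
Unset Printing Implicit Defensive.


(** * Ramsey's theorem *)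

(** The type [T] is quantified inside, so that one bound, fixed before the graph is known, serves
    all graphs. *)
Definition ramsey_bound a b N := forall (T : finType) (e : rel T) (S : {set T}),
  symmetric e -> N <= #|S| ->
  (exists K : {set T}, [/\ K \subset S, #|K| = a &
     {in K &, forall u w, u != w -> e u w}]) \/
  (exists K : {set T}, [/\ K \subset S, #|K| = b &
     {in K &, forall u w, u != w -> ~~ e u w}]).

(** The usual double induction: a bound for a+1 and b+1 is one more than the sum of the bounds for
    the pairs in which one of the two is lowered. *)
Lemma ramsey a b : exists N, ramsey_bound a b N.
Proof.
elim: a b => [|a IHa] b.
  exists 0 => T e S _ _; left; exists set0; split; rewrite ?sub0set ?cards0 //.
  by move=> u w; rewrite inE.
elim: b => [|b [N2 H2]].
  exists 0 => T e S _ _; right; exists set0; split; rewrite ?sub0set ?cards0 //.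
  by move=> u w; rewrite inE.
have [N1 H1] := IHa b.+1.
exists (N1 + N2).+1 => T e S esym hS.
have /card_gt0P [v vS] : 0 < #|S| by lia.
pose S1 := [set w in S :\ v | e v w]; pose S2 := [set w in S :\ v | ~~ e v w].
have cS : #|S1| + #|S2| = #|S|.-1.
  rewrite (cardsD1 v S) vS /= -(cardsID [set w | e v w] (S :\ v)).
  have -> : S1 = (S :\ v) :&: [set w | e v w] by apply/setP => w; rewrite !inE.
  by have -> : S2 = (S :\ v) :\: [set w | e v w] by apply/setP => w; rewrite !inE andbC.
(* Both colours at once: [c] is the colour of the pairs inside [K] and of the pairs formed with
   [v]. *)
have ext (K : {set T}) (c : bool) : K \subset [set w in S :\ v | e v w == c] ->
    {in K &, forall u w, u != w -> e u w == c} ->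
    [/\ v |: K \subset S, #|v |: K| = #|K|.+1 &
        {in v |: K &, forall u w, u != w -> e u w == c}].
  move=> /subsetP hK hc; have vK : v \notin K.
    by apply/negP => /hK; rewrite !inE eqxx.
  split; last 1 first.
  - move=> u w /setU1P [->|uK] /setU1P [->|wK]; rewrite ?eqxx //.
    + by move=> _; move: (hK _ wK); rewrite inE => /andP [].
    + by move=> _; rewrite esym; move: (hK _ uK); rewrite inE => /andP [].
    + exact: hc.
  - by apply/subsetP => w /setU1P [->//|/hK]; rewrite !inE => /andP [/andP []].
  - by rewrite cardsU1 vK.
have [h|h] : N1 <= #|S1| \/ N2 <= #|S2| by lia.
- have [[K [sK cK hK]]|[K [sK cK hK]]] := H1 T e S1 esym h; [left|right].
  + have [||s1 s2 s3] := ext K true.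
    * by apply: subset_trans sK _; apply/subsetP => w; rewrite !inE eqb_id.
    * by move=> u w uK wK uw; rewrite hK.
    exists (v |: K); split=> //; first by rewrite s2 cK.
    by move=> u w uK wK uw; rewrite (eqP (s3 u w uK wK uw)).
  + exists K; split=> //; apply: subset_trans sK _.
    by apply/subsetP => w; rewrite !inE => /andP [/andP []].
- have [[K [sK cK hK]]|[K [sK cK hK]]] := H2 T e S2 esym h; [left|right].
  + exists K; split=> //; apply: subset_trans sK _.
    by apply/subsetP => w; rewrite !inE => /andP [/andP []].
  + have [||s1 s2 s3] := ext K false.
    * by apply: subset_trans sK _; apply/subsetP => w; rewrite !inE eqbF_neg.
    * by move=> u w uK wK uw; rewrite (negbTE (hK _ _ uK wK uw)).
    exists (v |: K); split=> //; first by rewrite s2 cK.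
    by move=> u w uK wK uw; rewrite (eqP (s3 u w uK wK uw)).
Qed.

Lemma subset_card (T : finType) (S : {set T}) n :
  n <= #|S| -> exists2 K : {set T}, K \subset S & #|K| = n.
Proof.
move=> h; exists [set:: take n (enum S)].
  by apply/subsetP => w; rewrite inE => /mem_take; rewrite mem_enum.
have -> : #|[set:: take n (enum S)]| = #|take n (enum S)|.
  by apply: eq_card => w; rewrite inE.
by rewrite (card_uniqP _) ?take_uniq ?enum_uniq // size_takel // -cardE.
Qed.

Lemma pigeonhole_bool (T : finType) (f : T -> bool) (S : {set T}) n :
  n + n <= #|S| -> exists (b : bool) (K : {set T}),
    [/\ K \subset S, #|K| = n & {in K, forall u, f u = b}].
Proof.
move=> hS; have := cardsID [set w | f w] S => cS.
have [h|h] : n <= #|S :&: [set w | f w]| \/ n <= #|S :\: [set w | f w]| by lia.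
- have [K /subsetP sK cK] := subset_card h; exists true, K; split=> //.
    by apply/subsetP => w /sK; rewrite !inE => /andP [].
  by move=> w /sK; rewrite !inE => /andP [].
- have [K /subsetP sK cK] := subset_card h; exists false, K; split=> //.
    by apply/subsetP => w /sK; rewrite !inE => /andP [].
  by move=> w /sK; rewrite !inE => /andP [/negbTE ].
Qed.

Lemma pigeonhole (T U : finType) (f : T -> U) (S : {set T}) (V : {set U}) n :
  {in S, forall u, f u \in V} -> #|V| * n < #|S| ->
  exists2 v, v \in V & n < #|[set u in S | f u == v]|.
Proof.
move=> fV h; apply/exists_inP; apply: contraLR h => /exists_inPn h.
rewrite -leqNgt -sum1_card (partition_big f (mem V)) //= -sum_nat_const.
apply: leq_sum => v vV; have := h v vV; rewrite -leqNgt -sum1_card.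
by apply: leq_trans; rewrite leq_eqVlt; apply/orP; left; apply/eqP; apply: eq_bigl => u; rewrite inE.
Qed.

(* [size] occurs both at [Finite.sort] and at [Equality.sort], which [lia] would
   treat as different terms. *)
Ltac slia := intros;
  repeat match goal with
  | H : is_true (sedge _ _) |- _ => clear H
  | H : is_true (~~ sedge _ _) |- _ => clear H
  | H : is_true (in_mem _ _) |- _ => clear H
  | H : is_true (~~ in_mem _ _) |- _ => clear H
  | H : is_true (uniq _) |- _ => clear H
  | H : is_true (disjoint _ _) |- _ => clear H
  | H : ipath _ |- _ => clear H
  | H : forall x : ?T, _ |- _ => lazymatch type of T with Prop => fail | _ => clear H end
  end;
  repeat match goal with
  | |- context [Equality.sort (fintype_Finite__to__eqtype_Equality ?F)] =>
    change (Equality.sort (fintype_Finite__to__eqtype_Equality F)) with (Finite.sort F)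
  | H : context [Equality.sort (fintype_Finite__to__eqtype_Equality ?F)] |- _ =>
    change (Equality.sort (fintype_Finite__to__eqtype_Equality F)) with (Finite.sort F) in H
  end; lia.

(** * Induced paths and connected sets *)

Section Paths.
Variable G : sgraph.
Implicit Types (u v w x y z : G) (p q : seq G).

Lemma edge_neq u v : u -- v -> u != v.
Proof. by apply: contraTneq => ->; rewrite sedge_irrefl. Qed.

Definition apart p q := forall u v, u \in p -> v \in q -> (u != v) && ~~ (u -- v).

Lemma apart_sym p q : apart p q -> apart q p.
Proof. by move=> h u v uq vp; rewrite eq_sym sedge_sym h. Qed.

Lemma apart_sub p q p' q' : {subset p' <= p} -> {subset q' <= q} ->
  apart p q -> apart p' q'.
Proof. by move=> sp sq h u v /sp up /sq vq; apply: h. Qed.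

Lemma apart_catl p1 p2 q : apart p1 q -> apart p2 q -> apart (p1 ++ p2) q.
Proof. by move=> h1 h2 u v; rewrite mem_cat => /orP [] uP vq; [apply: h1|apply: h2]. Qed.

Lemma apart_catr p q1 q2 : apart p q1 -> apart p q2 -> apart p (q1 ++ q2).
Proof. by move=> h1 h2; apply/apart_sym/apart_catl; apply: apart_sym. Qed.

Lemma apart_rconsl p x q : apart p q -> apart [:: x] q -> apart (rcons p x) q.
Proof. by rewrite -cats1; apply: apart_catl. Qed.

Lemma apart_rconsr p q x : apart p q -> apart p [:: x] -> apart p (rcons q x).
Proof. by rewrite -cats1; apply: apart_catr. Qed.

Lemma apart1 x q : (forall v, v \in q -> (x != v) && ~~ (x -- v)) -> apart [:: x] q.
Proof. by move=> h u v; rewrite inE => /eqP ->; apply: h. Qed.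

Lemma apart_anticomplete p q : apart p q -> anticomplete [set:: p] [set:: q].
Proof.
move=> h; apply/andP; split.
  apply/pred0P => u /=; rewrite !inE; apply/negP => /andP [up uq].
  by have := h u u up uq; rewrite eqxx.
apply/forall_inP => u; rewrite inE => up; apply/forall_inP => v; rewrite inE => vq.
by case/andP: (h u v up vq).
Qed.

Lemma ipath_adj p : ipath p -> {in p &, forall u v,
  u -- v = (index v p == (index u p).+1) || (index u p == (index v p).+1)}.
Proof.
case=> p0 Up hp u v up vp.
have iu : index u p < size p by rewrite index_mem.
have iv : index v p < size p by rewrite index_mem.
case: (ltngtP (index u p) (index v p)) => huv.
- by have := hp u _ _ huv iv; rewrite !nth_index // => ->; slia.
- by have := hp u _ _ huv iu; rewrite !nth_index // sedge_sym => ->; slia.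
- have -> : u = v by rewrite -(nth_index u up) huv nth_index.
  by rewrite sedge_irrefl; slia.
Qed.

Lemma ipath_intro p : p != [::] -> uniq p ->
  {in p &, forall u v, index u p < index v p ->
     u -- v = (index v p == (index u p).+1)} -> ipath p.
Proof.
move=> p0 Up h; split=> // x0 i j ij jp.
have ip : i < size p by slia.
by rewrite h ?mem_nth // !index_uniq.
Qed.

Lemma ipath_uniq p : ipath p -> uniq p. Proof. by case. Qed.

Lemma ipath1 x : ipath [:: x].
Proof. by split=> // x0 i [|j] //; rewrite ltnS ltn0. Qed.

Lemma ipath_consP x p : p != [::] ->
  (ipath (x :: p) <->
   [/\ x \notin p, ipath p & forall v, v \in p -> x -- v = (v == head x p)]).
Proof.
move=> p0; split.
  case=> _ /= /andP [xp Up] h; split=> //.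
    by split=> // x0 i j ij jp; have := h x0 i.+1 j.+1; rewrite ltnS /= eqSS => ->.
  move=> v vp; have := h x 0 (index v p).+1 isT; rewrite /= ltnS index_mem vp nth_index // => ->//.
  case: p p0 xp Up h vp => // z p _ _ _ _ _ /=.
  by rewrite eqSS [v == z]eq_sym; case: (z == v).
case=> xp [_ Up hp] h; split=> //; first by rewrite /= xp.
move=> x0 [|i] [|j] //=; rewrite ?ltnS => ij jp; last by rewrite hp // eqSS.
rewrite h ?mem_nth // eqSS; case: p p0 xp Up hp h ij jp => // z p _ _ Up _ _ _ jp /=.
by rewrite -[z]/(nth x0 (z :: p) 0) nth_uniq // .
Qed.

Lemma ipath_rev p : ipath p -> ipath (rev p).
Proof.
case=> p0 Up h; split; rewrite ?rev_uniq //.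
  by rewrite -size_eq0 size_rev size_eq0.
move=> x0 i j ij; rewrite size_rev => jp.
rewrite !nth_rev //; last by slia.
by rewrite sedge_sym h; slia.
Qed.

Lemma ipath_catl p q : p != [::] -> ipath (p ++ q) -> ipath p.
Proof.
move=> p0 [_]; rewrite cat_uniq => /and3P [Up _ _] h; split=> // x0 i j ij jp.
have := h x0 i j ij; rewrite size_cat !nth_cat jp (ltn_trans ij jp) => -> //; slia.
Qed.

Lemma ipath_catr p q : q != [::] -> ipath (p ++ q) -> ipath q.
Proof.
move=> q0 /ipath_rev; rewrite rev_cat => /ipath_catl h.
by rewrite -[q]revK; apply/ipath_rev/h; rewrite -size_eq0 size_rev size_eq0.
Qed.

Lemma ipath_join p q y :
  ipath (rcons p y) -> ipath (y :: q) -> apart p q -> ipath (p ++ y :: q).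
Proof.
elim: p => [//|x p IH] hp hq apq.
rewrite rcons_cons in hp; have n0 : rcons p y != [::] by case: (p).
have [xp hp' hx] := (ipath_consP x n0).1 hp.
have IHp : ipath (p ++ y :: q).
  by apply: IH => // u v up vq; apply: apq; rewrite // inE up orbT.
have n1 : p ++ y :: q != [::] by case: (p).
rewrite cat_cons; apply/(ipath_consP x n1); split=> //.
  rewrite mem_cat inE !negb_or; move: xp; rewrite mem_rcons inE negb_or => /andP [-> ->] /=.
  by apply/negP => xq; have := apq x x; rewrite inE eqxx xq => /(_ isT isT).
move=> v; have -> : head x (p ++ y :: q) = head x (rcons p y) by case: (p).
have -> : p ++ y :: q = rcons p y ++ q by rewrite cat_rcons.
rewrite mem_cat => /orP [|vq]; first exact: hx.
have /andP [_ /negbTE ->] := apq x v (mem_head _ _) vq.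
apply/esym/negbTE/negP => /eqP ev.
have : ~~ has (mem (rcons p y)) q.
  by have := ipath_uniq IHp; rewrite -cat_rcons cat_uniq => /and3P [].
by move/hasPn/(_ v vq)/negP; apply; rewrite ev; case: (p) => [|a l]; rewrite /= inE eqxx.
Qed.

Lemma ipath_join2 p q x y :
  ipath (rcons p x) -> ipath (y :: q) -> x -- y ->
  apart p (y :: q) -> apart [:: x] q -> ipath (rcons p x ++ y :: q).
Proof.
move=> hp hq xy h1 h2.
rewrite cat_rcons; apply: ipath_join => //.
apply/ipath_consP => //; split=> //=.
  rewrite inE negb_or edge_neq //=; apply/negP => xq.
  by have := h2 x x (mem_head _ _) xq; rewrite eqxx.
move=> v; rewrite inE => /orP [/eqP->|vq]; rewrite ?eqxx //.
have /andP [_ /negbTE ->] := h2 x v (mem_head _ _) vq.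
apply/esym/negbTE; apply: contraTneq vq => ->.
by case/andP: (ipath_uniq hq).
Qed.

(** Positions are 0-based and both ends are included. *)
Definition seg i j p := drop i (take j.+1 p).

Lemma mem_seg i j p u : uniq p ->
  (u \in seg i j p) = [&& u \in p, i <= index u p & index u p <= j].
Proof.
move=> Up; rewrite /seg; apply/idP/and3P.
  move=> h; have h1 := mem_drop h; have up := mem_take h1; split=> //.
    move: h => /(nthP u) [k]; rewrite size_drop size_take => hk <-.
    rewrite nth_drop nth_take; last by case: ifP hk; slia.
    by rewrite index_uniq //; case: ifP hk; slia.
  move: h1 => /(nthP u) [k]; rewrite size_take => hk <-.
  rewrite nth_take; last by case: ifP hk; slia.
  by rewrite index_uniq //; case: ifP hk; slia.
case=> up h1 h2; have hs : index u p < size p by rewrite index_mem.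
have hl : index u p - i < size (drop i (take j.+1 p)).
  by rewrite size_drop size_take; case: ifP; slia.
have := mem_nth u hl; rewrite nth_drop subnKC // nth_take ?nth_index //.
Qed.

Lemma size_seg i j p : j < size p -> size (seg i j p) = j.+1 - i.
Proof. by move=> h; rewrite /seg size_drop size_take; case: ifP; slia. Qed.

Lemma nth_seg x0 i j p k : i + k <= j -> nth x0 (seg i j p) k = nth x0 p (i + k).
Proof. by move=> h; rewrite /seg nth_drop nth_take //; slia. Qed.

Lemma ipath_seg i j p : ipath p -> i <= j -> j < size p -> ipath (seg i j p).
Proof.
move=> hp ij jp.
have e : p = take i p ++ seg i j p ++ drop j.+1 p.
  rewrite /seg -{1}(cat_take_drop j.+1 p) catA; congr (_ ++ _).
  by rewrite -{1}(cat_take_drop i (take j.+1 p)) take_takel //; slia.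
have n0 : seg i j p != [::] by rewrite -size_eq0 size_seg //; slia.
rewrite e in hp; apply: (ipath_catl (q := drop j.+1 p)) => //.
by apply: (ipath_catr (p := take i p)) => //; case: (seg i j p) n0.
Qed.

Lemma index_seg i j p u : uniq p -> u \in seg i j p -> index u (seg i j p) = index u p - i.
Proof.
move=> Up us; move: (us); rewrite mem_seg // => /and3P [up h1 h2].
have hs : index u p < size p by rewrite index_mem.
have e : u = nth u (seg i j p) (index u p - i) by rewrite nth_seg subnKC ?nth_index.
rewrite {1}e index_uniq //; first by rewrite /seg size_drop size_take; case: ifP; slia.
by rewrite /seg drop_uniq ?take_uniq.
Qed.

Lemma head_seg x0 i j p : i <= j -> j < size p -> head x0 (seg i j p) = nth x0 p i.
Proof. by move=> h1 h2; rewrite -nth0 nth_seg addn0. Qed.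

Lemma last_seg x0 i j p : i <= j -> j < size p -> last x0 (seg i j p) = nth x0 p j.
Proof.
move=> h1 h2; rewrite -nth_last size_seg // nth_seg; last by slia.
by congr nth; slia.
Qed.

Lemma seg_cons x0 i j p : i < size p -> i <= j -> seg i j p = nth x0 p i :: seg i.+1 j p.
Proof.
move=> h1 h2; rewrite /seg (drop_nth x0) ?size_take; last by case: ifP; slia.
by rewrite nth_take.
Qed.

Lemma seg_rcons x0 i j p : j.+1 < size p -> i <= j.+1 ->
  seg i j.+1 p = rcons (seg i j p) (nth x0 p j.+1).
Proof.
move=> h1 h2; by rewrite /seg (take_nth x0) // drop_rcons // size_take; move: h1 h2; case: ifP => // ; slia.
Qed.

End Paths.

Section Connected.
Variable G : sgraph.
Implicit Types (u v w x y z : G) (p q : seq G) (A B K : {set G}).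

Definition inrel B : rel G := [rel y z | [&& y \in B, z \in B & y -- z]].

(* Boolean, so that [minset] yields minimal connected sets. *)
Definition connected B := [forall u in B, forall v in B, connect (inrel B) u v].

Lemma connectedP B : reflect {in B &, forall u v, connect (inrel B) u v} (connected B).
Proof.
apply: (iffP forall_inP) => [h u v uB vB|h u uB]; first exact: (forall_inP (h u uB)).
by apply/forall_inP => v; apply: h.
Qed.

Lemma inrel_sym B : symmetric (inrel B).
Proof. by move=> u v; rewrite /inrel /= sedge_sym andbCA. Qed.

Lemma cinrel_sym B : connect_sym (inrel B).
Proof. exact/sym_connect_sym/inrel_sym. Qed.

Lemma connect_mem B u v : connect (inrel B) u v -> u \in B -> v \in B.
Proof.
case/connectP => p; elim: p u => [|w p IH] u /=; first by move=> _ ->.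
by case/andP => /and3P [_ wB _] hp e _; apply: IH hp e wB.
Qed.

Lemma connect_sub_set A B u v : A \subset B -> connect (inrel A) u v -> connect (inrel B) u v.
Proof.
move=> /subsetP s; apply: connect_sub => a b /and3P [aA bA ab].
by apply: connect1; rewrite /inrel /= !s.
Qed.

Definition component B u := [set w | connect (inrel B) u w].

Lemma component_self B u : u \in component B u.
Proof. by rewrite inE connect0. Qed.

Lemma component_sub B u : u \in B -> component B u \subset B.
Proof. by move=> uB; apply/subsetP => w; rewrite inE => /connect_mem ->. Qed.

Lemma component_closed B u w z : u \in B -> w \in component B u -> z \in B -> w -- z -> z \in component B u.
Proof.
move=> uB hw zB wz; have wB := subsetP (component_sub uB) _ hw.
rewrite !inE in hw *; apply: connect_trans hw _; apply: connect1.
by rewrite /inrel /= wB zB.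
Qed.

Lemma connect_component B u w : u \in B -> w \in component B u -> connect (inrel (component B u)) u w.
Proof.
move=> uB; rewrite inE => /connectP [p hp ->]; apply/connectP; exists p => //.
suff H v : v \in component B u -> path (inrel B) v p -> path (inrel (component B u)) v p.
  by apply: H; rewrite ?component_self.
elim: p v {hp} => //= z p IH v vc /andP [/and3P [vB zB vz] hp].
have zc := component_closed uB vc zB vz.
by apply/andP; split; [apply/and3P; split|apply: IH].
Qed.

Lemma component_connected B u : u \in B -> connected (component B u).
Proof.
move=> uB; apply/connectedP => v w vc wc.
by apply: (@connect_trans _ _ u); [rewrite cinrel_sym|]; apply: connect_component.
Qed.

Lemma component_eq B u w : w \in component B u -> component B w = component B u.
Proof.
rewrite inE => h; apply/setP => z; rewrite !inE.
by apply/idP/idP; apply: connect_trans => //; rewrite cinrel_sym.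
Qed.

Lemma connected_root A r : r \in A ->
  (forall w, w \in A -> connect (inrel A) w r) -> connected A.
Proof.
move=> rA h; apply/connectedP => u v uA vA; apply: connect_trans (h u uA) _.
by rewrite cinrel_sym h.
Qed.

Lemma connected_setU1 B y z : connected B -> z \in B -> y -- z -> connected (y |: B).
Proof.
move=> hB zB yz; apply: (@connected_root _ z); first by rewrite inE zB orbT.
move=> w /setU1P [->|wB].
  by apply: connect1; rewrite /inrel /= !inE eqxx zB yz orbT.
by apply: connect_sub_set (subsetUr _ _) _; apply: (connectedP _ hB).
Qed.

(** A shortest walk in [B] from [u] to a vertex satisfying [T]: a repeated vertex, a chord, or an
    earlier vertex satisfying [T] would shorten it. *)
Lemma ipath_to B u (T : pred G) : connected B -> u \in B ->
  (exists2 t, t \in B & T t) ->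
  exists p, [/\ ipath (u :: p), {subset u :: p <= B}, T (last u p) &
                forall z, z \in belast u p -> ~~ T z].
Proof.
move=> hB uB [t tB Tt].
pose Q n := [exists p : n.-tuple G, path (inrel B) u p && T (last u p)].
have exQ : exists n, Q n.
  case/connectP: (connectedP _ hB u t uB tB) => p hp e.
  by exists (size p); apply/existsP; exists (in_tuple p); rewrite hp -e.
case: (ex_minnP exQ) => n /existsP [[p /= /eqP sp] /andP [hp Tp]] minn.
have minp q : path (inrel B) u q -> T (last u q) -> size p <= size q.
  move=> h1 h2; rewrite sp; apply: minn; apply/existsP; exists (in_tuple q).
  by rewrite h1.
have hmem : {subset u :: p <= B}.
  move: (hp) => {}hp z; elim: p u uB hp {sp Tp minp exQ minn Q} => [|a p IH] v vB /=.
    by move=> _; rewrite inE => /eqP ->.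
  by case/andP => /and3P [_ aB _] hp; rewrite inE => /orP [/eqP ->//|]; apply: IH.
(* The two shortcuts: skip the part between two equal entries, or jump along a chord. *)
have short i j : i < j -> j < size (u :: p) ->
    nth u (u :: p) i = nth u (u :: p) j \/
    nth u (u :: p) i -- nth u (u :: p) j /\ i.+1 < j -> False.
  move=> ij js hij.
  have hb k : k < size (u :: p) -> last u (take k p) = nth u (u :: p) k.
    case: k => [|k] hk; first by rewrite take0.
    by rewrite (take_nth u) ?last_rcons.
  have hd k : k < size (u :: p) -> last (nth u (u :: p) k) (drop k p) = last u p.
    by move=> hk; rewrite -hb // -last_cat cat_take_drop.
  have hpt k : k < size (u :: p) -> path (inrel B) u (take k p) /\
      path (inrel B) (nth u (u :: p) k) (drop k p).
    by move=> hk; move: hp; rewrite -{1}(cat_take_drop k p) cat_path hb // => /andP [].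
  have iS : i < size (u :: p) by slia.
  have [p1 _] := hpt i iS; have [_ p2] := hpt j js.
  have jp : j <= size p by move: js; rewrite /= ltnS.
  case: hij => [e|[e ij2]].
    have := minp (take i p ++ drop j p); rewrite cat_path last_cat hb // p1 e p2 hd //.
    by rewrite size_cat size_take size_drop; case: ifP => ? /(_ isT Tp); slia.
  have := minp (take i p ++ nth u (u :: p) j :: drop j p).
  rewrite cat_path last_cat hb // p1 [last _ (_ :: _)]/= hd //.
  have -> : path (inrel B) (nth u (u :: p) i) (nth u (u :: p) j :: drop j p).
    by apply/andP; split=> //; apply/and3P; split; rewrite ?e //; apply/hmem/mem_nth.
  by rewrite size_cat /= size_take size_drop; case: ifP => ? /(_ isT Tp); slia.
exists p; split=> //.
  split=> //.
    apply/(uniqP u) => i j; rewrite !inE => hi hj e.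
    by case: (ltngtP i j) => // h; exfalso; [apply: (short i j)|apply: (short j i)]; auto.
  move=> x0 i j ij js; rewrite !(set_nth_default u x0) //; last by slia.
  have [e|ne] := eqVneq j i.+1.
    rewrite e; have /(pathP u) := hp; move/(_ i).
    rewrite e /= ltnS in js; move/(_ js); rewrite /inrel /= => /and3P [] _ _.
    by case: (i).
  apply/negbTE/negP => h; apply: (short i j) => //; right; split=> //; slia.
move=> z zb; apply/negP => Tz.
have /(nthP u) [k] := zb; rewrite size_belast => hk ek.
have ez : z = last u (take k p).
  rewrite -ek; case: (k) hk => [|k'] hk; first by case: (p) hk.
  rewrite (take_nth u) ?last_rcons //; last by slia.
  by rewrite -[RHS]/(nth u (u :: p) k'.+1) lastI nth_rcons size_belast hk.
have hpk : path (inrel B) u (take k p).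
  by move: hp; rewrite -{1}(cat_take_drop k p) cat_path => /andP [].
by have := minp _ hpk; rewrite -ez => /(_ Tz); rewrite size_take hk; slia.
Qed.

End Connected.

(** * Building thetas, prisms and hubs *)

Section Configurations.
Variable G : sgraph.
Implicit Types (u v w x y z : G) (p q M L : seq G) (D Y K : {set G}).

Lemma ipath_apart p x q : ipath (p ++ x :: q) -> apart p q.
Proof.
move=> h u v up vq; have U := ipath_uniq h.
have vc : v \in p ++ x :: q by rewrite mem_cat inE vq !orbT.
have uc : u \in p ++ x :: q by rewrite mem_cat up.
have vp : v \notin p.
  move: U; rewrite cat_uniq => /and3P [_ /hasPn hh _]; apply: hh.
  by rewrite inE vq orbT.
have vx : x != v.
  by apply: contraTneq vq => <-; move: U; rewrite cat_uniq => /and3P [_ _ /andP []].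
have ev : index v (p ++ x :: q) = size p + (index v q).+1.
  by rewrite index_cat (negbTE vp) /= (negbTE vx).
have eu : index u (p ++ x :: q) < size p by rewrite index_cat up index_mem.
rewrite (ipath_adj h) //; apply/andP; split; last by slia.
by apply: contraNneq vp => <-.
Qed.

Lemma theta_intro a b p1 p2 p3 :
  ipath (a :: rcons p1 b) -> ipath (a :: rcons p2 b) -> ipath (a :: rcons p3 b) ->
  p1 != [::] -> p2 != [::] -> p3 != [::] ->
  apart p1 p2 -> apart p1 p3 -> apart p2 p3 -> has_theta G.
Proof.
move=> h1 h2 h3 n1 n2 n3 h12 h13 h23.
exists a, b, (fun i : 'I_3 => nth [::] [:: p1; p2; p3] i); split.
  by case=> [] [|[|[|i]]].
have s := apart_sym.
by case=> [] [|[|[|i]]] // hi [] [|[|[|j]]] // hj; rewrite ?eqxx // => _;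
  apply: apart_anticomplete => /=; auto.
Qed.

(** The pattern between two paths of a prism: one edge of each triangle. The defaults of [head] and
    [last] are elements of the lists, which are therefore nonempty, so they never matter. *)
Definition joined p q := forall u w, u \in p -> w \in q ->
  (u != w) && (u -- w == (u == head u p) && (w == head w q) || (u == last u p) && (w == last w q)).

Lemma joined_sym p q : joined p q -> joined q p.
Proof.
move=> h u w uq wp; have := h w u wp uq; rewrite eq_sym sedge_sym.
by rewrite [(w == _) && _]andbC [(w == last _ _) && _]andbC.
Qed.

Lemma prism_intro p1 p2 p3 :
  ipath p1 -> ipath p2 -> ipath p3 ->
  2 <= size p1 -> 2 <= size p2 -> 2 <= size p3 ->
  joined p1 p2 -> joined p1 p3 -> joined p2 p3 -> has_prism G.
Proof.
move=> h1 h2 h3 n1 n2 n3 h12 h13 h23.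
have [x0 _] : exists x0 : G, True by case: (p1) n1 => // x0; exists x0.
pose P (i : 'I_3) := nth [::] [:: p1; p2; p3] i.
have hP i : ipath (P i) /\ 1 < size (P i) by case: i => [] [|[|[|i]]].
have J i j : i != j -> joined (P i) (P j).
  have s := joined_sym.
  by case: i j => [] [|[|[|i]]] // hi [] [|[|[|j]]] // hj; rewrite ?eqxx // => _; rewrite /P /=; auto.
have hd p u : u \in p -> head u p = head x0 p by case: p.
have lt p u : u \in p -> last u p = last x0 p by case: p.
exists (fun i => head x0 (P i)), (fun i => last x0 (P i)), P; split.
  by move=> i; case: (hP i) => hi si; split=> //; case: (P i) si.
move=> i j /J h; split.
  apply/pred0P => u /=; apply/negP => /andP [up uq].
  by have := h u u up uq; rewrite eqxx.
move=> u w up wq; case/andP: (h u w up wq) => _ /eqP ->.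
by rewrite !hd // !lt.
Qed.

Lemma hole_intro x p : ipath p -> x \notin p -> 3 <= size p ->
  (forall v, v \in p -> x -- v = (v == head x p) || (v == last x p)) -> hole (x :: p).
Proof.
move=> [p0 Up h] xp sp hx; split=> //=; first by rewrite xp.
move=> x0 [|i] [|j] //=; rewrite ?ltnS => ij js; last by rewrite h // eqSS ?orbF.
rewrite hx ?mem_nth // eqSS -nth0 -nth_last !(set_nth_default x0 x) //; try slia.
by rewrite !nth_uniq //; slia.
Qed.

Lemma hole_join y1 y3 M M' :
  ipath (y1 :: rcons M y3) -> ipath (y1 :: rcons M' y3) -> apart M M' ->
  M != [::] -> M' != [::] -> hole (y1 :: M ++ y3 :: rev M').
Proof.
move=> h h' aM M0 M0'.
have n0 (N : seq G) : rcons N y3 != [::] by case: N.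
have [y1M hM e1] := (ipath_consP y1 (n0 M)).1 h.
have [y1M' hM' e1'] := (ipath_consP y1 (n0 M')).1 h'.
apply: hole_intro.
- apply: ipath_join => //; first by rewrite -rev_rcons; apply: ipath_rev.
  by apply: apart_sub aM => // u; rewrite mem_rev.
- move: y1M y1M'; rewrite !mem_rcons mem_cat !inE mem_rev !negb_or => /andP [-> ->] /andP [_ ->] //.
- have sM : 0 < size M by case: (M) M0.
  have sM' : 0 < size M' by case: (M') M0'.
  by rewrite size_cat /= size_rev; slia.
move=> v; rewrite mem_cat inE mem_rev.
have -> : head y1 (M ++ y3 :: rev M') = head y1 (rcons M y3) by case: (M).
have -> : last y1 (M ++ y3 :: rev M') = head y1 (rcons M' y3).
  rewrite last_cat /=; case: (M') M0' => // a l _; by rewrite rev_cons last_rcons.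
have hd (N N' : seq G) w : N != [::] -> ipath (rcons N y3) -> w \in rcons N' y3 -> apart N N' -> w == head y1 (rcons N y3) -> False.
  case: N => // a l _ hN; rewrite mem_rcons inE => /orP [/eqP -> _|wN' ap] /= /eqP e.
    by move: (ipath_uniq hN); rewrite e /= mem_rcons inE eqxx.
  by have := ap a w (mem_head _ _) wN'; rewrite e eqxx.
have ap' := apart_sym aM.
case/or3P => hv.
- rewrite e1 ?mem_rcons ?inE ?hv ?orbT //.
  have -> : (v == head y1 (rcons M' y3)) = false; last by rewrite orbF.
  by apply/negP; apply: hd ap' => //; rewrite mem_rcons inE hv orbT.
- rewrite (eqP hv) e1 ?mem_rcons ?inE ?eqxx //.
  have -> : (y3 == head y1 (rcons M' y3)) = false; last by rewrite orbF.
  by apply/negP; apply: hd ap' => //; rewrite mem_rcons inE eqxx.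
- rewrite e1' ?mem_rcons ?inE ?hv ?orbT //.
  have -> : (v == head y1 (rcons M y3)) = false by apply/negP; apply: hd aM => //; rewrite mem_rcons inE hv orbT.
  by [].
Qed.

(** In twin wheels and short pyramids the vertex has exactly three neighbours on the hole, two of
    them adjacent. Four neighbours, or three that form a stable set, exclude both. *)
Lemma hub_intro c v K : hole c -> K \subset nbr_in v c ->
  4 <= #|K| \/ (3 <= #|K| /\ stable K) -> Hub v.
Proof.
move=> hc sK hK; have cK := subset_leq_card sK.
exists c; split.
- by split=> //; case: hK => [|[]]; slia.
- case=> _ [p [hp sp e]]; have cp : #|nbr_in v c| = 3.
    rewrite e -sp -(card_uniqP (ipath_uniq hp)).
    by apply: eq_card => u; rewrite inE.
  case: hK => [|[h3 /forall_inP st]]; first by slia.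
  have eK : K = nbr_in v c by apply/eqP; rewrite eqEcard sK cp h3.
  case: p hp sp e {cp} => [|a [|b [|d [|? ?]]]] //= [_ _ h] _ e.
  have aK : a \in K by rewrite eK e !inE eqxx.
  have bK : b \in K by rewrite eK e !inE eqxx orbT.
  by move: (forall_inP (st a aK) b bK); rewrite (h a 0 1).
- case=> _ cp [a [b [d [e ab _ _]]]].
  case: hK => [|[h3 /forall_inP st]]; first by slia.
  have eK : K = nbr_in v c by apply/eqP; rewrite eqEcard sK cp h3.
  have aK : a \in K by rewrite eK e !inE eqxx.
  have bK : b \in K by rewrite eK e !inE eqxx orbT.
  by move: (forall_inP (st a aK) b bK); rewrite ab.
Qed.

Inductive attach := Single | Triangle | Wide.

(** In the [Wide] case [u] and [w] are the first and last neighbours of [e]; nothing is required of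
    the vertices of [m] between them. *)
Definition attached_as (k : attach) M e := match k with
  | Single => exists l c r, [/\ M = l ++ c :: r, e -- c, apart [:: e] l & apart [:: e] r]
  | Triangle => exists l u w r, [/\ M = l ++ u :: w :: r, e -- u, e -- w,
                                    apart [:: e] l & apart [:: e] r]
  | Wide => exists l u m w r, [/\ M = l ++ u :: m ++ w :: r, m != [::], e -- u /\ e -- w,
                                  apart [:: e] l & apart [:: e] r]
  end.

(** The reduced form in which the two sides are compared: a path from [y1] to [y3] with interior
    [M], and a leg from [y2] to it. The leg is read from its end near [M]; if [L] is empty, that end
    is [y2] itself, hence [head y2 L] and [rcons L y2]. *)
Definition bridge D (k : attach) y1 y2 y3 M L :=
  [/\ ipath (y1 :: rcons M y3),
      {subset M <= D} /\ {subset L <= D},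
      ipath (rcons L y2) /\ apart (rcons L y2) [:: y1; y3],
      apart (behead (rcons L y2)) M &
      attached_as k M (head y2 L)].

Definition separated D1 D2 Y :=
  [/\ forall u v, u \in D1 -> v \in D2 -> (u != v) && ~~ (u -- v),
      [disjoint D1 & Y] & [disjoint D2 & Y]].

Lemma separated_sym D1 D2 Y : separated D1 D2 Y -> separated D2 D1 Y.
Proof. by case=> h h1 h2; split=> // u v uD vD; rewrite eq_sym sedge_sym h. Qed.

Lemma separated_apart D1 D2 Y p q : separated D1 D2 Y ->
  {subset p <= D1} -> {subset q <= D2} -> apart p q.
Proof. by case=> h _ _ sp sq u v /sp up /sq vq; apply: h. Qed.

Definition tripod c y1 y2 y3 t1 t2 t3 :=
  [/\ [/\ ipath (c :: rcons t1 y1), ipath (c :: rcons t2 y2) & ipath (c :: rcons t3 y3)],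
      apart (rcons t1 y1) (rcons t2 y2), apart (rcons t1 y1) (rcons t3 y3) &
      apart (rcons t2 y2) (rcons t3 y3)].

Lemma ipath_center c p y : ipath (rcons p y) -> c -- head y p ->
  apart [:: c] (behead (rcons p y)) -> ipath (c :: rcons p y).
Proof.
move=> hp cy ap.
have -> : rcons p y = [:: head y p] ++ behead (rcons p y) by case: (p).
apply: (@ipath_join2 _ [::] _ c) => //=; first exact: ipath1.
by case: (p) hp.
Qed.

(** The unique neighbour of the leg on [M] becomes the centre and splits [M] into the other two
    arms. *)
Lemma bridge_tripod D y1 y2 y3 M L : bridge D Single y1 y2 y3 M L ->
  exists c t1 t3, [/\ c \in D, {subset t1 <= D} /\ {subset t3 <= D}, c \notin rcons L y2 & tripod c y1 y2 y3 t1 L t3].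
Proof.
case=> hM [sM sL] [hL aL] bL [l [c [r [eM ec el er]]]].
have cM : c \in M by rewrite eM mem_cat inE eqxx orbT.
exists c, (rev l), r.
have hlr : ipath ((y1 :: l) ++ c :: rcons r y3) by rewrite eM -cats1 -catA cat_cons cats1 in hM.
have aH : apart [:: head y2 L] (rcons (rev l) y1) /\ apart [:: head y2 L] (rcons r y3).
  have hLy : head y2 L \in rcons L y2 by case: (L) => *; rewrite /= inE eqxx.
  split; apply: apart_rconsr; try by apply: apart_sub aL => u; rewrite !inE => /eqP ->; rewrite ?eqxx ?orbT.
  - by apply: apart_sub el => // u; rewrite mem_rev.
  - by [].
have aB : apart (behead (rcons L y2)) (rcons (rev l) y1) /\ apart (behead (rcons L y2)) (rcons r y3).
  split; apply: apart_rconsr.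
  - by apply: apart_sub bL => // u; rewrite mem_rev eM mem_cat => ->.
  - by apply: apart_sub aL => [u /mem_behead //|u]; rewrite !inE => ->.
  - by apply: apart_sub bL => // u ur; rewrite eM mem_cat inE ur !orbT.
  - by apply: apart_sub aL => [u /mem_behead //|u]; rewrite !inE => ->; rewrite orbT.
have sp : rcons L y2 = [:: head y2 L] ++ behead (rcons L y2) by case: (L).
have cL : c \notin rcons L y2.
  rewrite sp mem_cat inE negb_or [c == _]eq_sym edge_neq //=.
  by apply/negP => h; have := bL c c h cM; rewrite eqxx.
split=> //; first exact: sM.
  by split=> u h; apply: sM; rewrite eM mem_cat ?inE -?(mem_rev l) h ?orbT.
split.
- split.
  + have := ipath_rev (ipath_catl (p := rcons (y1 :: l) c) (q := rcons r y3) isT _).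
    by rewrite cat_rcons rev_rcons rev_cons => /(_ hlr).
  + apply: ipath_center => //; first by rewrite sedge_sym.
    by apply: apart_sym; apply: apart_sub bL => // u; rewrite inE => /eqP ->.
  + by apply: ipath_catr hlr.
- rewrite sp; apply/apart_sym/apart_catl; [exact: aH.1|exact: aB.1].
- by apply: apart_sub (ipath_apart hlr) => u; rewrite // mem_rcons !inE mem_rev.
- rewrite sp; apply/apart_catl; [exact: aH.2|exact: aB.2].
Qed.

(** The ends of the theta are [c] and [c']. Each of its paths passes through one of the three
    vertices of [Y], so its interior is nonempty even if both arms are empty. *)
Lemma theta_tripods D1 D2 Y c c' y1 y2 y3 t1 t2 t3 t1' t2' t3' :
  separated D1 D2 Y -> c \in D1 -> c' \in D2 ->
  {subset t1 ++ t2 ++ t3 <= D1} -> {subset t1' ++ t2' ++ t3' <= D2} ->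
  tripod c y1 y2 y3 t1 t2 t3 -> tripod c' y1 y2 y3 t1' t2' t3' -> has_theta G.
Proof.
move=> sD cD cD' s s' [[h1 h2 h3] a12 a13 a23] [[h1' h2' h3'] a12' a13' a23'].
have s1 : {subset t1 <= D1} by move=> u h; apply: s; rewrite mem_cat h.
have s2 : {subset t2 <= D1} by move=> u h; apply: s; rewrite !mem_cat h orbT.
have s3 : {subset t3 <= D1} by move=> u h; apply: s; rewrite !mem_cat h !orbT.
have s1' : {subset t1' <= D2} by move=> u h; apply: s'; rewrite mem_cat h.
have s2' : {subset t2' <= D2} by move=> u h; apply: s'; rewrite !mem_cat h orbT.
have s3' : {subset t3' <= D2} by move=> u h; apply: s'; rewrite !mem_cat h !orbT.
have P t t' y : {subset t <= D1} -> {subset t' <= D2} ->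
    ipath (c :: rcons t y) -> ipath (c' :: rcons t' y) ->
    ipath (c :: rcons (t ++ y :: rev t') c').
  move=> st st' h h'; rewrite rcons_cat -cat_cons rcons_cons.
  apply: ipath_join => //; first by rewrite -rev_cons -rev_rcons; apply: ipath_rev.
  apply: separated_apart sD _ _ => u; first by rewrite inE => /orP [/eqP ->|/st].
  by rewrite mem_rcons inE mem_rev => /orP [/eqP ->|/st'].
have A t t' y r r' z : {subset t <= D1} -> {subset t' <= D2} -> {subset r <= D1} -> {subset r' <= D2} ->
    apart (rcons t y) (rcons r z) -> apart (rcons t' y) (rcons r' z) ->
    apart (t ++ y :: rev t') (r ++ z :: rev r').
  move=> st st' sr sr' a a'.
  have st2 : {subset rev t' <= D2} by move=> u; rewrite mem_rev => /st'.
  have sr2 : {subset rev r' <= D2} by move=> u; rewrite mem_rev => /sr'.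
  rewrite -!cat_rcons; apply: apart_catl; apply: apart_catr => //.
  - apply: apart_rconsl; first exact: separated_apart sD _ _.
    by apply: apart_sub a' => u; rewrite ?mem_rev !mem_rcons !inE => ->; rewrite ?orbT.
  - apply: apart_rconsr; first exact: separated_apart (separated_sym sD) _ _.
    by apply: apart_sub a' => u; rewrite ?mem_rev !mem_rcons !inE => ->; rewrite ?orbT.
  - by apply: apart_sub a' => u; rewrite ?mem_rev !mem_rcons !inE => ->; rewrite ?orbT.
apply: (@theta_intro c c' (t1 ++ y1 :: rev t1') (t2 ++ y2 :: rev t2') (t3 ++ y3 :: rev t3'));
  auto; by [case: (t1)|case: (t2)|case: (t3)].
Qed.

End Configurations.

(** * Pairs of bridges that create a theta, a prism or a hub *)

Section Combinations.
Variable G : sgraph.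
Implicit Types (u v w x y z : G) (p q r M L t : seq G) (D Y K : {set G}).

Lemma theta_single_single D1 D2 Y y1 y2 y3 M L M' L' : separated D1 D2 Y ->
  bridge D1 Single y1 y2 y3 M L -> bridge D2 Single y1 y2 y3 M' L' -> has_theta G.
Proof.
move=> sD b1 b2; have [_ [_ sL] _ _ _] := b1; have [_ [_ sL'] _ _ _] := b2.
have [c [t1 [t3 [cD [s1 s3] _ T]]]] := bridge_tripod b1.
have [c' [t1' [t3' [cD' [s1' s3'] _ T']]]] := bridge_tripod b2.
by apply: (theta_tripods sD cD cD') T T' => u; rewrite !mem_cat => /or3P []; auto.
Qed.

(** The part of [M] between the extreme neighbours of [y2] is dropped. Since it is nonempty, the two
    arms that remain see each other only through [y2]. *)
Lemma bridge_wide_arms D y1 y2 y3 M : bridge D Wide y1 y2 y3 M [::] ->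
  exists t1 t3, [/\ {subset t1 <= M}, {subset t3 <= M}, t1 != [::] /\ t3 != [::],
     ipath (y2 :: rcons t1 y1) /\ ipath (y2 :: rcons t3 y3) &
     apart (rcons t1 y1) (rcons t3 y3)].
Proof.
case=> hM [sM _] [_ aL] _ /= [l [u [m [w [r [eM m0 [yu yw] al ar]]]]]].
have a13 : apart [:: y2] [:: y1] /\ apart [:: y2] [:: y3].
  by split; apply: apart_sub aL => // v; rewrite !inE => ->; rewrite ?orbT.
have h : ipath ((y1 :: rcons l u) ++ m ++ w :: rcons r y3).
  have <- // : y1 :: rcons M y3 = (y1 :: rcons l u) ++ m ++ w :: rcons r y3.
  by rewrite eM -!cats1 /= -?catA /= -?catA /= -?catA.
have h1 : ipath (rcons (u :: rev l) y1).
  have := ipath_rev (ipath_catl (p := y1 :: rcons l u) isT h).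
  by rewrite rev_cons rev_rcons.
have h3 : ipath (rcons (w :: r) y3).
  have := h; rewrite catA => hh; have := ipath_catr _ hh.
  by rewrite -[w :: rcons _ _]/([::] ++ (w :: rcons r y3)) => /(_ isT).
exists (u :: rev l), (w :: r); split=> //.
- by move=> v; rewrite eM inE mem_rev mem_cat inE => /orP [] ->; rewrite ?orbT.
- by move=> v; rewrite eM inE !mem_cat !inE mem_cat inE => /orP [] ->; rewrite ?orbT.
- split; apply: ipath_center => //=; apply: apart_rconsr => //; try exact: a13.1; try exact: a13.2.
  by apply: apart_sub al => // v; rewrite mem_rev.
- case: m m0 h {eM} => // a m _ h'; have := @ipath_apart _ (y1 :: rcons l u) a _ h'.
  apply: apart_sub => v; first by rewrite !(inE, mem_rcons, mem_rev) => /or3P [] ->; rewrite ?orbT.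
  by rewrite mem_cat /= => ->; rewrite orbT.
Qed.

(** The theta joins [c] to [y2]: one path is [L], the other two pass through [y1] and [y3] and
    return along the wide side. As [L] is nonempty, [c] and [y2] are not adjacent. *)
Lemma theta_single_wide D1 D2 Y y1 y2 y3 M L M' : separated D1 D2 Y ->
  y1 \in Y -> y2 \in Y -> y3 \in Y -> L != [::] ->
  bridge D1 Single y1 y2 y3 M L -> bridge D2 Wide y1 y2 y3 M' [::] -> has_theta G.
Proof.
move=> sD y1Y y2Y y3Y L0 b1 b2; have [_ [_ sL] _ _ _] := b1; have [_ [sM' _] _ _ _] := b2.
have [c [t1 [t3 [cD [s1 s3] _ [[h1 h2 h3] a12 a13 a23]]]]] := bridge_tripod b1.
have [t1' [t3' [s1' s3' [n1 n3] [h1' h3'] a13']]] := bridge_wide_arms b2.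
have cy : apart [:: c] [:: y2].
  case: (L) L0 h2 => // a l _ h2; have := @ipath_apart _ [:: c] a (rcons l y2) h2.
  by apply: apart_sub => // v; rewrite mem_rcons !inE => ->.
have ty t y : apart (rcons t y) (rcons L y2) -> apart t [:: y2].
  by apply: apart_sub => v; rewrite mem_rcons !inE => ->; rewrite ?orbT.
have P t t' y : {subset t <= D1} -> {subset t' <= M'} -> apart t [:: y2] ->
    ipath (c :: rcons t y) -> ipath (y2 :: rcons t' y) ->
    ipath (c :: rcons (t ++ y :: rev t') y2).
  move=> st st' aty h h'; rewrite rcons_cat -cat_cons rcons_cons.
  apply: ipath_join => //; first by rewrite -rev_cons -rev_rcons; apply: ipath_rev.
  apply: apart_rconsr; last exact: (@apart_catl _ [:: c] t).
  apply: separated_apart sD _ _ => u; first by rewrite inE => /orP [/eqP ->|/st].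
  by rewrite mem_rev => /st' /sM'.
have a2 t t' y : {subset t' <= M'} -> ipath (y2 :: rcons t' y) ->
    apart (rcons t y) (rcons L y2) -> apart L (t ++ y :: rev t').
  move=> st' h' a; rewrite -cat_rcons; apply: apart_catr.
    by apply: apart_sub (apart_sym a) => // u; rewrite mem_rcons inE => ->; rewrite orbT.
  by apply: separated_apart sD sL _ => u; rewrite mem_rev => /st' /sM'.
apply: (@theta_intro _ c y2 (t1 ++ y1 :: rev t1') L (t3 ++ y3 :: rev t3')) => //.
- by apply: P => //; apply: ty a12.
- by apply: P => //; apply: ty (apart_sym a23).
- by case: (t1).
- by case: (t3).
- by apply/apart_sym/a2.
- have s1r : {subset rev t1' <= D2} by move=> u; rewrite mem_rev => /s1' /sM'.
  have s3r : {subset rev t3' <= D2} by move=> u; rewrite mem_rev => /s3' /sM'.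
  rewrite -!cat_rcons; apply: apart_catl; apply: apart_catr => //.
  + apply: apart_rconsl; first exact: separated_apart sD _ _.
    by apply: apart_sub a13' => u; rewrite ?mem_rev !mem_rcons !inE => ->; rewrite ?orbT.
  + apply: apart_rconsr; first exact: separated_apart (separated_sym sD) _ _.
    by apply: apart_sub a13' => u; rewrite ?mem_rev !mem_rcons !inE => ->; rewrite ?orbT.
  + by apply: apart_sub a13' => u; rewrite ?mem_rev !mem_rcons !inE => ->; rewrite ?orbT.
- by apply: a2 => //; apply: apart_sym.
Qed.

Lemma attached_as_neighbour k M e : attached_as k M e -> exists2 a, a \in M & e -- a.
Proof.
case: k => [[l [c [r [-> ec _ _]]]]|[l [c [w [r [-> ec _ _ _]]]]]|[l [c [m [w [r [-> _ [ec _] _ _]]]]]]];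
  by exists c; rewrite // mem_cat inE eqxx orbT.
Qed.

Lemma bridge_nonempty D k y1 y2 y3 M L : bridge D k y1 y2 y3 M L -> M != [::].
Proof. by case=> _ _ _ _ /attached_as_neighbour [a aM _]; apply: contraTneq aM => ->. Qed.

(** On the hole formed by the two paths from [y1] to [y3], [y2] sees a vertex of [M] and two
    nonadjacent vertices of [M']. Vertices on different sides are nonadjacent, so these three are
    stable. *)
Lemma hub_wide D1 D2 Y k y1 y2 y3 M M' : separated D1 D2 Y ->
  bridge D1 k y1 y2 y3 M [::] -> bridge D2 Wide y1 y2 y3 M' [::] -> Hub y2.
Proof.
move=> sD b1 b2; have n1 := bridge_nonempty b1; have n2 := bridge_nonempty b2.
case: b1 b2 => hM [sM _] _ _ /attached_as_neighbour [a aM ya] [hM' [sM' _] _ _ /=].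
case=> [l [u [m [w [r [eM m0 [yu yw] al ar]]]]]].
have uM : u \in M' by rewrite eM mem_cat inE eqxx orbT.
have wM : w \in M' by rewrite eM mem_cat inE mem_cat inE eqxx !orbT.
have sep := separated_apart sD sM sM'.
have /andP [au au'] := sep a u aM uM; have /andP [aw aw'] := sep a w aM wM.
have /andP [uw uw'] : (u != w) && ~~ (u -- w).
  case: m m0 eM => // b m _ eM; have h : ipath ((y1 :: rcons l u) ++ b :: m ++ w :: rcons r y3).
    have <- // : y1 :: rcons M' y3 = (y1 :: rcons l u) ++ b :: m ++ w :: rcons r y3.
    by rewrite eM -!cats1 /= -?catA /= -?catA /= -?catA.
  by apply: (ipath_apart h); rewrite ?inE ?mem_rcons ?mem_cat ?inE ?eqxx ?orbT.
apply: (@hub_intro _ (y1 :: M ++ y3 :: rev M') y2 [set a; u; w]).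
- by apply: hole_join => //; apply: sep.
- apply/subsetP => v; rewrite !inE mem_cat inE mem_rev => /orP [/orP []|] /eqP ->;
    by rewrite ?ya ?yu ?yw ?aM ?uM ?wM ?orbT.
- right; split.
    by rewrite -setUA cardsU1 cards2 !inE negb_or uw au aw.
  apply/forall_inP => v1; rewrite !inE => /orP [/orP []|] /eqP ->; apply/forall_inP => v2;
  rewrite !inE => /orP [/orP []|] /eqP ->; rewrite ?sedge_irrefl // sedge_sym //.
Qed.

(** Two neighbours on each side give four on the hole, too many for a twin wheel or a short
    pyramid. *)
Lemma hub_triangles D1 D2 Y y1 y2 y3 M M' : separated D1 D2 Y ->
  bridge D1 Triangle y1 y2 y3 M [::] -> bridge D2 Triangle y1 y2 y3 M' [::] -> Hub y2.
Proof.
move=> sD b1 b2; have n1 := bridge_nonempty b1; have n2 := bridge_nonempty b2.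
case: b1 b2 => hM [sM _] _ _ [l [u [w [r [eM yu yw al ar]]]]].
case=> hM' [sM' _] _ _ [l' [u' [w' [r' [eM' yu' yw' al' ar']]]]].
have uM : u \in M by rewrite eM mem_cat inE eqxx orbT.
have wM : w \in M by rewrite eM mem_cat !inE eqxx !orbT.
have uM' : u' \in M' by rewrite eM' mem_cat inE eqxx orbT.
have wM' : w' \in M' by rewrite eM' mem_cat !inE eqxx !orbT.
have sep := separated_apart sD sM sM'.
have uw (N l0 r0 : seq G) (a b : G) : N = l0 ++ a :: b :: r0 -> ipath (y1 :: rcons N y3) -> a != b.
  move=> -> /ipath_uniq /= /andP [_]; rewrite -cats1 -catA cat_uniq.
  by move=> /and3P [_ _] /=; rewrite inE negb_or => /andP [/andP []].
have := (uw _ _ _ _ _ eM hM, uw _ _ _ _ _ eM' hM').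
case=> uw1 uw2.
apply: (@hub_intro _ (y1 :: M ++ y3 :: rev M') y2 ([set u; w] :|: [set u'; w'])).
- by apply: hole_join => //; apply: sep.
- apply/subsetP => v; rewrite !inE mem_cat inE mem_rev.
  by case/orP => /orP [] /eqP ->; move: yu yw yu' yw'; rewrite /= ?uM ?wM ?uM' ?wM' ?orbT => ? ? ? ?; apply/andP.
- left; rewrite cardsU disjoint_setI0 ?cards0 ?subn0 ?cards2 ?uw1 ?uw2 //.
  apply/pred0P => v /=; apply/negP; rewrite !inE => /andP [h1 h2].
  have vM : v \in M by case/orP: h1 => /eqP ->.
  have vM' : v \in M' by case/orP: h2 => /eqP ->.
  by have := sep v v vM vM'; rewrite eqxx.
Qed.

(** What one side contributes to [joined]: an edge of one triangle, at the heads of the two arms. *)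
Definition head_joined p q := forall u v, u \in p -> v \in q ->
  (u != v) && (u -- v == (u == head u p) && (v == head v q)).

(** The triangle consists of the end of the leg and its two neighbours on [M]; three arms run from
    it to [y1], [y2] and [y3]. *)
Lemma bridge_triangle_arms D y1 y2 y3 M L : bridge D Triangle y1 y2 y3 M L ->
  exists t1 t3, [/\ {subset t1 <= D} /\ {subset t3 <= D}, t1 != [::] /\ t3 != [::],
    [/\ ipath (rcons t1 y1), ipath (rcons L y2) & ipath (rcons t3 y3)],
    head_joined (rcons t1 y1) (rcons L y2) /\ head_joined (rcons t1 y1) (rcons t3 y3) &
    head_joined (rcons L y2) (rcons t3 y3)].
Proof.
case=> hM [sM sL] [hL aL] bL [l [u [w [r [eM eu ew al ar]]]]].
have h : ipath ((y1 :: rcons l u) ++ (w :: rcons r y3)).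
  have <- // : y1 :: rcons M y3 = (y1 :: rcons l u) ++ w :: rcons r y3.
  by rewrite eM -!cats1 /= -?catA /= -?catA /= -?catA.
have h1 : ipath (rcons (u :: rev l) y1).
  have := ipath_rev (ipath_catl (p := y1 :: rcons l u) isT h).
  by rewrite rev_cons rev_rcons.
have h3 : ipath (rcons (w :: r) y3) by apply: ipath_catr h.
have U := ipath_uniq h.
have eL : rcons L y2 = head y2 L :: behead (rcons L y2) by case: (L).
have leg (t : seq G) (a y : G) : {subset a :: t <= M} -> y \in [:: y1; y3] ->
    apart [:: head y2 L] t -> head y2 L -- a -> head_joined (rcons L y2) (a :: rcons t y).
  move=> st yy at' ea v1 v2 v1L v2t.
  have -> : head v1 (rcons L y2) = head y2 L by case: (L).
  move: (v1L); rewrite {1}eL inE; case/orP => [/eqP e1|v1b].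
    rewrite e1 eqxx /=.
    move: v2t; rewrite inE mem_rcons inE; case/orP => [/eqP ->|/orP [/eqP ->|v2t]].
    - by rewrite ea eqxx edge_neq.
    - have /andP [n1 n2] : (head y2 L != y) && ~~ (head y2 L -- y).
        by apply: aL => //; rewrite -e1.
      rewrite n1 (negbTE n2) /= eq_sym eqbF_neg.
      by apply: contraNneq n2 => ->.
    - have /andP [n1 n2] := at' _ _ (mem_head _ _) v2t.
      by rewrite n1 (negbTE n2) /= eq_sym eqbF_neg; apply: contraNneq n2 => ->.
  have /andP [n1 n2] : (v1 != v2) && ~~ (v1 -- v2).
    move: v2t; rewrite -rcons_cons mem_rcons inE; case/orP => [/eqP ->|v2t].
      by apply: aL => //.
    by apply: bL => //; apply: st.
  rewrite n1 (negbTE n2) /= eq_sym eqbF_neg.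
  have -> : (v1 == head y2 L) = false; last by [].
  have := ipath_uniq hL; rewrite eL => /andP [hh _].
  by apply/negbTE; apply: contraNneq hh => <-.
exists (u :: rev l), (w :: r); split=> //.
- split=> v hv; apply: sM; move: hv; rewrite eM !inE mem_cat ?mem_rev !inE => /orP [] ->; rewrite ?orbT //.
- split; last first.
    move=> v1 v2; rewrite !rcons_cons => h1' h2'.
    have hv1 : v1 \in y1 :: rcons l u by move: h1'; rewrite !inE !mem_rcons !inE mem_rev orbCA.
    have eh : y1 :: rcons l u = rcons (y1 :: l) u by [].
    have hu : u \in (y1 :: rcons l u) ++ w :: rcons r y3 by rewrite mem_cat inE mem_rcons inE eqxx !orbT.
    have hw : w \in (y1 :: rcons l u) ++ w :: rcons r y3 by rewrite mem_cat !inE eqxx !orbT.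
    have hv1' : v1 \in (y1 :: rcons l u) ++ w :: rcons r y3 by rewrite mem_cat hv1.
    have hv2' : v2 \in (y1 :: rcons l u) ++ w :: rcons r y3 by rewrite mem_cat h2' orbT.
    move: U; rewrite cat_uniq => /and3P [U1 /hasPn U2 U3].
    have ne : v1 != v2 by apply: contraTneq hv1 => ->; apply: U2.
    rewrite ne /= (ipath_adj h) //.
    have i1 : index v1 ((y1 :: rcons l u) ++ w :: rcons r y3) = index v1 (y1 :: rcons l u) by rewrite index_cat hv1.
    have i2 : index v2 ((y1 :: rcons l u) ++ w :: rcons r y3) = size (y1 :: rcons l u) + index v2 (w :: rcons r y3).
      by rewrite index_cat (negbTE (U2 _ h2')).
    have l1 : index v1 (y1 :: rcons l u) < size (y1 :: rcons l u) by rewrite index_mem.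
    rewrite i1 i2 /=.
    have -> : (v1 == u) = (index v1 (y1 :: rcons l u) == (size l).+1).
      apply/eqP/eqP => [->|hh]; last by rewrite -(nth_index u hv1) hh eh nth_rcons /= ltnn eqxx.
      move: (U1); rewrite eh rcons_uniq -cats1 index_cat => /andP [/negbTE -> _] /=.
      by rewrite eqxx addn0.
    have -> : (v2 == w) = (index v2 (w :: rcons r y3) == 0).
      by rewrite /= [w == v2]eq_sym; case: (v2 == w).
    move: l1 => /=; rewrite size_rcons; move: (index v1 _) (index v2 _) => a b; clear; slia.
  move=> v1 v2 v1t v2t; have := leg (rev l) u y1; rewrite -rcons_cons.
  have s1 : {subset u :: rev l <= M}.
    by move=> v; rewrite eM !inE mem_cat mem_rev !inE => /orP [] ->; rewrite ?orbT.
  have ar1 : apart [:: head y2 L] (rev l) by apply: apart_sub al => // v; rewrite mem_rev.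
  move=> /(_ s1 (mem_head _ _) ar1 eu v2 v1 v2t v1t).
  by rewrite eq_sym sedge_sym [(v2 == _) && _]andbC.
- rewrite rcons_cons; apply: leg => //; last by rewrite !inE eqxx orbT.
  by move=> v; rewrite eM mem_cat !inE => /orP [] ->; rewrite ?orbT.
Qed.

(** Each path of the prism runs through one side to a vertex of [Y] and on through the other side.
    The middle one would be the single vertex [y2] if both legs were empty, which is the case
    treated by [hub_triangles]. *)
Lemma prism_triangles D1 D2 Y y1 y2 y3 M L M' L' : separated D1 D2 Y ->
  y1 \in Y -> y2 \in Y -> y3 \in Y -> (L != [::]) || (L' != [::]) ->
  bridge D1 Triangle y1 y2 y3 M L -> bridge D2 Triangle y1 y2 y3 M' L' -> has_prism G.
Proof.
move=> sD y1Y y2Y y3Y nL b1 b2; have [_ [_ sL] _ _ _] := b1; have [_ [_ sL'] _ _ _] := b2.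
have [t1 [t3 [[s1 s3] [n1 n3] [h1 h2 h3] [j12 j13] j23]]] := bridge_triangle_arms b1.
have [t1' [t3' [[s1' s3'] [n1' n3'] [h1' h2' h3'] [j12' j13'] j23']]] := bridge_triangle_arms b2.
have [sD12 dD1 dD2] := sD.
have D1Y u : u \in D1 -> u \notin Y by move=> h; rewrite (disjointFr dD1 h).
have D2Y u : u \in D2 -> u \notin Y by move=> h; rewrite (disjointFr dD2 h).
have P t t' y : {subset t <= D1} -> {subset t' <= D2} -> ipath (rcons t y) -> ipath (rcons t' y) ->
    ipath (t ++ y :: rev t').
  move=> st st' h h'; apply: ipath_join => //; first by rewrite -rev_rcons; apply: ipath_rev.
  by apply: separated_apart sD st _ => u; rewrite mem_rev => /st'.
have D12 u : u \in D1 -> u \in D2 -> False.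
  by move=> h h'; have := sD12 u u h h'; rewrite eqxx.
(* The pair [u], [w] lies on one side, on the other, or across. The nonemptiness conditions ensure
   that the heads on the opposite side are not both [y] and [z]. *)
have J t t' y r r' z : {subset t <= D1} -> {subset t' <= D2} -> {subset r <= D1} ->
    {subset r' <= D2} -> y \in Y -> z \in Y ->
    (t != [::]) || (r != [::]) -> (t' != [::]) || (r' != [::]) ->
    head_joined (rcons t y) (rcons r z) -> head_joined (rcons t' y) (rcons r' z) ->
    joined (t ++ y :: rev t') (r ++ z :: rev r').
  move=> st st' sr sr' yY zY n n' j j' u w uP wP.
  have hd (s s' : seq G) (a v : G) : head v (s ++ a :: rev s') = head a s by case: s.
  have ls (s s' : seq G) (a v : G) : last v (s ++ a :: rev s') = head a s'.
    by rewrite last_cat /=; case: s' => //= b s'; rewrite rev_cons last_rcons.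
  have hr (s : seq G) (a v : G) : head v (rcons s a) = head a s by case: s.
  rewrite !hd !ls.
  have mA (s : seq G) (a v : G) (D : {set G}) : {subset s <= D} -> v = head a s -> (v \in D) || (v == a).
    by case: s => [|b s] h -> /=; rewrite ?eqxx ?orbT // h ?mem_head.
  have hA (s s' : seq G) (a v : G) : v \in s ++ a :: rev s' -> (v \in rcons s a) || (v \in s').
    by rewrite mem_cat inE mem_rev mem_rcons inE => /or3P [] ->; rewrite ?orbT.
  have hB (s s' : seq G) (a v : G) : v \in s ++ a :: rev s' -> (v \in s) || (v \in rcons s' a).
    by rewrite mem_cat inE mem_rev mem_rcons inE => /or3P [] ->; rewrite ?orbT.
  have hRC (s : seq G) (a v : G) (D : {set G}) : {subset s <= D} -> v \in rcons s a -> (v \in D) || (v == a).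
    by move=> h; rewrite mem_rcons inE => /orP [->|/h ->]; rewrite ?orbT.
  have nZ (v : G) : v \in Y -> v \in D1 -> False by move=> h /D1Y; rewrite h.
  have nZ2 (v : G) : v \in Y -> v \in D2 -> False by move=> h /D2Y; rewrite h.
  have [/andP [uA wA]|nA] := boolP ((u \in rcons t y) && (w \in rcons r z)).
    have := j u w uA wA; rewrite !hr => /andP [-> /eqP ->] /=.
    have -> : (u == head y t') && (w == head z r') = false; last by rewrite orbF.
    apply/negP => /andP [/eqP e1 /eqP e2].
    have := hRC _ _ _ _ st uA; have := hRC _ _ _ _ sr wA.
    case/orP: n' => n0.
    - have uD : u \in D2 by rewrite e1; case: (t') n0 st' => // b s' _; apply; rewrite mem_head.
      by move=> _ /orP [h|/eqP h]; [apply: D12 h uD|apply: nZ2 uD; rewrite h].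
    - have uD : w \in D2 by rewrite e2; case: (r') n0 sr' => // b s' _; apply; rewrite mem_head.
      by move=> /orP [h|/eqP h] _; [apply: D12 h uD|apply: nZ2 uD; rewrite h].
  have [/andP [uA wA]|nA'] := boolP ((u \in rcons t' y) && (w \in rcons r' z)).
    have := j' u w uA wA; rewrite !hr => /andP [-> /eqP ->] /=.
    have -> : (u == head y t) && (w == head z r) = false; last by rewrite /= .
    apply/negP => /andP [/eqP e1 /eqP e2].
    have := hRC _ _ _ _ st' uA; have := hRC _ _ _ _ sr' wA.
    case/orP: n => n0.
    - have uD : u \in D1 by rewrite e1; case: (t) n0 st => // b s' _; apply; rewrite mem_head.
      by move=> _ /orP [h|/eqP h]; [apply: D12 uD h|apply: nZ uD; rewrite h].
    - have uD : w \in D1 by rewrite e2; case: (r) n0 sr => // b s' _; apply; rewrite mem_head.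
      by move=> /orP [h|/eqP h] _; [apply: D12 uD h|apply: nZ uD; rewrite h].
  have := hA _ _ _ _ uP; have := hA _ _ _ _ wP; have := hB _ _ _ _ uP; have := hB _ _ _ _ wP.
  have [/andP [ut wr]|/andP [ut wr]] : ((u \in t) && (w \in r')) \/ ((u \in t') && (w \in r)).
    move: nA nA'; rewrite !mem_rcons !inE.
    move: (hA _ _ _ _ uP) (hA _ _ _ _ wP) (hB _ _ _ _ uP) (hB _ _ _ _ wP).
    rewrite !mem_rcons !inE.
    case: (u \in t); case: (u \in t'); case: (w \in r); case: (w \in r'); case: (u == y); case: (w == z);
      rewrite //=; auto.
  - have uD := st _ ut; have wD := sr' _ wr.
    have /andP [-> /negbTE ->] := sD12 _ _ uD wD => _ _ _ _ /=.
    have -> : (w == head z r) = false.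
      apply/negP => /eqP e; case/orP: (mA _ _ _ _ sr e) => [h|/eqP h]; first exact: D12 h wD.
      by apply: nZ2 wD; rewrite h.
    have -> : (u == head y t') = false; last by rewrite andbF.
    apply/negP => /eqP e; case/orP: (mA _ _ _ _ st' e) => [h|/eqP h]; first exact: D12 uD h.
    by apply: nZ uD; rewrite h.
  - have uD := st' _ ut; have wD := sr _ wr.
    have := sD12 _ _ wD uD; rewrite eq_sym sedge_sym => /andP [-> /negbTE ->] _ _ _ _ /=.
    have -> : (u == head y t) = false.
      apply/negP => /eqP e; case/orP: (mA _ _ _ _ st e) => [h|/eqP h]; first exact: D12 h uD.
      by apply: nZ2 uD; rewrite h.
    have -> : (w == head z r') = false; last by rewrite andbF.
    apply/negP => /eqP e; case/orP: (mA _ _ _ _ sr' e) => [h|/eqP h]; first exact: D12 wD h.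
    by apply: nZ wD; rewrite h.
apply: (@prism_intro _ (t1 ++ y1 :: rev t1') (L ++ y2 :: rev L') (t3 ++ y3 :: rev t3')).
- exact: P.
- exact: P.
- exact: P.
- by case: (t1) n1 => // a l _; rewrite size_cat /=; clear; slia.
- by rewrite size_cat /= size_rev; case/orP: nL; [case: (L)|case: (L')] => //= *; clear; slia.
- by case: (t3) n3 => // a l _; rewrite size_cat /=; clear; slia.
- by apply: J; rewrite // ?n1 ?n1'.
- by apply: J; rewrite // ?n1 ?n1'.
- by apply: J; rewrite // ?n3 ?n3' ?orbT.
Qed.

End Combinations.

(** * Overlapping gaps along a path *)

Section Gaps.
Variable G : sgraph.
Implicit Types (u v w x y z : G) (p q r C R P : seq G) (D Y K : {set G}).

Lemma seg_sub i j p : {subset seg i j p <= p}.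
Proof. by move=> u /mem_drop /mem_take. Qed.

Lemma seg_apart i j k l p : ipath p -> j.+1 < k -> apart (seg i j p) (seg k l p).
Proof.
move=> hp jk u v; rewrite !mem_seg ?(ipath_uniq hp) // => /and3P [up u1 u2] /and3P [vp v1 v2].
rewrite (ipath_adj hp) //; apply/andP; split; last by slia.
by apply: contraTneq v1 => <-; slia.
Qed.

Lemma eq_nth_index p x0 u i : uniq p -> u \in p -> i < size p ->
  (u == nth x0 p i) = (index u p == i).
Proof.
by move=> U up ip; apply/eqP/eqP => [->|<-]; rewrite ?index_uniq ?nth_index.
Qed.

Lemma mem_nth_seg p x0 i j u : uniq p -> u \in seg i j p -> exists k, [/\ i <= k, k <= j, k < size p & u = nth x0 p k].
Proof.
move=> U; rewrite mem_seg // => /and3P [up h1 h2].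
by exists (index u p); rewrite index_mem nth_index.
Qed.

(* The extremities of [C] are the only neighbours of [y], so [C] closes to a
   hole through [y], and [R] is a third way from [y] to [z]. *)
Section Gap.
Variables (D1 D2 Y : {set G}) (y z : G) (C R : seq G).
Hypotheses (sD : separated D1 D2 Y) (yY : y \in Y) (zY : z \in Y) (yz : ~~ (y -- z)).
Hypotheses (hR : ipath (y :: rcons R z)) (RD : {subset R <= D2}).
Hypotheses (hC : ipath C) (CD : {subset C <= D1}) (sC : 2 < size C).
Hypothesis yC : forall k, k < size C -> y -- nth y C k = (k == 0) || (k == (size C).-1).
Hypothesis noth : ~ has_theta G.

Let UC : uniq C := ipath_uniq hC.

Lemma R_nonempty : R != [::].
Proof.
apply: contraNneq yz => eR; move: hR; rewrite eR /= => /(@ipath_consP _ y [:: z] isT) [_ _].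
by move/(_ z (mem_head _ _)) ->; rewrite /= eqxx.
Qed.

Lemma notinY_C k : k < size C -> (nth y C k == y = false) * (nth y C k == z = false).
Proof.
case: sD => _ d1 _ hk; have := CD (mem_nth y hk) => h.
have hn : nth y C k \notin Y by rewrite (disjointFr d1 h).
by split; apply: contraNF hn => /eqP ->.
Qed.

(** Otherwise the first and last neighbours of [z] on [C] are not consecutive, and [y] and [z] are
    the ends of a theta: two of its paths start at the two extremities of [C], the third is [R]. *)
Lemma gap_consecutive i j : i < j -> j < size C ->
  z -- nth y C i -> z -- nth y C j -> j = i.+1.
Proof.
move=> ij js zi zj; apply/eqP/negP => /negP nij; apply: noth.
pose Z := [pred k | (k < size C) && (z -- nth y C k)].
have exZ : exists k, Z k by exists i; rewrite /= zi andbT; slia.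
have bZ k : Z k -> k <= size C by case/andP => *; slia.
case: (ex_minnP exZ) => a /andP [ai za] mina.
case: (ex_maxnP exZ bZ) => b /andP [bi zb] maxb.
have ha : a <= i by apply: mina; rewrite /= zi andbT; slia.
have hb : j <= b by apply: maxb; rewrite /= zj andbT.
have minz k : k < size C -> z -- nth y C k -> a <= k.
  by move=> k1 k2; apply: mina; rewrite /= k1 k2.
have maxz k : k < size C -> z -- nth y C k -> k <= b.
  by move=> k1 k2; apply: maxb; rewrite /= k1 k2.
have {mina maxb exZ bZ} ab2 : a.+1 < b by slia.
clear Z ha hb ij js zi zj nij i j.
have n0 : 0 < size C by slia.
have [s12 dY1 dY2] := sD.
have zYn k : k < size C -> z == nth y C k = false by move=> hk; rewrite eq_sym notinY_C.
have yYn k : k < size C -> y == nth y C k = false by move=> hk; rewrite eq_sym notinY_C.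
have pa : ipath (y :: rcons (seg 0 a C) z).
  have na : seg 0 a C != [::] by rewrite -size_eq0 size_seg.
  have h1 : ipath (rcons (seg 0 a C) z).
    rewrite -[rcons _ _]revK rev_rcons; apply: ipath_rev; apply/ipath_consP.
      by rewrite -size_eq0 size_rev size_eq0.
    split; last 1 first.
    - move=> v; rewrite mem_rev => /(mem_nth_seg y UC) [k [k1 k2 k3 ->]].
      have -> : head z (rev (seg 0 a C)) = nth y C a.
        rewrite -nth0 nth_rev size_seg // ?subn0 // subSS subn0.
        by rewrite nth_seg // add0n; apply: set_nth_default.
      rewrite nth_uniq //; case: eqVneq => [->//|ne].
      by apply/negP => zk; have := minz k k3 zk; slia.
    - by rewrite mem_rev; apply/negP => /(mem_nth_seg y UC) [k [_ _ k3 /eqP]]; rewrite zYn.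
    - by apply/ipath_rev/ipath_seg.
  apply/ipath_consP; first by case: (seg _ _ _).
  have yz' : y != z.
    by move/ipath_uniq: hR; rewrite /= mem_rcons inE negb_or -andbA => /andP [].
  split=> //.
  - rewrite mem_rcons inE negb_or yz'; apply/negP => /(mem_nth_seg y UC) [k [_ _ k3 /eqP]].
    by rewrite yYn.
  - have -> : head y (rcons (seg 0 a C) z) = nth y C 0.
      by rewrite -(head_seg y (leq0n a)) //; case: (seg 0 a C) na.
    move=> v; rewrite mem_rcons inE => /orP [/eqP ->|/(mem_nth_seg y UC) [k [k1 k2 k3 ->]]].
      by rewrite (negbTE yz) zYn.
    rewrite yC // nth_uniq //; case: eqVneq => //= _; slia.
have pb : ipath (y :: rcons (rev (seg b (size C).-1 C)) z).
  have bC : b <= (size C).-1 by slia.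
  have lC : (size C).-1 < size C by slia.
  have na : seg b (size C).-1 C != [::] by rewrite -size_eq0 size_seg //; slia.
  have h1 : ipath (rcons (rev (seg b (size C).-1 C)) z).
    rewrite -rev_cons; apply: ipath_rev; apply/ipath_consP => //.
    split; last 1 first.
    - move=> v /(mem_nth_seg y UC) [k [k1 k2 k3 ->]].
      rewrite -nth0 nth_seg ?addn0 // [nth z C b](set_nth_default y) //.
      rewrite nth_uniq //; case: eqVneq => [->//|ne].
      by apply/negP => zk; have := maxz k k3 zk; slia.
    - by apply/negP => /(mem_nth_seg y UC) [k [_ _ k3 /eqP]]; rewrite zYn.
    - by apply: ipath_seg.
  have nr : rev (seg b (size C).-1 C) != [::] by rewrite -size_eq0 size_rev size_eq0.
  apply/ipath_consP; first by case: (rev _).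
  have yz' : y != z.
    by move/ipath_uniq: hR; rewrite /= mem_rcons inE negb_or -andbA => /andP [].
  split=> //.
  - rewrite mem_rcons inE negb_or yz' mem_rev; apply/negP => /(mem_nth_seg y UC) [k [_ _ k3 /eqP]].
    by rewrite yYn.
  - have -> : head y (rcons (rev (seg b (size C).-1 C)) z) = nth y C (size C).-1.
      have -> : head y (rcons (rev (seg b (size C).-1 C)) z) = head y (rev (seg b (size C).-1 C)) by case: (rev _) nr.
      rewrite -nth0 nth_rev size_seg ?subn1 //; last by slia.
      rewrite nth_seg; last by slia.
      by congr nth; slia.
    move=> v; rewrite mem_rcons inE mem_rev => /orP [/eqP ->|/(mem_nth_seg y UC) [k [k1 k2 k3 ->]]].
      by rewrite (negbTE yz) zYn.
    rewrite yC // nth_uniq //; case: eqVneq => //= k0; by slia.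
have ab : apart (seg 0 a C) (rev (seg b (size C).-1 C)).
  by apply: apart_sub (@seg_apart 0 a b (size C).-1 C hC ab2) => // v; rewrite mem_rev.
apply: (theta_intro pa pb hR) => //.
- by rewrite -size_eq0 size_seg.
- by rewrite -size_eq0 size_rev size_seg //; slia.
- exact: R_nonempty.
- by apply: separated_apart sD _ RD => v /seg_sub /CD.
- by apply: separated_apart sD _ RD => v; rewrite mem_rev => /seg_sub /CD.
Qed.

(** If the vertex at position [i] were the only neighbour of [z] on [C], it would form with [y] the
    ends of a theta: along [C] in both directions, and through [z] and [R]. *)
Lemma gap_neighbour i : 0 < i -> i.+1 < size C -> z -- nth y C i ->
  exists2 j, j != i & (j < size C) && (z -- nth y C j).
Proof.
move=> i0 iC zi.
have [/existsP [j /andP [ji zj]]|/existsPn none] := boolP [exists j : 'I_(size C), (j != i :> nat) && (z -- nth y C j)].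
  by exists (val j) => //; rewrite ltn_ord.
exfalso; apply: noth; have lC : (size C).-1 < size C by slia.
have zu k : k < size C -> z -- nth y C k = (k == i).
  move=> kC; case: eqVneq => [->//|ki]; have := none (Ordinal kC).
  by rewrite /= ki /= => /negbTE.
have c0 : nth y C i \in D1 by apply/CD/mem_nth; slia.
have rc k l : (k < size C) -> (l < size C) -> nth y C k -- nth y C l = (l == k.+1) || (k == l.+1).
  by move=> k1 l1; rewrite (ipath_adj hC) ?mem_nth // !index_uniq.
have nc k l : (k < size C) -> (l < size C) -> nth y C k == nth y C l = (k == l).
  by move=> k1 l1; rewrite nth_uniq.
have iC' : i < size C by slia.
have p1 : ipath (nth y C i :: rcons (rev (seg 0 i.-1 C)) y).
  have e : nth y C i :: rcons (rev (seg 0 i.-1 C)) y = rev (y :: seg 0 i C).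
    have h : seg 0 i C = rcons (seg 0 i.-1 C) (nth y C i).
      by have := @seg_rcons _ y 0 i.-1 C; rewrite prednK // => ->.
    by rewrite rev_cons h rev_rcons.
  rewrite e; apply/ipath_rev/ipath_consP; first by rewrite -size_eq0 size_seg.
  split; last 1 first.
  - move=> v /(mem_nth_seg y UC) [k [k1 k2 k3 ->]].
    by rewrite -nth0 nth_seg ?addn0 // yC // nc //; slia.
  - by apply/negP => /(mem_nth_seg y UC) [k [_ _ k3 /eqP]]; rewrite eq_sym notinY_C.
  - by apply: ipath_seg.
have p2 : ipath (nth y C i :: rcons (seg i.+1 (size C).-1 C) y).
  have e : nth y C i :: rcons (seg i.+1 (size C).-1 C) y = rev (y :: rev (seg i (size C).-1 C)).
    by rewrite rev_cons revK (@seg_cons _ y i) //; slia.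
  have n0 : seg i (size C).-1 C != [::] by rewrite -size_eq0 size_seg //; slia.
  rewrite e; apply/ipath_rev/ipath_consP; first by rewrite -size_eq0 size_rev size_eq0.
  split; last 1 first.
  - move=> v; rewrite mem_rev => /(mem_nth_seg y UC) [k [k1 k2 k3 ->]].
    rewrite -nth0 nth_rev size_seg //; last by slia.
    rewrite nth_seg ?subn1; last by slia.
    by rewrite yC // nc //; slia.
  - by rewrite mem_rev; apply/negP => /(mem_nth_seg y UC) [k [_ _ k3 /eqP]]; rewrite eq_sym notinY_C.
  - by apply/ipath_rev/ipath_seg => //; slia.
have p3 : ipath (nth y C i :: rcons (z :: rev R) y).
  have e : rcons (z :: rev R) y = rev (y :: rcons R z) by rewrite rev_cons rev_rcons.
  apply/ipath_consP => //; rewrite e; split; last 1 first.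
  - move=> v; rewrite rev_cons rev_rcons /= inE mem_rcons inE mem_rev.
    case/or3P => [/eqP ->|/eqP ->|vR].
    + by rewrite sedge_sym zi eqxx.
    + rewrite sedge_sym yC //; have -> : (i == 0) || (i == (size C).-1) = false by slia.
      by move/ipath_uniq: hR; rewrite /= mem_rcons inE negb_or -andbA => /andP [/negbTE ->].
    + case: sD => s12 _ dY2; have vD := RD vR.
      have /andP [_ /negbTE ->] := s12 _ _ c0 vD.
      apply/esym/negbTE; apply: contraTneq vD => ->; apply/negP => h.
      by have := disjointFr dY2 h; rewrite zY.
  - rewrite mem_rev inE mem_rcons inE !negb_or; apply/and3P; split; rewrite ?notinY_C //.
    by apply/negP => /RD h; case: sD => /(_ _ _ c0 h); rewrite eqxx.
  - exact: ipath_rev.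
have ayz a b : b < size C -> ~~ ((a <= i) && (i <= b)) -> apart (seg a b C) (z :: rev R).
  move=> bC h; apply: (@apart_catr _ _ [:: z]).
    move=> v w /(mem_nth_seg y UC) [k [k1 k2 k3 ->]]; rewrite inE => /eqP ->.
    by rewrite notinY_C // sedge_sym zu //=; apply/negP; slia.
  by apply: separated_apart sD _ _ => v; [move/seg_sub/CD|rewrite mem_rev => /RD].
apply: (theta_intro p1 p2 p3) => //.
- by rewrite -size_eq0 size_rev size_seg //; slia.
- by rewrite -size_eq0 size_seg //; slia.
- have i2 : i.-1.+1 < i.+1 by slia.
  by apply: apart_sub (@seg_apart 0 i.-1 i.+1 (size C).-1 C hC i2) => // v; rewrite mem_rev.
- have h : apart (seg 0 i.-1 C) (z :: rev R) by apply: ayz; slia.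
  by apply: apart_sub h => // v; rewrite mem_rev.
- by apply: ayz; slia.
Qed.

End Gap.

(** Let the gap of [y] begin first. If it also ends last, [z] has inside it two neighbours with
    position [k] strictly between them, against [gap_consecutive]. Otherwise the gaps cross: [z]
    sees exactly the positions a'-1 and a' in the gap of [y], and [y] exactly b and b+1 in the gap
    of [z], and these two triangles belong to a prism. The path [R] enters only through the lemmas
    on a single gap. *)
Lemma overlapping_gaps D1 D2 Y P R y z a b a' b' k :
  separated D1 D2 Y -> ~ has_theta G -> ~ has_prism G ->
  y \in Y -> z \in Y -> ~~ (y -- z) ->
  ipath (y :: rcons R z) -> {subset R <= D2} ->
  ipath P -> {subset P <= D1} ->
  a < k -> k < b -> b < size P -> a' < k -> k < b' -> b' < size P ->
  (forall i, a <= i <= b -> y -- nth y P i = (i == a) || (i == b)) ->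
  (forall i, a' <= i <= b' -> z -- nth y P i = (i == a') || (i == b')) ->
  a != a' -> b != b' -> False.
Proof.
wlog aa : y z R a b a' b' / a < a'.
  move=> H sD nt np yY zY yz hR RD hP PD ak kb bP ak' kb' bP' ya zb ne ne'.
  have [lt|gt|eq] := ltngtP a a'; last by rewrite eq eqxx in ne.
    exact: (H y z R a b a' b').
  have hR' : ipath (z :: rcons (rev R) y).
    by have := ipath_rev hR; rewrite rev_cons rev_rcons.
  apply: (H z y (rev R) a' b' a b) => //; rewrite 1?sedge_sym 1?eq_sym //.
  - by move=> v; rewrite mem_rev => /RD.
  - by move=> i hi; rewrite (set_nth_default y) ?zb //; slia.
  - by move=> i hi; rewrite (set_nth_default y) ?ya //; slia.
move=> sD nt np yY zY yz hR RD hP PD ak kb bP ak' kb' bP' ya zb _ ne'.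
have UP := ipath_uniq hP.
have hC : ipath (seg a b P) by apply: ipath_seg => //; slia.
have CD : {subset seg a b P <= D1} by move=> v /seg_sub /PD.
have sC : size (seg a b P) = b.+1 - a by rewrite size_seg.
have sC2 : 2 < size (seg a b P) by slia.
have yC i : i < size (seg a b P) -> y -- nth y (seg a b P) i = (i == 0) || (i == (size (seg a b P)).-1).
  by rewrite sC => hi; rewrite nth_seg ?ya; slia.
have gapc i j : a <= i -> i < j -> j <= b -> z -- nth y P i -> z -- nth y P j -> j = i.+1.
  move=> ai ij jb zi zj.
  have := @gap_consecutive D1 D2 Y y z (seg a b P) R sD yY zY yz hR RD hC CD sC2 yC nt (i - a) (j - a).
  by rewrite !nth_seg ?subnKC ?sC; try slia; move=> /(_ _ _ zi zj); slia.
have zYP i : i < size P -> (z != nth y P i) && (y != nth y P i).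
  case: sD => _ d1 _ hi; have hn : nth y P i \notin Y by rewrite (disjointFr d1) // PD ?mem_nth.
  by apply/andP; split; apply: contraNneq hn => <-.
have za' : z -- nth y P a' by rewrite zb ?eqxx //; slia.
have zb' : z -- nth y P b' by rewrite zb ?eqxx ?orbT //; slia.
have [lb|gb|eb] := ltngtP b b'; last by rewrite eb eqxx in ne'.
  have zC i : a <= i <= b -> z -- nth y P i = (i == a'.-1) || (i == a').
    have [j] := @gap_neighbour D1 D2 Y y z (seg a b P) R sD yY zY hR RD hC CD sC2 yC nt (a' - a) ltac:(slia) ltac:(slia) ltac:(by rewrite nth_seg subnKC //; slia).
    move=> ja /andP [js]; have {}js : a + j <= b by move: js; rewrite sC; slia.
    rewrite nth_seg //.
    move=> zj hi.
    have za1 : z -- nth y P a'.-1.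
      have [lj|gj|ej] := ltngtP (a + j) a'; last by slia.
        by have e := gapc (a + j) a' ltac:(slia) lj ltac:(slia) zj za'; rewrite e.
      have e := gapc a' (a + j) ltac:(slia) gj ltac:(slia) za' zj.
      by move: zj; rewrite zb; slia.
    apply/idP/orP => [zi|[] /eqP -> //].
    have [lj|gj|ej] := ltngtP i a'; last by right; rewrite ?ej ?eqxx.
      by left; have := gapc i a' ltac:(slia) lj ltac:(slia) zi za'; slia.
    have h1 := gapc a' i ltac:(slia) gj ltac:(slia) za' zi.
    by move: zi; rewrite zb; slia.
  have hR' : ipath (z :: rcons (rev R) y) by have := ipath_rev hR; rewrite rev_cons rev_rcons.
  have hC' : ipath (seg a' b' P) by apply: ipath_seg => //; slia.
  have CD' : {subset seg a' b' P <= D1} by move=> v /seg_sub /PD.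
  have sC' : size (seg a' b' P) = b'.+1 - a' by rewrite size_seg.
  have sC2' : 2 < size (seg a' b' P) by slia.
  have yC' i : i < size (seg a' b' P) -> z -- nth z (seg a' b' P) i = (i == 0) || (i == (size (seg a' b' P)).-1).
    by rewrite sC' => hi; rewrite nth_seg ?(set_nth_default y) ?zb; slia.
  have RD' : {subset rev R <= D2} by move=> v; rewrite mem_rev => /RD.
  have zy : ~~ (z -- y) by rewrite sedge_sym.
  have gapc' i j : a' <= i -> i < j -> j <= b' -> y -- nth y P i -> y -- nth y P j -> j = i.+1.
    move=> ai ij jb zi zj.
    have := @gap_consecutive D1 D2 Y z y (seg a' b' P) (rev R) sD zY yY zy hR' RD' hC' CD' sC2' yC' nt (i - a') (j - a').
    by rewrite !nth_seg ?subnKC ?sC' ?(set_nth_default y); try slia; move=> /(_ _ _ zi zj); slia.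
  have yb : y -- nth y P b by rewrite ya ?eqxx ?orbT //; slia.
  have yC2 i : a' <= i <= b' -> y -- nth y P i = (i == b) || (i == b.+1).
    have [j] := @gap_neighbour D1 D2 Y z y (seg a' b' P) (rev R) sD zY yY hR' RD' hC' CD' sC2' yC' nt (b - a') ltac:(slia) ltac:(slia) ltac:(by rewrite nth_seg subnKC ?(set_nth_default y) //; slia).
    move=> ja /andP [js]; have {}js : a' + j <= b' by move: js; rewrite sC'; slia.
    rewrite nth_seg //.
    rewrite (set_nth_default y); last by slia.
    move=> zj hi.
    have za1 : y -- nth y P b.+1.
      have [lj|gj|ej] := ltngtP (a' + j) b; last by slia.
        have e := gapc' (a' + j) b ltac:(slia) lj ltac:(slia) zj yb.
        by move: zj; rewrite ya; slia.
      by have e := gapc' b (a' + j) ltac:(slia) gj ltac:(slia) yb zj; rewrite -e.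
    apply/idP/orP => [zi|[] /eqP -> //].
    have [lj|gj|ej] := ltngtP i b; last by left; rewrite ?ej ?eqxx.
      have h1 := gapc' i b ltac:(slia) lj ltac:(slia) zi yb.
      by move: zi; rewrite ya; slia.
    by right; have := gapc' b i ltac:(slia) gj ltac:(slia) yb zi; slia.
  (* The three paths of the prism: the positions a' to b; the positions a'-1 down to a, then [y];
     [z], then the positions b' down to b+1. *)
  apply: np.
  have hu (s t i j : nat) : s <= t -> t < size P -> i < size P -> (nth y P i == head (nth y P i) (seg s t P)) = (i == s).
    by move=> h1 h2 h3; rewrite -nth0 nth_seg ?addn0 // (set_nth_default y) ?nth_uniq //; slia.
  have P1 : ipath (seg a' b P) by apply: ipath_seg => //; slia.
  have n2 : seg a a'.-1 P != [::] by rewrite -size_eq0 size_seg; slia.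
  have P2 : ipath (rcons (rev (seg a a'.-1 P)) y).
    rewrite -rev_cons; apply/ipath_rev/ipath_consP => //; split; last 1 first.
    - move=> v /(mem_nth_seg y UP) [i [i1 i2 i3 ->]].
      rewrite ya -?nth0 ?nth_seg ?addn0 ?nth_uniq //; slia.
    - by apply/negP => /(mem_nth_seg y UP) [i [i1 i2 i3 /eqP]]; have /andP [_ /negbTE ->] := zYP i i3.
    - by apply: ipath_seg => //; slia.
  have n3 : seg b.+1 b' P != [::] by rewrite -size_eq0 size_seg; slia.
  have P3 : ipath (z :: rev (seg b.+1 b' P)).
    apply/ipath_consP; first by rewrite -size_eq0 size_rev size_eq0.
    split; last 1 first.
    - move=> v; rewrite mem_rev => /(mem_nth_seg y UP) [i [i1 i2 i3 ->]].
      rewrite zb; last by slia.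
      rewrite -nth0 nth_rev size_seg ?subn1; try slia.
      rewrite nth_seg ?(set_nth_default y) ?nth_uniq //; try slia.
    - by rewrite mem_rev; apply/negP => /(mem_nth_seg y UP) [i [i1 i2 i3 /eqP]]; have /andP [/negbTE -> _] := zYP i i3.
    - by apply/ipath_rev/ipath_seg => //; slia.
  have pp i j : i < size P -> j < size P -> nth y P i -- nth y P j = (j == i.+1) || (i == j.+1).
    by move=> h1 h2; rewrite (ipath_adj hP) ?mem_nth // !index_uniq.
  have nu i j : i < size P -> j < size P -> (nth y P i == nth y P j) = (i == j) by move=> *; rewrite nth_uniq.
  have h1h v : head v (seg a' b P) = nth y P a'.
    by rewrite -nth0 nth_seg ?addn0; [apply: set_nth_default|]; slia.
  have h1l v : last v (seg a' b P) = nth y P b.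
    by rewrite last_seg //; [apply: set_nth_default|]; slia.
  have h2h v : head v (rcons (rev (seg a a'.-1 P)) y) = nth y P a'.-1.
    have e : seg a a'.-1 P = seg a a'.-1.-1.+1 P \/ a = a'.-1 by have [->|ne] := eqVneq a a'.-1; [right|left; congr seg; slia].
    have -> : head v (rcons (rev (seg a a'.-1 P)) y) = head v (rev (seg a a'.-1 P)).
      have : rev (seg a a'.-1 P) != [::] by rewrite -size_eq0 size_rev size_eq0.
      by case: (rev _).
    rewrite -nth0 nth_rev size_seg ?subn1; try slia.
    rewrite nth_seg; last by slia.
    rewrite (set_nth_default y); last by slia.
    by congr nth; slia.
  have h3l v : last v (z :: rev (seg b.+1 b' P)) = nth y P b.+1.
    rewrite /= (@seg_cons _ y) ?rev_cons ?last_rcons //; slia.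
  have yz' : (y == z) = false.
    by move/ipath_uniq: hR; rewrite /= mem_rcons inE negb_or -andbA => /andP [/negbTE].
  apply: (prism_intro P1 P2 P3).
  - by rewrite size_seg; slia.
  - by rewrite size_rcons size_rev size_seg; slia.
  - by rewrite /= size_rev size_seg; slia.
  - move=> u w uP; rewrite h1h h1l h2h last_rcons.
    have [i [i1 i2 i3 ->]] := mem_nth_seg y UP uP.
    rewrite mem_rcons inE mem_rev => /orP [/eqP ->|/(mem_nth_seg y UP) [j [j1 j2 j3 ->]]].
      have := zYP i i3; rewrite eq_sym => /andP [_ yi]; rewrite eq_sym yi /=.
      rewrite eqxx sedge_sym yC2 ?nu; try slia.
      have := zYP a'.-1 ltac:(slia) => /andP [_ /negbTE ->]; slia.
    rewrite pp ?nu; try slia.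
    have := zYP j j3; rewrite ![_ == nth y P j]eq_sym => /andP [_ /negbTE ->]; slia.
  - move=> u w uP; rewrite h1h h1l h3l [head _ _]/=.
    have [i [i1 i2 i3 ->]] := mem_nth_seg y UP uP.
    rewrite inE mem_rev => /orP [/eqP ->|/(mem_nth_seg y UP) [j [j1 j2 j3 ->]]].
      have := zYP i i3; rewrite eq_sym => /andP [yi _]; rewrite yi /=.
      rewrite eqxx sedge_sym zC ?nu; try slia.
      have := zYP b.+1 ltac:(slia) => /andP [/negbTE -> _]; slia.
    rewrite pp ?nu; try slia.
    have := zYP j j3; rewrite ![_ == nth y P j]eq_sym => /andP [/negbTE -> _]; slia.
  - move=> u w; rewrite h2h last_rcons h3l [head _ (_ :: _)]/=.
    rewrite mem_rcons inE mem_rev => /orP [/eqP ->|/(mem_nth_seg y UP) [i [i1 i2 i3 ->]]];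
    rewrite inE mem_rev => /orP [/eqP ->|/(mem_nth_seg y UP) [j [j1 j2 j3 ->]]].
    + rewrite yz' (negbTE yz) !eqxx /=.
      have := zYP b.+1 ltac:(slia) => /andP [/negbTE -> _].
      by have := zYP a'.-1 ltac:(slia) => /andP [_ /negbTE ->].
    + have /andP [yj1 yj2] := zYP j j3; rewrite yj2 eqxx /= yC2 ?nu; try slia.
      have := zYP a'.-1 ltac:(slia) => /andP [_ /negbTE ->]; slia.
    + have /andP [yj1 yj2] := zYP i i3; rewrite eq_sym yj1 /= sedge_sym zC ?nu ?eqxx; try slia.
      have := zYP b.+1 ltac:(slia) => /andP [/negbTE -> _]; slia.
    + rewrite pp ?nu; try slia.
      have /andP [yj1 yj2] := zYP i i3; have /andP [zj1 zj2] := zYP j j3.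
      by rewrite ![_ == y]eq_sym ![_ == z]eq_sym (negbTE yj2) (negbTE zj1); slia.
(* The nested case b' < b. *)
have := gapc a' b' ltac:(slia) ltac:(slia) ltac:(slia) za' zb'; slia.
Qed.

End Gaps.

(** * Stars and ladders *)

Section Pieces.
Variable G : sgraph.
Implicit Types (u v w x y z c e : G) (p q r C R P : seq G) (A B D N Y K S : {set G}).

Definition star_in D c (leg : G -> seq G) S (b : bool) :=
  [/\ c \in D,
      forall y, y \in S -> [/\ {subset leg y <= D}, ipath (c :: rcons (leg y) y)
                             & (leg y == [::]) = b] &
      {in S &, forall y z, y != z -> apart (rcons (leg y) y) (rcons (leg z) z)}].

(** Vacuous if [e] or [f] has no neighbour on [P]; in a ladder this is excluded by [meets]. *)
Definition before P e f :=
  forall u v, u \in P -> v \in P -> e -- u -> f -- v -> index u P < index v P.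

(** The types of [attached_as] without a decomposition of the path, so that they do not depend on
    its direction and survive passing to a segment that keeps all neighbours. *)
Definition meets (k : attach) P e := match k with
  | Single => exists2 c, c \in P /\ e -- c & forall v, v \in P -> e -- v -> v = c
  | Triangle => exists u w, [/\ u \in P /\ w \in P, u -- w, e -- u /\ e -- w &
                  forall v, v \in P -> e -- v -> v = u \/ v = w]
  | Wide => exists u w, [/\ u \in P /\ w \in P, u != w, ~~ (u -- w) & e -- u /\ e -- w]
  end.

(* The neighbours of [rcons (leg y) y] in [P] are those of its head, which is [y]
   itself when the leg is empty; [b] tells whether all legs are empty. *)
Definition ladder_in D P (leg : G -> seq G) S (k : attach) (b : bool) :=
  [/\ ipath P /\ {subset P <= D},
      forall y, y \in S ->
        [/\ {subset leg y <= D}, ipath (rcons (leg y) y) /\ head y (leg y) \notin P,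
            apart (behead (rcons (leg y) y)) P, meets k P (head y (leg y))
          & (leg y == [::]) = b],
      {in S &, forall y z, y != z -> apart (rcons (leg y) y) (rcons (leg z) z)} &
      {in S &, forall y z, y != z ->
         before P (head y (leg y)) (head z (leg z)) \/
         before P (head z (leg z)) (head y (leg y))}].

Definition touches S A := [forall y in S, [exists a in A, y -- a]].

Lemma touchesP S A : reflect (forall y, y \in S -> exists2 a, a \in A & y -- a) (touches S A).
Proof.
apply: (iffP forall_inP) => h y /h; first by move/exists_inP.
by case=> a aA ya; apply/exists_inP; exists a.
Qed.

Definition minimal_for S A :=
  [/\ connected A, touches S A &
      forall B, B \proper A -> connected B ->
        exists2 y, y \in S & forall a, a \in B -> ~~ (y -- a)].

Lemma minimal_for_exists D S : connected D -> touches S D ->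
  exists2 A : {set G}, A \subset D & minimal_for S A.
Proof.
move=> cD tD; pose Q := [pred A : {set G} | connected A && touches S A].
have QD : Q D by rewrite /= cD.
have [A /minsetP [/andP [cA tA] minA] sA] := minset_exists QD.
exists A => //; split=> // B BA cB.
have [tB|] := boolP (touches S B).
  have e := minA B; rewrite /= cB tB in e.
  by have eAB := e isT (proper_sub BA); rewrite eAB properxx in BA.
rewrite negb_forall_in => /exists_inP [y yS /exists_inPn h].
by exists y => // a; apply: h.
Qed.

(** [E] is connected because a path in [A] from [E] to [c] cannot leave [E] before it reaches [c]:
    an edge from [E] into the component [V] starts at [c]. *)
Lemma outside_component A c v : connected A -> c \in A -> v \in A -> v != c ->
  let V := component (A :\ c) v in let E := A :\: V in
  [/\ c \in E, v \in V /\ V \subset A :\ c, connected E, connected V &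
      forall u w, u \in E -> w \in V -> u -- w -> u = c].
Proof.
move=> cA cin vin vc V E.
have vA : v \in A :\ c by rewrite !inE vc.
have sV : V \subset A :\ c by apply: component_sub.
have cE : c \in E by rewrite inE cin andbT; apply: contraTN isT => /(subsetP sV); rewrite !inE eqxx.
have cross u w : u \in E -> w \in V -> u -- w -> u = c.
  rewrite inE => /andP [uV uA] wV uw; apply/eqP; apply: contraNT uV => uc.
  by apply: (component_closed vA wV); rewrite 1?sedge_sym // !inE uc.
split=> //; last by apply: component_connected.
  by rewrite component_self.
apply: (connected_root cE) => w wE.
have wA : w \in A by move: wE; rewrite inE => /andP [].
have [p [hp sp lp bp]] := @ipath_to _ A w (pred1 c) cA wA (ex_intro2 _ _ c cin (eqxx c)).
have aux : forall q u, u \in E -> ipath (u :: q) -> {subset u :: q <= A} -> last u q = c -> (forall z, z \in belast u q -> z != c) -> connect (inrel E) u c.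
  elim=> [|a q IH] u uE hq sq lq bq; first by rewrite -lq connect0.
  have [_ hq' h] := (@ipath_consP _ u (a :: q) isT).1 hq.
  have ua : u -- a by rewrite h ?mem_head /=.
  have uc : u != c by apply: bq; rewrite mem_head.
  have aE : a \in E.
    have aA : a \in A by apply: sq; rewrite !inE eqxx orbT.
    rewrite in_setD aA andbT; apply/negP => aV.
    by have e := cross u a uE aV ua; rewrite e eqxx in uc.
  apply: (@connect_trans _ _ a); first by apply: connect1; rewrite /inrel /= uE aE.
  apply: IH => //; first by move=> z hz; apply: sq; rewrite inE hz orbT.
  by move=> z hz; apply: bq; rewrite /= inE hz orbT.
by apply: (aux p) => //; apply/eqP.
Qed.

Lemma ipath_snoc p u y : ipath (u :: p) -> last u p -- y -> y \notin u :: p ->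
  (forall z, z \in belast u p -> ~~ (z -- y)) -> ipath (rcons (u :: p) y).
Proof.
move=> hp ly yp bp; rewrite -[rcons _ _]revK rev_rcons; apply/ipath_rev/ipath_consP.
  by rewrite -size_eq0 size_rev.
have er : rev (u :: p) = last u p :: rev (belast u p) by rewrite lastI rev_rcons.
split; [by rewrite mem_rev|exact: ipath_rev|].
move=> v; rewrite er inE mem_rev => /orP [/eqP ->|vb]; first by rewrite sedge_sym ly eqxx.
rewrite sedge_sym (negbTE (bp _ vb)); apply/esym/negbTE.
apply: contraTneq vb => -> /=; have := ipath_uniq hp; rewrite lastI rcons_uniq.
by case/andP.
Qed.

(** For [c] in [N] let [V c] be the component of [v] in [A] without [c]. It is connected and proper,
    so some [y] has all its neighbours in the rest [E c], which is connected and contains [c]; a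
    shortest path in [E c] from [c] to a neighbour of [y] is the leg. As [N] is stable, the sets
    [E c] are pairwise anticomplete. *)
Lemma star_of_stable_neighbours S A v N : minimal_for S A -> [disjoint S & A] ->
  {in S &, forall y z, ~~ (y -- z)} ->
  v \in A -> N \subset A -> (forall c, c \in N -> v -- c) ->
  {in N &, forall c d, ~~ (c -- d)} ->
  exists (S' : {set G}) leg, [/\ S' \subset S, #|S'| = #|N| & star_in A v leg S' false].
Proof.
move=> [cA tA minA] dSA stS vA /subsetP NA vN stN.
have nvc c : c \in N -> v != c by move=> /vN /edge_neq.
pose V c := component (A :\ c) v; pose E c := A :\: V c.
have out c (cN : c \in N) := outside_component cA (NA c cN) vA (nvc c cN).
have ex c : c \in N -> exists2 y, y \in S & forall a, a \in A -> y -- a -> a \in E c.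
  move=> cN; have [cE [vV sV] cE' cV _] := out c cN.
  have pV : V c \proper A.
    apply/properP; split; first by apply: subset_trans sV (subD1set _ _).
    by exists c; [exact: NA|apply: contraTN isT => /(subsetP sV); rewrite !inE eqxx].
  have [y yS h] := minA _ pV cV; exists y => // a aA ya.
  by rewrite inE aA andbT; apply: contraTN ya; apply: h.
have exp c : exists yp : G * seq G, c \in N -> [/\ yp.1 \in S,
    forall a, a \in A -> yp.1 -- a -> a \in E c, {subset yp.2 <= E c}, yp.2 != [::] &
    ipath (v :: rcons yp.2 yp.1)].
  case cN : (c \in N); last by exists (c, [::]).
  have [y yS hy] := ex c cN; have [cE [vV sV] cE' cV cross] := out c cN.
  have yA : y \notin A by rewrite (disjointFr dSA yS).
  have [a aA ya] := touchesP _ _ tA y yS.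
  have [q [hq sq lq bq]] := @ipath_to _ (E c) c (sedge y) cE' cE (ex_intro2 _ _ a (hy a aA ya) ya).
  exists (y, c :: q) => _; split=> //=.
  have sqA : {subset c :: q <= A} by move=> u /sq; rewrite inE => /andP [].
  have hqy : ipath (rcons (c :: q) y).
    apply: ipath_snoc => //; first by rewrite sedge_sym.
      by apply: contra yA => /sqA.
    by move=> z /bq; rewrite sedge_sym.
  apply/(@ipath_consP _ v (rcons (c :: q) y) isT); split=> //.
  - rewrite mem_rcons inE negb_or; apply/andP; split; first by apply: contraNneq yA => <-.
    by apply/negP => /sq; rewrite inE vV.
  - move=> u; rewrite mem_rcons inE /= => /orP [/eqP ->|uq].
      have -> : (y == c) = false by apply: contraNF yA => /eqP ->; exact: NA.
      apply/negbTE; rewrite sedge_sym; apply/negP => yv.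
      by have := hy v vA yv; rewrite inE vV.
    have [->|uc] := eqVneq u c; first exact: vN.
    apply/negbTE/negP => vu; move: uc.
    by rewrite (cross u v) ?eqxx 1?sedge_sym //; apply: sq.
have [f hf] := fin_all_exists exp.
(* [E d] is connected, avoids [c] and contains [d], which lies in [V c] as a neighbour of [v]; so
   all of [E d] lies in that component. *)
have sepE c d : c \in N -> d \in N -> c != d -> {subset E d <= V c}.
  move=> cN dN cd w; have [cE [vV sV] cEc cV _] := out c cN; have [dE [vVd sVd] cEd cVd crossd] := out d dN.
  have cVd' : c \in V d.
    apply: (@component_closed _ (A :\ d) v v) => //; rewrite ?inE ?eqxx ?nvc ?vA ?component_self ?cd ?NA ?vN //.
  have vAc : v \in A :\ c by rewrite !inE nvc.
  have dVc : d \in V c.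
    apply: (@component_closed _ (A :\ c) v v) => //; rewrite ?inE ?eqxx ?nvc ?vA ?component_self ?NA ?vN //.
    by rewrite eq_sym cd.
  move=> wE; rewrite /V -(component_eq dVc) inE.
  apply: (@connect_sub_set _ (E d)); last exact: (connectedP _ cEd).
  apply/subsetP => u uE; have : u \in A by move: uE; rewrite inE => /andP [].
  rewrite !inE => ->; rewrite andbT; apply: contraTneq uE => ->.
  by rewrite inE cVd'.
have apE c d : c \in N -> d \in N -> c != d -> forall u w, u \in E c -> w \in E d -> (u != w) && ~~ (u -- w).
  move=> cN dN cd u w uE wE; have [_ _ _ _ crossc] := out c cN; have [_ _ _ _ crossd] := out d dN.
  have wV := sepE c d cN dN cd w wE; have dc : d != c by rewrite eq_sym.
  have uV := sepE d c dN cN dc u uE.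
  apply/andP; split; first by apply: contraTneq wV => <-; move: uE; rewrite inE => /andP [].
  apply/negP => uw; have e1 := crossc u w uE wV uw; have e2 := crossd w u wE uV; rewrite sedge_sym in e2.
  by have := stN c d cN dN; rewrite -e1 -(e2 uw) uw.
have finj : {in N &, injective (fun c => (f c).1)}.
  move=> c d cN dN /= e; apply/eqP/negPn/negP => cd.
  have [yS h1 _ _ _] := hf c cN; have [_ h2 _ _ _] := hf d dN.
  have [a aA ya] := touchesP _ _ tA _ yS.
  have aE := h1 a aA ya; have aE' : a \in E d by apply: h2; rewrite // -e.
  by have := apE c d cN dN cd a a aE aE'; rewrite eqxx.
have exg y : exists c, y \in [set (f c).1 | c in N] -> c \in N /\ y = (f c).1.
  have [/imsetP [c cN ->]|] := boolP (y \in [set (f c).1 | c in N]); first by exists c.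
  by exists y.
have [g hg] := fin_all_exists exg.
exists [set (f c).1 | c in N], (fun y => (f (g y)).2); split.
- by apply/subsetP => y /imsetP [c cN ->]; have [] := hf c cN.
- by rewrite card_in_imset.
split=> //.
- move=> y /hg [cN e]; have [yS h1 h2 h3 h4] := hf _ cN; rewrite -e in h4.
  by split; [move=> u /h2; rewrite inE => /andP []|exact: h4|apply: negbTE].
- move=> y z yS zS yz; have [cN e1] := hg y yS; have [dN e2] := hg z zS.
  have cd : g y != g z by apply: contraNneq yz => e; rewrite e1 e -e2.
  have [yS' hy sy _ _] := hf _ cN; have [zS' hz sz _ _] := hf _ dN.
  rewrite -e1 in yS' hy; rewrite -e2 in zS' hz.
  have yA : y \notin A by rewrite (disjointFr dSA).
  have zA : z \notin A by rewrite (disjointFr dSA).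
  have EA c u : u \in E c -> u \in A by rewrite inE => /andP [].
  have yz1 u : u \in E (g z) -> (y != u) && ~~ (y -- u).
    move=> uE; have uA := EA _ _ uE; apply/andP; split; first by apply: contraNneq yA => ->.
    by apply/negP => /(hy u uA) uE'; have := apE _ _ cN dN cd u u uE' uE; rewrite eqxx.
  have zy1 u : u \in E (g y) -> (z != u) && ~~ (z -- u).
    move=> uE; have uA := EA _ _ uE; apply/andP; split; first by apply: contraNneq zA => ->.
    by apply/negP => /(hz u uA) uE'; have := apE _ _ cN dN cd u u uE uE'; rewrite eqxx.
  apply: apart_rconsl; apply: apart_rconsr.
  + by move=> u w /sy uE /sz wE; apply: (apE _ _ cN dN cd).
  + by apply: apart_sym; apply: apart1 => u /sy; apply: zy1.
  + by apply: apart1 => u /sz; apply: yz1.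
  + by apply: apart1 => u; rewrite inE => /eqP ->; rewrite yz stS.
Qed.

End Pieces.

(** * Breadth-first layers and descent along heavy branches *)

Section Layers.
Variable G : sgraph.
Implicit Types (u v w x y z c e : G) (p q r C R P : seq G) (A B D N Y K S X : {set G}).

Lemma connected_cross A X x b : connected A -> x \in A -> x \in X -> b \in A -> b \notin X ->
  exists u v, [/\ u \in A, u \in X, v \in A, v \notin X & u -- v].
Proof.
move=> cA xA xX bA bX; case/connectP: (connectedP _ cA x b xA bA) => p.
elim: p x xA xX => [|a p IH] x xA xX /=; first by move=> _ e; rewrite e xX in bX.
case/andP => /and3P [_ aA xa] hp e.
have [aX|aX] := boolP (a \in X); first exact: IH hp e.
by exists x, a; split.
Qed.

(** A breadth-first tree of [A] with root [x]: [d] is the depth, and by the last clause an edge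
    never skips a layer. *)
Definition layering A x (d : G -> nat) (par : G -> G) :=
  [/\ d x = 0,
      forall u, u \in A -> u != x -> [/\ par u \in A, par u -- u & d u = (d (par u)).+1] &
      forall u v, u \in A -> v \in A -> u -- v -> d v <= (d u).+1].

Lemma layering_exists A x : connected A -> x \in A -> exists d par, layering A x d par.
Proof.
move=> cA xA.
(* [reach n u] holds if a walk of length [n] leads from [x] to [u]; the depth is the least such
   [n]. *)
pose reach := fix reach (n : nat) (u : G) {struct n} := if n is n'.+1 then [exists w in A, reach n' w && (w -- u)] else u == x.
have ex u : exists n, u \in A -> reach n u /\ forall m, reach m u -> n <= m.
  have [uA|] := boolP (u \in A); last by exists 0.
  have exn : exists n, reach n u.
    case/connectP: (connectedP _ cA x u xA uA) => p; elim/last_ind: p u uA => [|p a IH] u uA.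
      by move=> _ ->; exists 0; rewrite /= eqxx.
    rewrite rcons_path last_rcons => /andP [hp /and3P [lA _ la]] e.
    have [n hn] := IH _ lA hp erefl; exists n.+1 => /=.
    by apply/exists_inP; exists (last x p); rewrite // hn e.
  by case: (ex_minnP exn) => n h1 h2; exists n.
have [d hd] := fin_all_exists ex.
have exp u : exists w, u \in A -> u != x -> [/\ w \in A, w -- u & d u = (d w).+1].
  have [uA|] := boolP (u \in A); last by exists u.
  have [->|ux] := eqVneq u x; first by exists x.
  have [h1 h2] := hd u uA; case E: (d u) h1 => [|n] /=; first by rewrite (negbTE ux).
  case/exists_inP => w wA /andP [hw wu]; exists w => _ _; split=> //.
  have [g1 g2] := hd w wA; apply/eqP; rewrite eqSS eqn_leq g2 // andbT -ltnS -E; apply: h2 => /=.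
  by apply/exists_inP; exists w; rewrite // g1.
have [par hp] := fin_all_exists exp.
exists d, par; split=> //.
- by apply/eqP; rewrite -leqn0; apply: (hd x xA).2; rewrite /= eqxx.
- move=> u v uA vA uv; apply: (hd v vA).2; apply/exists_inP; exists u => //.
  by apply/andP; split=> //; exact: (hd u uA).1.
Qed.

Section Descent.
Variables (A S : {set G}) (x : G) (d : G -> nat) (par h : G -> G) (m D : nat).
Hypotheses (lay : layering A x d par) (hA : forall y, y \in S -> h y \in A).
Hypotheses (hm : forall a, a \in A -> #|[set y in S | h y == a]| <= m).
Hypotheses (hD : forall a, a \in A -> #|nbr a :&: A| <= D).

Definition child a b := [&& b \in A, b != x & par b == a].

(** Here [h] chooses a neighbour in [A] for each vertex of [S]; those counted are the ones whose
    chosen neighbour descends from [v] in the tree. *)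
Definition below v := [set y in S | (d v <= d (h y)) && (iter (d (h y) - d v) par (h y) == v)].

Definition branching v := [exists y in S, h y == v] || (1 < #|[set c | child v c]|).

(** If at most [m] vertices of [S] choose [v] itself and each of its at most [D] children has at
    most [B] of them below it, then [v] has at most m + D B. One more forces a child with more than
    [B]. *)
Fixpoint descent_bound M := if M is M'.+1 then (m + D * descent_bound M').+1 else 0.

Lemma below_split v y : v \in A -> y \in below v ->
  h y = v \/ exists2 c, child v c & y \in below c.
Proof.
case: lay => d0 dp _ vA; rewrite !inE => /and3P [yS le /eqP e].
have [e0|lt] := eqVneq (d v) (d (h y)).
  by left; rewrite -e e0 subnn.
right; have {}lt : d v < d (h y) by slia.
pose n := d (h y) - (d v).+1; have en : d (h y) - d v = n.+1 by rewrite /n; slia.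
have key j : j <= n -> [/\ iter j par (h y) \in A & d (iter j par (h y)) = d (h y) - j].
  elim: j => [|j IH] jn; first by rewrite /= subn0 hA.
  have [jA dj] := IH (ltnW jn).
  have nx : iter j par (h y) != x.
    apply/negP => /eqP ex; move: dj; rewrite ex d0; move: jn lt; rewrite /n; slia.
  by have [h1 h2 h3] := dp _ jA nx; split=> //=; rewrite h3 /= in dj; slia.
have [cA dc] := key n (leqnn n).
have nx : iter n par (h y) != x.
  by apply/negP => /eqP ex; move: dc; rewrite ex d0; move: lt; rewrite /n; slia.
have [_ _ h3] := dp _ cA nx.
exists (iter n par (h y)); first by rewrite /child cA nx /= -e en /= eqxx.
have edc : d (iter n par (h y)) = (d v).+1 by rewrite dc /n; slia.
by rewrite inE yS edc lt eqxx.
Qed.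

Lemma children_bound v : v \in A -> #|[set c | child v c]| <= D.
Proof.
move=> vA; apply: leq_trans (hD vA); apply/subset_leq_card/subsetP => c.
rewrite !inE => /and3P [cA cx /eqP e]; case: lay => _ dp _.
by have [_ + _] := dp c cA cx; rewrite e cA => ->.
Qed.

(** Always go to a child that keeps enough of [S] below it. A branching vertex costs one level of
    [descent_bound]; at any other vertex the only child inherits everything. The number [n] bounds
    the depth that remains. *)
Lemma descent M n v : v \in A -> (forall w, w \in A -> d w < d v + n) ->
  descent_bound M <= #|below v| ->
  exists p, path child v p /\ M <= count branching (v :: p).
Proof.
elim: n M v => [|n IH] M v vA hn; first by have := hn v vA; rewrite addn0 ltnn.
case: M => [|M] hb; first by exists [::].
have hc c : child v c -> forall w, w \in A -> d w < d c + n.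
  move=> /and3P [cA cx /eqP ec] w wA; have := hn w wA; case: lay => _ dp _.
  by have [_ _ ->] := dp c cA cx; rewrite ec; slia.
have [gv|] := boolP (branching v).
  have [c cv big] : exists2 c, child v c & descent_bound M <= #|below c|.
    have [/existsP [c /andP [cv h1]]|/existsPn none] := boolP [exists c, child v c && (descent_bound M <= #|below c|)]; first by exists c.
    suff : #|below v| <= m + D * descent_bound M by move: hb => /=; slia.
    have sub : below v \subset [set y in S | h y == v] :|: \bigcup_(c in [set c | child v c]) below c.
      apply/subsetP => y yb; have [e|[c cv yc]] := below_split vA yb.
        by rewrite inE; apply/orP; left; move: yb; rewrite !inE e eqxx andbT => /and3P [].
      by rewrite inE; apply/orP; right; apply/bigcupP; exists c => //; rewrite inE.
    apply: leq_trans (subset_leq_card sub) _; apply: leq_trans (leq_card_setU _ _) _.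
    apply: leq_add; first exact: hm.
    have := children_bound vA; set CC := [set c | child v c] => hCC.
    apply: (@leq_trans (#|CC| * descent_bound M)); last by rewrite leq_mul2r hCC orbT.
    rewrite -sum_nat_const.
    have : #|\bigcup_(c in CC) below c| <= \sum_(c in CC) #|below c|.
      elim/big_ind2: _ => [|X1 n1 X2 n2 h1 h2|//]; first by rewrite cards0.
      by apply: leq_trans (leq_card_setU _ _) _; apply: leq_add.
    move=> h1; apply: (leq_trans h1); apply: leq_sum => c; rewrite inE => cv.
    by have := none c; rewrite cv /= -ltnNge => /ltnW.
  have cA : c \in A by case/and3P: cv.
  have [p [hp cp]] := IH M c cA (hc c cv) big.
  by exists (c :: p); rewrite /= cv hp /= gv; split=> //; move: cp => /=; slia.
rewrite negb_or -leqNgt => /andP [/exists_inPn nh nc].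
have [y yb] : exists y, y \in below v by apply/card_gt0P; move: hb => /=; slia.
have [e|[c cv yc]] := below_split vA yb.
  by have := nh y; rewrite e eqxx => /(_ _); case/(_ _)/negP => //; move: yb; rewrite inE => /andP [].
have cA : c \in A by case/and3P: cv.
have sub : below v \subset below c.
  apply/subsetP => z zb; have [e|[c' cv' zc]] := below_split vA zb.
    by have zS : z \in S by [move: zb; rewrite inE => /andP []]; have := nh z zS; rewrite e eqxx.
  by have <- : c' = c by apply: (card_le1_eqP nc); rewrite inE.
have [p [hp cp]] := IH M.+1 c cA (hc c cv) (leq_trans hb (subset_leq_card sub)).
by exists (c :: p); rewrite /= cv hp; split=> //; move: cp => /=; slia.
Qed.

(** A descending path meets each layer at most once, and since edges do not skip layers it has no
    chords. *)
Lemma descent_path p : x \in A -> path child x p ->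
  [/\ {subset x :: p <= A}, forall i, i < size (x :: p) -> d (nth x (x :: p) i) = i,
      ipath (x :: p) & {in x :: p, forall u, d u = index u (x :: p)}].
Proof.
case: lay => d0 dp dl xA hp.
have cA i : i < size p -> child (nth x (x :: p) i) (nth x p i) by move/(pathP x): hp => h1; apply: h1.
have sA : {subset x :: p <= A}.
  move=> u; rewrite inE => /orP [/eqP ->//|/(nthP x) [i ip <-]].
  by case/and3P: (cA i ip).
have di i : i < size (x :: p) -> d (nth x (x :: p) i) = i.
  elim: i => [|i IH] ip; first by rewrite /= d0.
  have /and3P [bA bx /eqP eb] := cA i ip; have [_ _ ->] := dp _ bA bx.
  by rewrite eb IH //; apply: ltnW.
have U : uniq (x :: p).
  apply/(uniqP x) => i j; rewrite !inE => hi hj e.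
  by rewrite -(di i hi) -(di j hj) e.
split=> //; last by move=> u up; rewrite -{1}(nth_index x up) di ?index_mem.
apply: ipath_intro => // u v up vp lt.
have iu : index u (x :: p) < size (x :: p) by rewrite index_mem.
have iv : index v (x :: p) < size (x :: p) by rewrite index_mem.
have du : d u = index u (x :: p) by rewrite -{1}(nth_index x up) di.
have dv : d v = index v (x :: p) by rewrite -{1}(nth_index x vp) di.
have [e|ne] := eqVneq (index v (x :: p)) (index u (x :: p)).+1.
  have ip : index u (x :: p) < size p by rewrite e /= in iv.
  have /and3P [bA bx /eqP eb] := cA _ ip; have [_ h1 _] := dp _ bA bx.
  have eu : nth x (x :: p) (index u (x :: p)) = u by rewrite nth_index.
  have ev : nth x p (index u (x :: p)) = v.
    by rewrite -[LHS]/(nth x (x :: p) (index u (x :: p)).+1) -e nth_index.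
  by rewrite eb ev eu in h1.
apply/negbTE/negP => uv; have := dl u v (sA u up) (sA v vp) uv.
by rewrite du dv; move: ne lt; slia.
Qed.

End Descent.

(* [d] is the distance to the root. *)
Lemma branching_path A S (m D M : nat) x : connected A -> touches S A -> x \in A ->
  (forall a, a \in A -> #|nbr a :&: S| <= m) ->
  (forall a, a \in A -> #|nbr a :&: A| <= D) ->
  descent_bound m D M <= #|S| ->
  exists P d h, [/\ ipath P /\ {subset P <= A},
    {in P, forall u, d u = index u P} /\
      (forall u v, u \in A -> v \in A -> u -- v -> d v <= (d u).+1),
    forall y, y \in S -> h y \in A /\ y -- h y &
    exists W : {set G}, [/\ {subset W <= P}, M <= #|W| &
      forall w, w \in W -> (exists2 y, y \in S & h y = w) \/
                           (exists2 c, c \in A & c \notin P /\ w -- c)]].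
Proof.
move=> cA tA xA hm hD big.
have [d [par lay]] := layering_exists cA xA.
have [d0 dp dl] := lay.
have exh y : exists a, y \in S -> a \in A /\ y -- a.
  have [yS|] := boolP (y \in S); last by exists y.
  by have [a aA ya] := touchesP _ _ tA y yS; exists a.
have [h hh] := fin_all_exists exh.
have hA y : y \in S -> h y \in A by case/hh.
have hm' a : a \in A -> #|[set y in S | h y == a]| <= m.
  move=> aA; apply: leq_trans (hm a aA); apply/subset_leq_card/subsetP => y.
  by rewrite !inE => /andP [yS /eqP <-]; have [_] := hh y yS; rewrite sedge_sym yS => ->.
have toroot n u : d u = n -> u \in A -> iter n par u == x.
  elim: n u => [|n IH] u e uA; have [ux|ux] := eqVneq u x; rewrite ?ux ?eqxx //.
  - by have [_ _] := dp u uA ux; rewrite e.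
  - by rewrite ux d0 in e.
  - by have [pA _ e2] := dp u uA ux; rewrite iterSr IH //; rewrite e in e2; case: e2.
have bx : #|below S d par h x| = #|S|.
  apply: eq_card => y; rewrite inE d0 leq0n subn0 /=.
  by have [yS|//] := boolP (y \in S); rewrite toroot // hA.
have bound w : w \in A -> d w < d x + (\max_(w in A) d w).+1.
  by move=> wA; rewrite d0 add0n ltnS; apply: (@leq_bigmax_cond _ (mem A) d).
rewrite -bx in big.
have [p [hp cp]] := descent lay hA hm' hD xA bound big.
have [sA di iP dP] := descent_path lay xA hp.
exists (x :: p), d, h; split=> //; exists [set w in x :: p | branching A S x par h w]; split.
- by move=> w; rewrite inE => /andP [].
- apply: leq_trans cp _; rewrite -size_filter.
  have /card_uniqP <- : uniq (filter (branching A S x par h) (x :: p)) by rewrite filter_uniq ?ipath_uniq.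
  by apply/subset_leq_card/subsetP => w; rewrite mem_filter [_ \in [set _ in _ | _]]inE andbC.
move=> w; rewrite inE => /andP [wP /orP [/exists_inP [y yS /eqP e]|two]]; [left|right].
  by exists y.
(* Two children of [w] lie in the same layer, so at most one of them is on the path. *)
have /card_gt1P [c1 [c2 [h1 h2 ne]]] := two.
rewrite !inE in h1 h2; have /and3P [c1A c1x /eqP e1] := h1; have /and3P [c2A c2x /eqP e2] := h2.
have [_ wc1 d1] := dp _ c1A c1x; have [_ wc2 d2] := dp _ c2A c2x.
have [in1|] := boolP (c1 \in x :: p); last by exists c1; rewrite // -e1.
have [in2|] := boolP (c2 \in x :: p); last by exists c2; rewrite // -e2.
exfalso; move/negP: ne; apply; apply/eqP.
by rewrite -(nth_index x in1) -(nth_index x in2) -!dP // d1 d2 e1 e2.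
Qed.

End Layers.

(** * The pieces that a geodesic leaves *)

Section PathPieces.
Variable G : sgraph.
Implicit Types (u v w x y z c e p q : G) (r C R P : seq G) (A B D N Y K S X W T : {set G}).

Definition geodesic A P (d : G -> nat) :=
  [/\ ipath P, {subset P <= A}, {in P, forall u, d u = index u P} &
      forall u v, u \in A -> v \in A -> u -- v -> d v <= (d u).+1].

Definition pieces A P := [set component (A :\: [set:: P]) u | u in A :\: [set:: P]].

Lemma card_choice (T1 T2 : finType) (U : {set T1}) (V : {set T2}) (f : T1 -> T2) :
  {in U, forall t, f t \in V} -> {in U &, injective f} -> #|U| <= #|V|.
Proof.
move=> h inj; rewrite -(card_in_imset inj); apply/subset_leq_card/subsetP => y.
by case/imsetP => t tU ->; apply: h.
Qed.

(** [B] need only contain the stretch between [u] and [v], so this applies to sets that miss other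
    vertices of the path. *)
Lemma ipath_connected P u v : ipath P -> u \in P -> v \in P ->
  forall B, {in P, forall w, minn (index u P) (index v P) <= index w P <= maxn (index u P) (index v P) -> w \in B} ->
  connect (inrel B) u v.
Proof.
move=> hP uP vP B.
wlog le : u v uP vP / index u P <= index v P.
  move=> H hB; have [le|/ltnW le] := leqP (index u P) (index v P); first exact: H.
  by rewrite cinrel_sym; apply: H => // w wP; rewrite minnC maxnC; apply: hB.
rewrite (minn_idPl le) (maxn_idPr le) => hB.
have sz : index v P < size P by rewrite index_mem.
have gen k : index u P + k <= index v P -> connect (inrel B) u (nth u P (index u P + k)).
  elim: k => [|k IH] hk; first by rewrite addn0 nth_index.
  apply: connect_trans (IH _) (connect1 _); first by slia.
  have U := ipath_uniq hP.
  have m1 : nth u P (index u P + k) \in P by rewrite mem_nth //; slia.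
  have m2 : nth u P (index u P + k.+1) \in P by rewrite mem_nth //; slia.
  rewrite /inrel /= !hB // ?index_uniq // ?(ipath_adj hP) ?index_uniq //; slia.
by have := gen (index v P - index u P); rewrite subnKC // nth_index //; apply.
Qed.

(** [K] joins the two sides of [p], so the rest of [P] lies in one component [X] of [A] without [p].
    If [X] is everything, minimality gives a vertex of [S] that sees [A] only in [p]. Otherwise any
    other component avoids [P], hence is a piece attached to [P] only at [p]. *)
Lemma inner_vertex S A P K (p a b : G) : minimal_for S A -> ipath P -> {subset P <= A} ->
  K \in pieces A P -> p \in P -> a \in P -> b \in P ->
  index a P < index p P -> index p P < index b P ->
  (exists2 c, c \in K & c -- a) -> (exists2 c, c \in K & c -- b) ->
  (exists2 y, y \in S & y -- p /\ forall q, q \in A -> y -- q -> q = p) \/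
  (exists2 E, E \in pieces A P & (exists2 c, c \in E & c -- p) /\
     forall c q, c \in E -> q \in P -> c -- q -> q = p).
Proof.
move=> [cA tA minA] hP PA /imsetP [k kA eK] pP aP bP ap pb [c1 c1K c1a] [c2 c2K c2b].
have pA := PA p pP.
have kAp : k \in A :\ p.
  move: kA; rewrite !inE => /andP [kP ->]; rewrite andbT.
  by apply: contraNneq kP => ->.
pose X := component (A :\ p) k.
have sub : A :\: [set:: P] \subset A :\ p.
  by apply/subsetP => v; rewrite !inE => /andP [vP ->]; rewrite andbT; apply: contraNneq vP => ->.
have KX : {subset K <= X}.
  by move=> v; rewrite eK !inE; apply: connect_sub_set.
(* From [v] follow [P] without crossing [p] to the attachment of [K] on the same side. *)
have PX v : v \in P -> v != p -> v \in X.
  move=> vP vp; have ne : index v P != index p P.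
    by apply: contraNneq vp => e; rewrite -(nth_index v vP) e nth_index.
  have go c e : c \in K -> c -- e -> e \in P -> e != p -> ((index e P < index p P) = (index v P < index p P)) -> v \in X.
    move=> cK ce eP ep es.
    have eX : e \in X.
      apply: (component_closed kAp (KX _ cK)) => //; by rewrite !inE ep PA.
    rewrite /X -(component_eq eX) inE.
    have eq1 : index e P != index p P.
      by apply: contraNneq ep => e'; rewrite -(nth_index e eP) e' nth_index.
    apply: (ipath_connected hP) => // w wP hw; rewrite !inE PA // andbT.
    by apply: contraTneq hw => ->; slia.
  have [lt|gt] : index v P < index p P \/ index p P < index v P by slia.
  - by apply: (go c1 a) => //; [apply: contraTneq ap => ->; rewrite ltnn|rewrite ap lt].
  - by apply: (go c2 b) => //; [apply: contraTneq pb => ->; rewrite ltnn|slia].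
have [conn|] := boolP (connected (A :\ p)).
  left; have pr : A :\ p \proper A.
    by apply/properP; split; [exact: subD1set|exists p; rewrite // !inE eqxx].
  have [y yS hy] := minA _ pr conn.
  have only q : q \in A -> y -- q -> q = p.
    by move=> qA yq; apply/eqP; apply: contraTT yq => qp; apply: hy; rewrite !inE qp.
  exists y => //; split=> //.
  have [q qA yq] := touchesP _ _ tA y yS.
  by rewrite -(only q qA yq).
move=> nconn; right.
have [u uA uX] : exists2 u, u \in A :\ p & u \notin X.
  apply/exists_inP; apply: contraNT nconn => /exists_inPn h.
  apply: (connected_root kAp) => w /h /negPn; rewrite inE.
  by rewrite cinrel_sym.
pose E := component (A :\ p) u.
have Edis v : v \in E -> v \notin X.
  move=> vE; apply: contra uX => vX.
  by rewrite /X -(component_eq vX) (component_eq vE) component_self.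
have EP : E \subset A :\: [set:: P].
  apply/subsetP => v vE; have := subsetP (component_sub uA) v vE; rewrite !inE => /andP [vp ->].
  by rewrite andbT; apply: contraL (vE) => vP; apply/negP => /Edis; rewrite PX.
have uE : u \in E by apply: component_self.
exists E.
  apply/imsetP; exists u; first exact: (subsetP EP).
  apply/setP => v; apply/idP/idP => vE.
    by rewrite inE; apply: (connect_sub_set EP); apply: (connectedP _ (component_connected uA)).
  by move: vE; rewrite !inE; apply: connect_sub_set.
have only c q : c \in E -> q \in P -> c -- q -> q = p.
  move=> cE qP cq; apply/eqP; apply: contraTT isT => qp.
  have qE : q \in E by apply: (component_closed uA cE) => //; rewrite !inE qp PA.
  by have := Edis _ qE; rewrite PX.
split=> //.
have pE : p \notin E by apply: contraTN isT => /(subsetP (component_sub uA)); rewrite !inE eqxx.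
have uA' : u \in A by move: uA; rewrite inE => /andP [].
have [c [q [cA' cE qA qE cq]]] := connected_cross cA uA' uE pA pE.
exists c => //; have [<- //|qp] := eqVneq q p.
by move: qE; rewrite (component_closed uA cE) // !inE qp.
Qed.

(** Among the branching vertices fewer than k are chosen by vertices of [S]. The others have
    neighbours off the path; if there are fewer than k pieces, one of these is attached at more than
    2k+2 of them. Without the first and the last, at least 2k remain, and k of them fall under the
    same alternative of [inner_vertex]. *)
Definition path_bound (m D k : nat) := descent_bound m D (k * (2 * k + 2) + k).+1.

Lemma path_pieces S A (m D k : nat) x : minimal_for S A -> x \in A ->
  (forall a, a \in A -> #|nbr a :&: S| <= m) ->
  (forall a, a \in A -> #|nbr a :&: A| <= D) ->
  path_bound m D k <= #|S| ->
  exists P d, geodesic A P d /\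
   ((exists T, [/\ T \subset S, #|T| = k & forall y, y \in T -> exists2 p, p \in P & y -- p]) \/
    (exists KK : {set {set G}}, KK \subset pieces A P /\ #|KK| = k)).
Proof.
move=> mA xA hm hD big; have [cA tA _] := mA.
have [P [d [h [[iP PA] [dP dl] hh [W [WP bW hW]]]]]] := branching_path cA tA xA hm hD big.
exists P, d; split=> //.
have [pk|pk] := leqP k #|pieces A P|.
  by right; have [KK s c] := subset_card pk; exists KK.
left; pose Q := [set y in S | [exists p in P, y -- p]].
suff : k <= #|Q|.
  case/subset_card => T /subsetP s c; exists T; split=> //.
    by apply/subsetP => y /s; rewrite inE => /andP [].
  by move=> y /s; rewrite inE => /andP [_ /exists_inP].
rewrite leqNgt; apply/negP => Qk.
pose W1 := [set w in W | [exists y in S, h y == w]].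
have c1 : #|W1| <= #|Q|.
  have ex w : exists y, w \in W1 -> [/\ y \in S & h y = w].
    have [|] := boolP (w \in W1); last by exists w.
    by rewrite inE => /andP [_ /exists_inP [y yS /eqP e]]; exists y.
  have [f hf] := fin_all_exists ex.
  apply: (@card_choice _ _ W1 Q f).
    move=> w wW1; have [yS e] := hf w wW1; rewrite inE yS; apply/exists_inP; exists w.
      by apply: WP; move: wW1; rewrite inE => /andP [].
    by rewrite -[X in _ -- X]e; have [] := hh _ yS.
  by move=> w w' wW wW' e; have [_ <-] := hf w wW; have [_ <-] := hf w' wW'; rewrite e.
pose W2 := W :\: W1.
have c2 : k * (2 * k + 2) < #|W2|.
  have : #|W| <= #|W1| + #|W2| by rewrite -(cardsID W1 W) leq_add2r; apply/subset_leq_card/subsetIr.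
  by move: bW c1 Qk; slia.
have exc w : exists c, w \in W2 -> [/\ c \in A, c \notin P & w -- c].
  have [|] := boolP (w \in W2); last by exists w.
  rewrite inE => /andP [nW1 wW]; case: (hW w wW) => [[y yS e]|[c cA' [cP wc]]].
    by case/negP: nW1; rewrite inE wW; apply/exists_inP; exists y; rewrite ?e.
  by exists c.
have [f hf] := fin_all_exists exc.
pose F w := component (A :\: [set:: P]) (f w).
have FK : {in W2, forall w, F w \in pieces A P}.
  by move=> w wW; have [h1 h2 _] := hf w wW; apply: imset_f; rewrite !inE h1 h2.
have [|K KK big3] := @pigeonhole _ _ F W2 (pieces A P) (2 * k + 2) FK.
  apply: leq_ltn_trans c2; rewrite leq_mul2r; apply/orP; right; exact: ltnW.
set W3 := [set w in W2 | F w == K] in big3.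
have W3P w : w \in W3 -> w \in P by rewrite !inE => /andP [/andP [_ wW] _]; apply: WP.
have W3c w : w \in W3 -> exists2 c, c \in K & c -- w.
  rewrite inE => /andP [wW /eqP <-]; have [_ _ wc] := hf w wW; exists (f w); first exact: component_self.
  by rewrite sedge_sym.
have [w0 w0W] : exists w, w \in W3 by apply/card_gt0P; slia.
have exi : exists i, [exists w in W3, index w P == i] by exists (index w0 P); apply/exists_inP; exists w0.
have bdi i : [exists w in W3, index w P == i] -> i <= size P.
  by case/exists_inP => w _ /eqP <-; apply: index_size.
case: (ex_minnP exi) => i /exists_inP [a aW /eqP ea] mina.
case: (ex_maxnP exi bdi) => j /exists_inP [b bW' /eqP eb] maxb.
(* Every vertex that remains lies strictly between two attachments of [K]. *)
pose W4 := W3 :\ a :\ b.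
have W4i w : w \in W4 -> [/\ w \in W3, index a P < index w P & index w P < index b P].
  rewrite 2!in_setD1 => /and3P [wb wa wW3].
  have wi : [exists w' in W3, index w' P == index w P] by apply/exists_inP; exists w.
  have neq v : v \in W3 -> w != v -> index v P != index w P.
    move=> vW; apply: contraNneq => e.
    by rewrite -(nth_index w (W3P _ wW3)) -e nth_index // W3P.
  have h1 := mina _ wi; have h2 := maxb _ wi; have h3 := neq a aW wa; have h4 := neq b bW' wb.
  by rewrite wW3; split=> //; rewrite ?ea ?eb in h3 h4 *; clear mina maxb; slia.
have c4 : k + k <= #|W4|.
  by have := cardsD1 a W3; have := cardsD1 b (W3 :\ a); rewrite -/W4; clear mina maxb; slia.
(* The first alternative of [inner_vertex], as a boolean. *)
pose good p := [exists y in S, (y -- p) && [forall q in A, (y -- q) ==> (q == p)]].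
have [g [W5 [s5 c5 hg]]] := @pigeonhole_bool _ good W4 k c4.
have inW5 w : w \in W5 -> [/\ w \in W3, index a P < index w P & index w P < index b P].
  by move/(subsetP s5); apply: W4i.
case: g hg => hg.
  have ex w : exists y, w \in W5 -> [/\ y \in S, y -- w & forall q, q \in A -> y -- q -> q = w].
    have [wW|] := boolP (w \in W5); last by exists w.
    have /exists_inP [y yS /andP [yw /forall_inP h1]] := hg w wW; exists y => _; split=> //.
    by move=> q qA yq; have := h1 q qA; rewrite yq => /eqP.
  have [f' hf'] := fin_all_exists ex.
  suff : k <= #|Q| by rewrite leqNgt Qk.
  rewrite -c5; apply: (@card_choice _ _ W5 Q f').
    move=> w wW; have [yS yw _] := hf' w wW; rewrite inE yS; apply/exists_inP; exists w => //.
    by have [/W3P] := inW5 w wW.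
  move=> w w' wW wW' e; have [_ yw _] := hf' w wW; have [_ _ h1] := hf' w' wW'.
  by apply: h1; [apply/PA/W3P; have [] := inW5 w wW|rewrite -e].
have ex w : exists E : {set G}, w \in W5 -> [/\ E \in pieces A P, exists2 c, c \in E & c -- w &
     forall c q, c \in E -> q \in P -> c -- q -> q = w].
  have [wW|] := boolP (w \in W5); last by exists set0.
  have [wW3 aw wb] := inW5 w wW.
  have := inner_vertex mA iP PA KK (W3P _ wW3) (W3P _ aW) (W3P _ bW') aw wb (W3c _ aW) (W3c _ bW').
  case=> [[y yS [yw h1]]|[E EE [h1 h2]]]; last by exists E.
  have := hg w wW => /negbT /exists_inPn /(_ y yS); rewrite yw /= => /negP; case.
  by apply/forall_inP => q qA; apply/implyP => yq; rewrite (h1 q).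
have [f' hf'] := fin_all_exists ex.
suff : k <= #|pieces A P| by rewrite leqNgt pk.
rewrite -c5 -(@card_in_imset _ _ f' (mem W5)).
  by apply/subset_leq_card/subsetP => E /imsetP [w wW ->]; have [] := hf' w wW.
move=> w w' wW wW' e; have [_ [c cE cw] _] := hf' w wW; have [_ _ h2] := hf' w' wW'.
by apply: (h2 c) => //; [rewrite -e|apply: W3P; have [] := inW5 w wW].
Qed.

End PathPieces.

(** * Types of attachment, and ladders without legs *)

Section Ladders.
Variable G : sgraph.
Implicit Types (u v w x y z c e p q : G) (r C R P : seq G) (A B D N Y K S X W T : {set G}).

(** A ladder before the types and the emptiness of the legs have been made uniform. *)
Definition preladder D P (leg : G -> seq G) S :=
  [/\ ipath P /\ {subset P <= D},
      forall y, y \in S ->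
        [/\ {subset leg y <= D}, ipath (rcons (leg y) y) /\ head y (leg y) \notin P,
            apart (behead (rcons (leg y) y)) P &
            exists2 p, p \in P & head y (leg y) -- p],
      {in S &, forall y z, y != z -> apart (rcons (leg y) y) (rcons (leg z) z)} &
      {in S &, forall y z, y != z ->
         before P (head y (leg y)) (head z (leg z)) \/
         before P (head z (leg z)) (head y (leg y))}].

(** Boolean, so that the pigeonhole principle can be applied to the types. *)
Definition meetsb (k : attach) P e := match k with
  | Single => [exists c in P, (e -- c) && [forall v in P, (e -- v) ==> (v == c)]]
  | Triangle => [exists u in P, exists w in P, [&& u -- w, e -- u, e -- w &
                   [forall v in P, (e -- v) ==> ((v == u) || (v == w))]]]
  | Wide => [exists u in P, exists w in P, [&& u != w, ~~ (u -- w), e -- u & e -- w]]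
  end.

Lemma meetsP k P e : reflect (meets k P e) (meetsb k P e).
Proof.
case: k; apply: (iffP exists_inP).
- case=> c cP /andP [ec /forall_inP h]; exists c => // v vP ev.
  by have := h v vP; rewrite ev => /eqP.
- case=> c [cP ec] h; exists c; rewrite // ec; apply/forall_inP => v vP.
  by apply/implyP => ev; rewrite (h v).
- case=> u uP /exists_inP [w wP /and4P [uw eu ew /forall_inP h]]; exists u, w; split=> // v vP ev.
  by have := h v vP; rewrite ev => /orP [] /eqP; auto.
- case=> u [w [[uP wP] uw [eu ew] h]]; exists u => //; apply/exists_inP; exists w => //.
  rewrite uw eu ew; apply/forall_inP => v vP; apply/implyP => ev.
  by case: (h v vP ev) => ->; rewrite eqxx ?orbT.
- by case=> u uP /exists_inP [w wP /and4P [uw nuw eu ew]]; exists u, w.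
- by case=> u [w [[uP wP] uw nuw [eu ew]]]; exists u => //; apply/exists_inP; exists w; rewrite // uw nuw eu ew.
Qed.

(** If no two neighbours are nonadjacent, they are pairwise consecutive on [P], so there are at most
    two. *)
Lemma meets_cases P e : ipath P -> (exists2 p, p \in P & e -- p) ->
  exists k, meets k P e.
Proof.
move=> hP [p pP ep].
have [/meetsP h|nw] := boolP (meetsb Wide P e); first by exists Wide.
have [/existsP [w /and3P [wP ew wp]]|one] := boolP [exists w, [&& w \in P, e -- w & w != p]].
  exists Triangle; exists p, w.
  have adj u v : u \in P -> v \in P -> e -- u -> e -- v -> u != v -> u -- v.
    move=> uP vP eu ev uv; move: nw; apply: contraNT => nuv; apply/exists_inP; exists u => //.
    by apply/exists_inP; exists v; rewrite // uv nuv eu ev.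
  have pw : p -- w by apply: adj; rewrite // eq_sym.
  split=> // v vP ev; have [|vp] := eqVneq v p; first by left.
  have [|vw] := eqVneq v w; first by right.
  have h1 := adj _ _ vP pP ev ep vp; have h2 := adj _ _ vP wP ev ew vw.
  move: pw h1 h2; rewrite !(ipath_adj hP) //.
  have : index v P != index p P by apply: contraNneq vp => h; rewrite -(nth_index v vP) h nth_index.
  slia.
exists Single; exists p => // v vP ev; apply/eqP; apply: contraNT one => vp.
by apply/existsP; exists v; rewrite vP ev.
Qed.

(** The factor 8 pays for three binary choices: wide or not, single or not, empty leg or not. *)
Lemma preladder_kind D P leg S n : preladder D P leg S -> 8 * n <= #|S| ->
  exists k b S', [/\ S' \subset S, #|S'| = n & ladder_in D P leg S' k b].
Proof.
case=> hP hS apS beS big.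
pose f1 y := meetsb Wide P (head y (leg y)); pose f2 y := meetsb Single P (head y (leg y)).
have [b1 [S1 [s1 c1 h1]]] := @pigeonhole_bool _ f1 S (4 * n) ltac:(lia).
have [b2 [S2 [s2 c2 h2]]] := @pigeonhole_bool _ f2 S1 (2 * n) ltac:(lia).
have [b3 [S3 [s3 c3 h3]]] := @pigeonhole_bool _ (fun y => leg y == [::]) S2 n ltac:(lia).
have i3 y : y \in S3 -> [/\ y \in S, y \in S1 & y \in S2].
  move=> /(subsetP s3) y2; have y1 := subsetP s2 _ y2; split=> //; exact: (subsetP s1).
have hk : exists k, forall y, y \in S3 -> meets k P (head y (leg y)).
  case: b1 h1 => h1; first by exists Wide => y /i3 [_ y1 _]; apply/meetsP/h1.
  case: b2 h2 => h2; first by exists Single => y /i3 [_ _ y2]; apply/meetsP/h2.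
  exists Triangle => y /i3 [yS y1 y2]; have [_ _ _ ex] := hS y yS.
  case: (meets_cases hP.1 ex) => [[]] // /meetsP hm; first by have := h2 y y2; rewrite /f2 hm.
  by have := h1 y y1; rewrite /f1 hm.
case: hk => k hk; exists k, b3, S3; split=> //.
  by apply/subsetP => y /i3 [].
split=> //.
- by move=> y y3; have [yS _ _] := i3 y y3; have [a1 a2 a3 _] := hS y yS; split; auto.
- by move=> y z /i3 [yS _ _] /i3 [zS _ _]; apply: apS.
- by move=> y z /i3 [yS _ _] /i3 [zS _ _]; apply: beS.
Qed.

Lemma through_path D y z : connected D -> ~~ (y -- z) -> y != z -> z \notin D ->
  (exists2 a, a \in D & y -- a) -> (exists2 a, a \in D & z -- a) ->
  exists R, ipath (y :: rcons R z) /\ {subset R <= D}.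
Proof.
move=> cD yz nyz zD [a aD ya] [b bD zb].
have cB := connected_setU1 cD aD ya.
have [] := @ipath_to _ (y |: D) y (sedge z) cB (setU11 _ _) (ex_intro2 _ _ b _ zb).
  by rewrite !inE bD orbT.
move=> R [hR sR lR bR]; exists R; split; last first.
  move=> u uR; have := sR u; rewrite !inE uR orbT => /(_ isT) /orP [/eqP e|//].
  by move: (ipath_uniq hR); rewrite /= -e uR.
rewrite -rcons_cons; apply: ipath_snoc => //; first by rewrite sedge_sym.
  by apply/negP => /sR; rewrite !inE eq_sym (negbTE nyz) (negbTE zD).
by move=> u /bR; rewrite sedge_sym.
Qed.

(** The gap extends from the last neighbour before position [k] to the first one after it. *)
Lemma gap_exists P y k : uniq P -> k < size P -> ~~ (y -- nth y P k) ->
  (exists2 i, i <= k & y -- nth y P i) -> (exists2 j, k <= j < size P & y -- nth y P j) ->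
  exists ab : nat * nat, [/\ ab.1 < k, k < ab.2, ab.2 < size P &
    forall i, ab.1 <= i <= ab.2 -> y -- nth y P i = (i == ab.1) || (i == ab.2)].
Proof.
move=> U kP nk [i ik yi] [j /andP [kj jP] yj].
pose Z1 := [pred i | (i <= k) && (y -- nth y P i)].
pose Z2 := [pred j | (k <= j) && (y -- nth y P j)].
have e1 : exists i, Z1 i by exists i; rewrite /= ik yi.
have b1 l : Z1 l -> l <= k by case/andP.
have e2 : exists j, Z2 j by exists j; rewrite /= kj yj.
case: (ex_maxnP e1 b1) => a /andP [ak ya] maxa; case: (ex_minnP e2) => b /andP [kb yb] minb.
have a1 : a != k by apply: contraNneq nk => <-.
have b1' : b != k by apply: contraNneq nk => <-.
have bj : b <= j by apply: minb; rewrite /= kj yj.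
have maxa' l : l <= k -> y -- nth y P l -> l <= a by move=> h1 h2; apply: maxa; rewrite /= h1 h2.
have minb' l : k <= l -> y -- nth y P l -> b <= l by move=> h1 h2; apply: minb; rewrite /= h1 h2.
clear maxa minb e1 e2 b1 Z1 Z2.
exists (a, b); split=> /=; try slia.
move=> l hl; apply/idP/idP => [yl|/orP [] /eqP -> //].
have [h|h] := leqP l k; first by have := maxa' l h yl; slia.
by have := minb' l (ltnW h) yl; slia.
Qed.

Definition crossing P y z :=
  [exists u in P, exists v in P, [&& y -- u, z -- v & index v P <= index u P]].

Lemma before_crossing P y z : ~~ crossing P y z -> before P y z.
Proof.
move=> h u v uP vP yu zv; rewrite ltnNge; apply: contra h => h.
by apply/exists_inP; exists u => //; apply/exists_inP; exists v; rewrite // yu zv.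
Qed.

(** Give each vertex the interval from its first to its last neighbour on [P], and suppose that 3m+1
    of these pairwise intersect. Then they share a position k. At most m of the vertices see it, and
    each of the others has a gap around k. By [overlapping_gaps] every such gap shares an end with
    one fixed gap, so more than 2m vertices see one of its two ends, although each end is seen by at
    most m. *)
Lemma disjoint_intervals (m n M : nat) D1 D2 Y P T : ramsey_bound (3 * m).+1 n M ->
  separated D1 D2 Y -> ~ has_theta G -> ~ has_prism G -> connected D2 ->
  T \subset Y -> {in Y &, forall y z, ~~ (y -- z)} ->
  (forall y, y \in T -> exists2 a, a \in D2 & y -- a) ->
  ipath P -> {subset P <= D1} ->
  (forall y, y \in T -> exists2 p, p \in P & y -- p) ->
  (forall p, p \in P -> #|nbr p :&: T| <= m) -> M <= #|T| ->
  exists T', [/\ T' \subset T, #|T'| = n &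
    {in T' &, forall y z, y != z -> before P y z \/ before P z y}].
Proof.
move=> hN sD nt np cD2 TY stY hD2 hP PD hT hm big.
pose cr : rel G := [rel y z | crossing P y z && crossing P z y].
have crs : symmetric cr by move=> y z; rewrite /cr /= andbC.
have [[K [sK cK hK]]|[K [sK cK hK]]] := hN G cr T crs big; last first.
  exists K; split=> // y z yK zK yz; have := hK y z yK zK yz; rewrite negb_and.
  by case/orP => /before_crossing; auto.
exfalso; have U := ipath_uniq hP.
have KT y : y \in K -> y \in T by apply: (subsetP sK).
have exlo y : exists i : nat * nat, y \in K ->
   [/\ y -- nth y P i.1, y -- nth y P i.2, i.1 < size P, i.2 < size P &
       forall p, p \in P -> y -- p -> i.1 <= index p P <= i.2].
  have [yK|] := boolP (y \in K); last by exists (0, 0).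
  have [p pP yp] := hT y (KT y yK).
  pose Z := [pred i | (i < size P) && (y -- nth y P i)].
  have eZ : exists i, Z i by exists (index p P); rewrite /= index_mem pP nth_index.
  have bZ i : Z i -> i <= size P by case/andP => /ltnW.
  case: (ex_minnP eZ) => a /andP [aP ya] mina; case: (ex_maxnP eZ bZ) => b /andP [bP yb] maxb.
  exists (a, b) => _; split=> // q qP yq.
  by rewrite mina ?maxb //= index_mem qP nth_index.
have [lh hlh] := fin_all_exists exlo.
have [y0 y0K] : exists y, y \in K by apply/card_gt0P; rewrite cK.
have [y1 y1K max1] : exists2 y, y \in K & forall z, z \in K -> (lh z).1 <= (lh y).1.
  by case: (@arg_maxnP _ y0 (mem K) (fun z => (lh z).1) y0K) => y yK h; exists y.
(* Helly's property on a line: the largest left end belongs to all the intervals. *)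
pose k := (lh y1).1.
have lohi y : y \in K -> (lh y).1 <= k <= (lh y).2.
  move=> yK; rewrite max1 //=; have [-> |ne] := eqVneq y y1.
    have [h1 _ h3 _ h5] := hlh y1 y1K; have := h5 _ (mem_nth _ h3) h1.
    by rewrite index_uniq //; case/andP.
  have := hK y y1 yK y1K ne => /andP [/exists_inP [u uP /exists_inP [v vP /and3P [yu y1v le]]] _].
  have [_ _ _ _ h5] := hlh y1 y1K; have /andP [h6 _] := h5 v vP y1v.
  have [_ _ _ _ h7] := hlh y yK; have /andP [_ h8] := h7 u uP yu.
  by apply: leq_trans h6 _; apply: leq_trans le _.
have [_ _ kP _ _] := hlh y1 y1K; rewrite -/k in kP.
pose K' := K :\: nbr (nth y1 P k).
have cK' : (2 * m) < #|K'|.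
  have h1 := hm _ (mem_nth y1 kP); have h2 := cardsID (nbr (nth y1 P k)) K.
  have h3 : #|K :&: nbr (nth y1 P k)| <= #|nbr (nth y1 P k) :&: T|.
    by apply: subset_leq_card; rewrite setIC; apply: setIS.
  move: (leq_trans h3 h1) h2; rewrite cK /K'.
  by move: #|K :&: _| #|K :\: _| => i j; clear; lia.
have K'K y : y \in K' -> y \in K /\ ~~ (y -- nth y P k).
  by rewrite !inE => /andP [+ yK]; rewrite sedge_sym (set_nth_default y).
have exab y : exists ab : nat * nat, y \in K' -> [/\ ab.1 < k, k < ab.2, ab.2 < size P &
    forall i, ab.1 <= i <= ab.2 -> y -- nth y P i = (i == ab.1) || (i == ab.2)].
  have [yK'|] := boolP (y \in K'); last by exists (0, 0).
  have [yK nk] := K'K y yK'; have /andP [l1 l2] := lohi y yK; have [h1 h2 h3 h4 _] := hlh y yK.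
  have [] := @gap_exists P y k U kP nk; first by exists (lh y).1.
    by exists (lh y).2; rewrite ?l2 ?h4.
  by move=> ab h; exists ab.
have [ab hab] := fin_all_exists exab.
have [z0 z0K] : exists y, y \in K' by apply/card_gt0P; apply: leq_ltn_trans cK'.
have [a1 b1 c1 d1] := hab z0 z0K.
have nY y : y \in K' -> y \in Y by case/K'K => /KT /(subsetP TY).
have key z : z \in K' -> (ab z).1 = (ab z0).1 \/ (ab z).2 = (ab z0).2.
  move=> zK; have [e|ne] := eqVneq (ab z).1 (ab z0).1; first by left.
  have [e|ne'] := eqVneq (ab z).2 (ab z0).2; first by right.
  exfalso; have [a2 b2 c2 d2] := hab z zK.
  have nz : z0 != z by apply: contraNneq ne => ->.
  have zD2 : z \notin D2 by case: (sD) => _ _ dd; apply/negP => h; have := disjointFr dd h; rewrite nY.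
  have yz : ~~ (z0 -- z) by apply: stY; apply: nY.
  have nb y : y \in K' -> exists2 a, a \in D2 & y -- a by case/K'K => /KT /hD2.
  have [R [hR sR]] := through_path cD2 yz nz zD2 (nb _ z0K) (nb _ zK).
  apply: (overlapping_gaps sD nt np (nY _ z0K) (nY _ zK) yz hR sR hP PD a1 b1 c1 a2 b2 c2 d1).
  - by move=> i hi; rewrite (set_nth_default z) ?d2 //; clear - hi c2; lia.
  - by rewrite eq_sym.
  - by rewrite eq_sym.
have sub : K' \subset (nbr (nth z0 P (ab z0).1) :&: T) :|: (nbr (nth z0 P (ab z0).2) :&: T).
  apply/subsetP => z zK; have [a2 b2 c2 d2] := hab z zK; have [/KT zT _] := K'K z zK.
  have l1 : (ab z).1 < size P by clear - a2 kP; lia.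
  have e1 : z -- nth z P (ab z).1 by rewrite d2 ?eqxx // leqnn ltnW // (ltn_trans a2).
  have e2 : z -- nth z P (ab z).2 by rewrite d2 ?eqxx ?orbT // leqnn andbT ltnW // (ltn_trans a2).
  rewrite !inE zT !andbT.
  case: (key z zK) => <-; [rewrite (set_nth_default z) // sedge_sym e1|].
    by [].
  by rewrite [nth z0 P (ab z).2](set_nth_default z) // [X in _ || X]sedge_sym e2 orbT.
have l1 : (ab z0).1 < size P by clear - a1 kP; lia.
have := leq_trans (subset_leq_card sub) (leq_card_setU _ _).
apply/negP; rewrite -ltnNge; apply: leq_ltn_trans cK'; rewrite mul2n -addnn.
by apply: leq_add; apply/hm/mem_nth.
Qed.

End Ladders.

(** * Legs obtained from pieces *)

Section FromPieces.
Variable G : sgraph.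
Implicit Types (u v w x y z c e p q : G) (r C R P : seq G) (A B D N Y K S X W T : {set G}).

(** [A :\: K] is connected because every other piece also has a neighbour on [P]: [A] is connected,
    and from a piece one can leave only to [P]. *)
Lemma piece_props A P K : K \in pieces A P -> ipath P -> {subset P <= A} -> connected A ->
  [/\ K \subset A, forall u, u \in K -> u \notin P, connected K,
      (exists2 c, c \in K & exists2 p, p \in P & c -- p) /\ connected (A :\: K) &
      forall u v, u \in K -> v \in A -> v \notin P -> u -- v -> v \in K].
Proof.
case/imsetP => k kA -> hP PA cA; set K' := component _ k.
have sK : K' \subset A :\: [set:: P] by apply: component_sub.
have KA u : u \in K' -> u \in A by move/(subsetP sK); rewrite inE => /andP [].
have KP u : u \in K' -> u \notin P by move/(subsetP sK); rewrite !inE => /andP [].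
have cl u v : u \in K' -> v \in A -> v \notin P -> u -- v -> v \in K'.
  by move=> uK vA vP uv; apply: (component_closed kA uK) => //; rewrite !inE vP.
have [p0 p0P] : exists p, p \in P by case: hP; case: (P) => // p s; exists p; rewrite mem_head.
have cross X x : X \subset A :\: [set:: P] -> x \in X -> (forall u v, u \in X -> v \in A -> v \notin P -> u -- v -> v \in X) ->
    exists2 c, c \in X & exists2 p, p \in P & c -- p.
  move=> sX xX clX; have xA : x \in A by have := subsetP sX x xX; rewrite inE => /andP [].
  have pX : p0 \notin X by apply: contraL p0P => /(subsetP sX); rewrite !inE => /andP [].
  have [u [v [uA uX vA vX uv]]] := connected_cross cA xA xX (PA _ p0P) pX.
  exists u => //; exists v => //; apply: contraNT vX => vP; exact: (clX u).
split=> //.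
- by apply/subsetP.
- exact: component_connected.
split; first by apply: (cross K' k) => //; apply: component_self.
have pB p : p \in P -> p \in A :\: K'.
  by move=> pP; rewrite inE PA // andbT; apply: contraL pP; apply: KP.
apply: (connected_root (pB _ p0P)) => w wB.
have toP p : p \in P -> connect (inrel (A :\: K')) p p0.
  by move=> pP; apply: (ipath_connected hP) => // v vP _; apply: pB.
have [wP|wP] := boolP (w \in P); first exact: toP.
have wA : w \in A :\: [set:: P] by move: wB; rewrite !inE wP => /andP [].
pose X := component (A :\: [set:: P]) w.
have sX : X \subset A :\: [set:: P] by apply: component_sub.
have [c cX [p pP cp]] : exists2 c, c \in X & exists2 p, p \in P & c -- p.
  apply: (cross X w) => //; first exact: component_self.
  by move=> u v uX vA vP uv; apply: (component_closed wA uX) => //; rewrite !inE vP.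
have sXB : X \subset A :\: K'.
  apply/subsetP => v vX; rewrite in_setD; have := subsetP sX v vX; rewrite inE => /andP [_ ->].
  rewrite andbT; apply/negP => vK; move: wB; rewrite in_setD => /andP [/negP + _]; apply.
  by rewrite /K' -(component_eq vK) (component_eq vX) component_self.
apply: connect_trans (toP p pP).
apply: (@connect_trans _ _ c).
  by apply: (connect_sub_set sXB); apply: (connectedP _ (component_connected wA)); rewrite ?component_self.
by apply: connect1; rewrite /inrel /= (subsetP sXB) // pB.
Qed.

(** Without [K] a connected set is left, so some [y] has all its neighbours in [A] inside [K]. A
    shortest path from [y] through [K] to a vertex that sees [P], read backwards and without [y], is
    the leg. *)
Lemma piece_leg S A P K : minimal_for S A -> [disjoint S & A] ->
  ipath P -> {subset P <= A} -> K \in pieces A P ->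
  exists y (leg : seq G), [/\ y \in S, {subset leg <= K} /\ leg != [::], ipath (rcons leg y),
    apart (behead (rcons leg y)) P /\ (exists2 p, p \in P & head y leg -- p) &
    forall a, a \in A -> y -- a -> a \in K].
Proof.
move=> [cA tA minA] dSA hP PA KK.
have [/subsetP KA KP cK [[c cK' [p0 p0P cp]] cAK] clK] := piece_props KK hP PA cA.
have pr : A :\: K \proper A.
  apply/properP; split; first exact: subsetDl.
  by exists c; [exact: KA|rewrite inE cK'].
have [y yS hy] := minA _ pr cAK.
have yA : y \notin A by rewrite (disjointFr dSA yS).
have only a : a \in A -> y -- a -> a \in K.
  by move=> aA ya; apply: contraTT ya => aK; apply: hy; rewrite inE aK.
have [a aA ya] := touchesP _ _ tA y yS; have aK := only a aA ya.
have cB := connected_setU1 cK aK ya.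
have [] := @ipath_to _ (y |: K) y (fun u => [exists p in P, u -- p]) cB (setU11 _ _) (ex_intro2 _ _ c _ _).
- by rewrite !inE cK' orbT.
- by apply/exists_inP; exists p0.
move=> q [hq sq lq bq].
have Ty : ~~ [exists p in P, y -- p].
  by apply/exists_inPn => p pP; apply: hy; rewrite inE PA // andbT; apply: contraL pP; apply: KP.
have q0 : q != [::] by apply: contraNneq Ty => e; rewrite e in lq.
have qK : {subset q <= K}.
  move=> u uq; have := sq u; rewrite !inE uq orbT => /(_ isT) /orP [/eqP e|//].
  by move: (ipath_uniq hq); rewrite /= -e uq.
have er : rcons (rev q) y = rev (y :: q) by rewrite rev_cons.
have eb : behead (rcons (rev q) y) = rev (belast y q).
  by rewrite er lastI rev_rcons.
exists y, (rev q); split=> //.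
- split; first by move=> u; rewrite mem_rev => /qK.
  by rewrite -size_eq0 size_rev size_eq0.
- by rewrite er; apply: ipath_rev.
- split.
    rewrite eb => u p; rewrite mem_rev => ub pP.
    have /exists_inPn /(_ p pP) h := bq u ub; rewrite h andbT.
    have /setU1P [->|uK] : u \in y |: K by apply: sq; apply: mem_belast.
      by apply: contraNneq yA => ->; apply: PA.
    by apply: contraL pP => /eqP <-; apply: KP.
  have -> : head y (rev q) = last y q by case/lastP: (q) => // s z; rewrite rev_rcons last_rcons.
  by case/exists_inP: lq => p pP h; exists p.
Qed.

(** A vertex of level t sees only the positions t-1 to t+1 of the geodesic; 3 is the least
    difference that keeps two such ranges disjoint. *)
Definition spread (d : G -> nat) (leg : G -> seq G) T :=
  {in T &, forall y z, y != z ->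
     d (head y (leg y)) + 3 <= d (head z (leg z)) \/ d (head z (leg z)) + 3 <= d (head y (leg y))}.

(** If 7D+1 legs had pairwise close levels, all of these would be within 2 of one level e0, and
    every leg would see one of the seven positions e0-3 to e0+3. One vertex of [P] would then be
    adjacent to more than D heads of legs, which are distinct vertices of [A]. *)
Lemma spread_legs (D n M : nat) S A P d (KK : {set {set G}}) : ramsey_bound (7 * D).+1 n M ->
  minimal_for S A -> [disjoint S & A] -> {in S &, forall y z, ~~ (y -- z)} ->
  geodesic A P d -> (forall a, a \in A -> #|nbr a :&: A| <= D) ->
  KK \subset pieces A P -> M <= #|KK| ->
  exists T leg, [/\ T \subset S, #|T| = n, preladder A P leg T, spread d leg T &
    forall y, y \in T -> leg y != [::]].
Proof.
move=> hN mA dSA stS [hP PA dP dl] hD sKK big; have [cA tA minA] := mA.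
have [x0 x0P] : exists p, p \in P by case: hP; case: (P) => // p s; exists p; rewrite mem_head.
have U := ipath_uniq hP.
have ex K : exists yl : G * seq G, K \in KK -> [/\ yl.1 \in S, {subset yl.2 <= K} /\ yl.2 != [::],
    ipath (rcons yl.2 yl.1),
    apart (behead (rcons yl.2 yl.1)) P /\ (exists2 p, p \in P & head yl.1 yl.2 -- p) &
    forall a, a \in A -> yl.1 -- a -> a \in K].
  have [KKK|] := boolP (K \in KK); last by exists (x0, [::]).
  have [y [leg h]] := piece_leg mA dSA hP PA (subsetP sKK _ KKK).
  by exists (y, leg).
have [f hf] := fin_all_exists ex.
have pp K (KKK : K \in KK) := piece_props (subsetP sKK _ KKK) hP PA cA.
have disK K L : K \in KK -> L \in KK -> K != L -> forall u, u \in K -> u \notin L.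
  move=> /(subsetP sKK) /imsetP [k kA ->] /(subsetP sKK) /imsetP [l lA ->] ne u uk; apply/negP => ul.
  by case/eqP: ne; rewrite -(component_eq uk) (component_eq ul).
have finj : {in KK &, injective (fun K => (f K).1)}.
  move=> K L KK1 LK /= e; apply/eqP/negPn/negP => ne.
  have [yS _ _ _ h1] := hf K KK1; have [_ _ _ _ h2] := hf L LK.
  have [a aA ya] := touchesP _ _ tA _ yS; have aK := h1 a aA ya.
  by have /negP := disK K L KK1 LK ne a aK; apply; apply: h2; rewrite // -e.
pose T0 := [set (f K).1 | K in KK].
have cT0 : #|T0| = #|KK| by rewrite card_in_imset.
have exg y : exists K, y \in T0 -> K \in KK /\ y = (f K).1.
  have [/imsetP [K KK1 ->]|] := boolP (y \in T0); first by exists K.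
  by exists set0.
have [g hg] := fin_all_exists exg.
pose leg y := (f (g y)).2.
have hleg y : y \in T0 -> [/\ g y \in KK, y \in S, {subset leg y <= g y} /\ leg y != [::],
    ipath (rcons (leg y) y) &
    (apart (behead (rcons (leg y) y)) P /\ (exists2 p, p \in P & head y (leg y) -- p)) /\
    forall a, a \in A -> y -- a -> a \in g y].
  move=> yT; have [KK1 e] := hg y yT; have := hf _ KK1; rewrite -e => -[h1 h2 h3 h4 h5].
  by split.
have hdK y : y \in T0 -> head y (leg y) \in g y.
  by case/hleg => _ _ [s]; case E: (leg y) s => [|a l] //= s _ _ _; apply: s; rewrite mem_head.
have gKA y u : y \in T0 -> u \in g y -> u \in A.
  by move=> yT; have [KK1 _] := hg y yT; have [/subsetP + _ _ _ _] := pp _ KK1; apply.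
have gKP y u : y \in T0 -> u \in g y -> u \notin P.
  by move=> yT; have [KK1 _] := hg y yT; have [_ + _ _ _] := pp _ KK1; apply.
have apT : {in T0 &, forall y z, y != z -> apart (rcons (leg y) y) (rcons (leg z) z)}.
  move=> y z yT zT yz; have [Ky yS [sy _] _ [_ oy]] := hleg y yT; have [Kz zS [sz _] _ [_ oz]] := hleg z zT.
  have ne : g y != g z.
    by apply: contraNneq yz => e; have [_ ->] := hg y yT; have [_ ->] := hg z zT; rewrite e.
  have ne' : g z != g y by rewrite eq_sym.
  have yA : y \notin A by rewrite (disjointFr dSA).
  have zA : z \notin A by rewrite (disjointFr dSA).
  apply: apart_rconsl; apply: apart_rconsr.
  - move=> u w /sy uK /sz wK; apply/andP; split.
      by apply: contraNneq (disK _ _ Ky Kz ne u uK) => ->.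
    apply/negP => uw; have [_ _ _ _ cl] := pp _ Ky; have wA := gKA _ _ zT wK; have wP := gKP _ _ zT wK.
    by have := disK _ _ Kz Ky ne' w wK; rewrite (cl u w).
  - apply: apart_sym; apply: apart1 => u /sy uK; have uA := gKA _ _ yT uK; apply/andP; split.
      by apply: contraNneq zA => ->.
    by apply/negP => /(oz u uA); apply/negP/(disK _ _ Ky Kz).
  - apply: apart1 => u /sz uK; have uA := gKA _ _ zT uK; apply/andP; split.
      by apply: contraNneq yA => ->.
    by apply/negP => /(oy u uA); apply/negP/(disK _ _ Kz Ky).
  - by apply: apart1 => u; rewrite inE => /eqP ->; rewrite yz stS.
(* On [P] the level is the position, and along an edge it changes by at most one. *)
have win y p : y \in T0 -> p \in P -> head y (leg y) -- p -> d (head y (leg y)) <= index p P + 1 /\ index p P <= d (head y (leg y)) + 1.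
  move=> yT pP yp; rewrite -(dP p pP) !addn1; have eA := gKA _ _ yT (hdK y yT).
  by split; apply: dl => //; try (by apply: PA); rewrite sedge_sym.
pose close : rel G := [rel y z | (d (head y (leg y)) < d (head z (leg z)) + 3) && (d (head z (leg z)) < d (head y (leg y)) + 3)].
have csym : symmetric close by move=> y z; rewrite /close /= andbC.
rewrite -cT0 in big.
have [[K [sK cK hK]]|[T [sT cT hT]]] := hN G close T0 csym big.
  exfalso; have KT y : y \in K -> y \in T0 by apply: (subsetP sK).
  have [y0 y0K] : exists y, y \in K by apply/card_gt0P; rewrite cK.
  have exp y : exists p, y \in K -> p \in P /\ head y (leg y) -- p.
    have [/KT yT|] := boolP (y \in K); last by exists y.
    by have [_ _ _ _ [[_ [p pP yp]] _]] := hleg y yT; exists p.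
  have [q hq] := fin_all_exists exp.
  pose e0 := d (head y0 (leg y0)); pose V := [set:: seg (e0 - 3) (e0 + 3) P].
  have cV : #|V| <= 7.
    rewrite cardsE; apply: leq_trans (card_size _) _; rewrite /seg size_drop size_take.
    by case: ifP => hh; clear - hh; slia.
  have qV : {in K, forall y, q y \in V}.
    move=> y yK; have [pP yp] := hq y yK; rewrite inE mem_seg // pP /=.
    have [w1 w2] := win y _ (KT y yK) pP yp.
    have : (e0 < d (head y (leg y)) + 3) && (d (head y (leg y)) < e0 + 3).
      have [->|ne] := eqVneq y y0; first by rewrite -/e0; clear; lia.
      by rewrite andbC; apply: (hK y y0).
    by move: w1 w2; clear; lia.
  have [|p pV big2] := @pigeonhole _ _ q K V D qV.
    by rewrite cK ltnS leq_mul2r cV orbT.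
  have [pP pA] : p \in P /\ p \in A.
    have : p \in V := pV; rewrite inE => /mem_drop /mem_take pP; split=> //; exact: PA.
  have := leq_trans big2 (@card_choice _ _ _ (nbr p :&: A) (fun y => head y (leg y)) _ _).
  rewrite ltnNge hD // => h; suff: false by []; apply: h.
    move=> y; rewrite inE => /andP [yK /eqP <-]; have [_ yp] := hq y yK.
    by rewrite !inE sedge_sym yp (gKA y) ?hdK ?KT.
  move=> y z; rewrite !inE => /andP [yK _] /andP [zK _] e; apply/eqP/negPn/negP => yz.
  have hd (l : seq G) (t : G) : head t l \in rcons l t by case: l => *; rewrite /= mem_head.
  have := apT _ _ (KT _ yK) (KT _ zK) yz _ _ (hd _ _) (hd _ _).
  by rewrite e eqxx.
have TT y : y \in T -> y \in T0 by apply: (subsetP sT).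
have sp : spread d leg T.
  move=> y z yT zT yz; have := hT y z yT zT yz; rewrite /close /= negb_and -!leqNgt.
  by case/orP; auto.
exists T, leg; split=> //.
- by apply/subsetP => y /TT /hleg [].
- split=> //.
  + move=> y /TT yT; have [_ _ [sy ny] iy [[a1 a2] _]] := hleg y yT; split=> //.
      by move=> u /sy; apply: gKA.
    by split=> //; apply: (gKP y) => //; apply: hdK.
  + by move=> y z /TT yT /TT zT; apply: apT.
  + move=> y z yT zT yz; case: (sp y z yT zT yz) => h; [left|right]; move=> u v uP vP yu zv.
      have [_ h1] := win y u (TT _ yT) uP yu; have [h2 _] := win z v (TT _ zT) vP zv.
      by clear - h h1 h2; lia.
    have [_ h1] := win z u (TT _ zT) uP yu; have [h2 _] := win y v (TT _ yT) vP zv.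
    by clear - h h1 h2; lia.
- by move=> y /TT /hleg [_ _ []].
Qed.

End FromPieces.

(** * Rerouting, and the structure of one side *)

Section Structure.
Variable G : sgraph.
Implicit Types (u v w x y z c e p q : G) (r C R P : seq G) (A B D N Y K S X W T : {set G}).

Lemma head_mem_rcons (l : seq G) y : head y l \in rcons l y.
Proof. by case: l => *; rewrite /= mem_head. Qed.

(* A wide leg replaces one vertex of the geodesic by the first vertex of the leg;
   what remains of the leg then sees the new path in that vertex only. *)
Lemma reroute A P d (leg : G -> seq G) T : geodesic A P d ->
  ladder_in A P leg T Wide false -> spread d leg T -> [disjoint T & A] ->
  exists P' leg', forall b T', T' \subset T ->
    (forall y, y \in T' -> (leg' y == [::]) = b) -> ladder_in A P' leg' T' Single b.
Proof.
move=> [hP PA dP dl] [_ hT apT _] sp dTA; have U := ipath_uniq hP.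
have [x0 x0P] : exists p, p \in P by case: hP; case: (P) => // p s; exists p; rewrite mem_head.
pose e y := head y (leg y); pose t y := d (e y).
have eleg y : y \in T -> leg y = e y :: behead (leg y).
  by case/hT => _ _ _ _; rewrite /e; case: (leg y).
have eA y : y \in T -> e y \in A.
  by move=> yT; have [s _ _ _ _] := hT y yT; apply: s; rewrite eleg ?mem_head.
have eP y : y \in T -> e y \notin P by case/hT => _ [].
have win y i : y \in T -> i < size P -> e y -- nth x0 P i -> t y <= i + 1 /\ i <= t y + 1.
  move=> yT iP yp; have pP := mem_nth x0 iP.
  have ei : d (nth x0 P i) = i by rewrite dP // index_uniq.
  rewrite -{1 2}ei !addn1; have pA := PA _ pP; have eyA := eA y yT.
  by split; apply: dl; rewrite // sedge_sym.
(* Among three consecutive positions only the outer two are nonadjacent, so [e y] sees both and can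
   replace the vertex between them. *)
have wide y : y \in T -> [/\ 0 < t y, t y + 1 < size P, e y -- nth x0 P (t y - 1) & e y -- nth x0 P (t y + 1)].
  move=> yT; have [_ _ _ [u [w [[uP wP] uw nuw [eu ew]]]] _] := hT y yT.
  have iu : index u P < size P by rewrite index_mem.
  have iw : index w P < size P by rewrite index_mem.
  have eu' : e y -- nth x0 P (index u P) by rewrite nth_index.
  have ew' : e y -- nth x0 P (index w P) by rewrite nth_index.
  have [u1 u2] := win y _ yT iu eu'; have [w1 w2] := win y _ yT iw ew'.
  have ne : index u P != index w P.
    by apply: contraNneq uw => h; rewrite -(nth_index u uP) h nth_index.
  move: nuw; rewrite (ipath_adj hP) // => /norP [n1 n2].
  have [[h1 h2]|[h1 h2]] : (index u P = t y - 1 /\ index w P = t y + 1) \/ (index w P = t y - 1 /\ index u P = t y + 1).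
    by move: u1 u2 w1 w2 ne n1 n2; clear; lia.
  - by split; rewrite -?h1 -?h2 // ; move: u1 u2 w1 w2 n1 n2 h1 h2; clear; lia.
  - by split; rewrite -?h1 -?h2 // ; move: u1 u2 w1 w2 n1 n2 h1 h2; clear; lia.
have far y z : y \in T -> z \in T -> y != z -> t y + 3 <= t z \/ t z + 3 <= t y by move=> *; apply: sp.
(* The new path by positions: [e y] at position [t y], the old vertex elsewhere. Levels differ by at
   least 3, so no position is claimed twice and no two replacements are consecutive. *)
pose s i := if [pick y in T | t y == i] is Some y then e y else nth x0 P i.
have sE i : (exists y, [/\ y \in T, t y = i & s i = e y]) \/ (s i = nth x0 P i /\ forall y, y \in T -> t y != i).
  rewrite /s; case: pickP => [y /andP [yT /eqP h]|h]; first by left; exists y.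
  by right; split=> // y yT; have := h y; rewrite /= yT => /negbT.
have sy y : y \in T -> s (t y) = e y.
  move=> yT; case: (sE (t y)) => [[z [zT ez ->]]|[_ /(_ y yT)]]; last by rewrite eqxx.
  have [->//|ne] := eqVneq z y; case: (far z y zT yT ne); rewrite ez; clear; lia.
have pp i j : i < size P -> j < size P -> nth x0 P i -- nth x0 P j = (j == i.+1) || (i == j.+1).
  by move=> h1 h2; rewrite (ipath_adj hP) ?mem_nth // !index_uniq.
have eap y z u w : y \in T -> z \in T -> y != z -> u \in rcons (leg y) y -> w \in rcons (leg z) z -> (u != w) && ~~ (u -- w).
  by move=> yT zT yz; apply: apT.
have ins y : y \in T -> e y \in rcons (leg y) y by move=> _; apply: head_mem_rcons.
have yj y j : y \in T -> j < size P -> j != t y -> e y -- nth x0 P j = (j == (t y).+1) || (t y == j.+1).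
  move=> yT jP ne; have [h1 h2 h3 h4] := wide y yT; apply/idP/orP => [h|[] /eqP h].
  - have [w1 w2] := win y j yT jP h; move: ne w1 w2; clear; lia.
  - by rewrite h -addn1.
  - by move: h3; rewrite h subn1.
have adj i j : i < size P -> j < size P -> s i -- s j = (j == i.+1) || (i == j.+1).
  move=> iP jP; case: (sE i) => [[y [yT ty ->]]|[-> hi]]; case: (sE j) => [[z [zT tz ->]]|[-> hj]].
  - have [yz|yz] := eqVneq y z.
      by rewrite -yz sedge_irrefl -ty -tz -yz; clear; lia.
    have /andP [_ /negbTE ->] := eap y z _ _ yT zT yz (ins y yT) (ins z zT).
    by have := far y z yT zT yz; rewrite -ty -tz; clear; lia.
  - by rewrite yj -?ty // eq_sym hj.
  - by rewrite sedge_sym yj -?tz ?[i == t z]eq_sym ?hi // orbC.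
  - exact: pp.
have inj i j : i < size P -> j < size P -> s i = s j -> i = j.
  move=> iP jP; case: (sE i) => [[y [yT ty ->]]|[-> hi]]; case: (sE j) => [[z [zT tz ->]]|[-> hj]] h.
  - have [yz|yz] := eqVneq y z; first by rewrite -ty -tz yz.
    by have := eap y z _ _ yT zT yz (ins y yT) (ins z zT); rewrite h eqxx.
  - by have := eP y yT; rewrite h mem_nth.
  - by have := eP z zT; rewrite -h mem_nth.
  - by apply/eqP; rewrite -(nth_uniq x0 iP jP U) h.
pose P' := mkseq s (size P).
have UP' : uniq P'.
  by rewrite map_inj_in_uniq ?iota_uniq // => i j; rewrite !mem_iota; apply: inj.
have nP' z i : i < size P -> nth z P' i = s i by move=> iP; rewrite nth_mkseq.
have inP' u : u \in P' -> exists2 i, i < size P & u = s i.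
  by case/mapP => i; rewrite mem_iota => /andP [_ h] ->; exists i.
have iP' i : i < size P -> index (s i) P' = i.
  by move=> h; rewrite -(nP' x0 i h) index_uniq // size_mkseq.
have hP' : ipath P'.
  split=> //; first by rewrite -size_eq0 size_mkseq size_eq0; case: (hP).
  move=> z i j ij; rewrite size_mkseq => jP; have iP := ltn_trans ij jP.
  by rewrite !nP' // adj //; move: ij; clear; lia.
have P'A : {subset P' <= A}.
  move=> u /inP' [i h ->]; case: (sE i) => [[y [yT _ ->]]|[-> _]]; first exact: eA.
  by apply/PA/mem_nth.
have er y : y \in T -> rcons (leg y) y = e y :: rcons (behead (leg y)) y by move=> yT; rewrite {1}eleg.
have rest y u : y \in T -> u \in rcons (behead (leg y)) y -> u \in behead (rcons (leg y) y).
  by move=> yT; rewrite er.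
have restP y u i : y \in T -> u \in rcons (behead (leg y)) y -> i < size P -> i != t y -> (u != s i) && ~~ (u -- s i).
  move=> yT uy iP ne; case: (sE i) => [[z [zT tz ->]]|[-> _]].
    apply: (eap y z) => //; last by apply: ins.
      by apply: contraNneq ne => ->; rewrite tz.
    by apply: mem_behead; apply: rest.
  by have [_ _ a _ _] := hT y yT; apply: a; [apply: rest|apply: mem_nth].
have ty y : y \in T -> t y < size P by case/wide => _ h _ _; move: h; clear; lia.
pose f y := head y (behead (leg y)).
have fy y : y \in T -> f y \in rcons (behead (leg y)) y by move=> yT; apply: head_mem_rcons.
have hcons y : y \in T -> [/\ e y \notin rcons (behead (leg y)) y, ipath (rcons (behead (leg y)) y) &
    forall v, v \in rcons (behead (leg y)) y -> e y -- v = (v == f y)].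
  move=> yT; have [_ [ip _] _ _ _] := hT y yT; rewrite er // in ip.
  have n0 : rcons (behead (leg y)) y != [::] by case: (behead _).
  have [h1 h2 h3] := (@ipath_consP _ (e y) _ n0).1 ip; split=> // v hv; rewrite h3 //.
  by rewrite /f; case: (behead (leg y)).
have fonly y u : y \in T -> u \in P' -> f y -- u -> u = e y.
  move=> yT /inP' [i iP ->] h; have [ei|ne] := eqVneq i (t y); first by rewrite ei sy.
  by have /andP [_] := restP y _ i yT (fy y yT) iP ne; rewrite h.
have eP' y : y \in T -> e y \in P'.
  by move=> yT; rewrite -sy // -(nP' x0) ?ty // mem_nth // size_mkseq ty.
have nin y u : y \in T -> u \in rcons (behead (leg y)) y -> u \notin P'.
  move=> yT uy; apply/negP => /inP' [i iP ei]; have [et|ne] := eqVneq i (t y).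
    by have [+ _ _] := hcons y yT; rewrite -(sy y yT) -et -ei uy.
  by have := restP y u i yT uy iP ne; rewrite ei eqxx.
(* A leg with a single vertex becomes empty and others do not; [b] and [T'] are left open so that
   the caller can select legs of one kind. *)
exists P', (fun y => behead (leg y)) => b T' /subsetP sT' hb; split=> //.
- move=> y /[dup] yT' /sT' yT; have [h1 h2 h3] := hcons y yT; split=> //.
  + by move=> u hu; have [s' _ _ _ _] := hT y yT; apply: s'; rewrite eleg // inE hu orbT.
  + by split=> //; apply: (nin y) => //; apply: fy.
  + move=> u v hu vP'; have hu' := mem_behead hu.
    have [i iP ei] := inP' v vP'; rewrite ei; have [et|ne] := eqVneq i (t y); last exact: (restP y u i yT hu' iP ne).
    rewrite et sy //; apply/andP; split; first by apply: contraNneq h1 => <-.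
    rewrite sedge_sym h3 //; apply: contraTneq hu => ->.
    have := ipath_uniq h2; rewrite /f; case: (behead (leg y)) => [|a l] //=.
    by case/andP.
  + exists (e y).
      by split; [exact: eP'|rewrite sedge_sym h3 ?fy // eqxx].
    by move=> v vP' fv; apply: fonly.
  + exact: hb.
- move=> y z /sT' yT /sT' zT yz; apply: apart_sub (apT y z yT zT yz) => u; rewrite er // inE => ->; exact: orbT.
- move=> y z /sT' yT /sT' zT yz.
  case: (far y z yT zT yz) => h; [left|right]; move=> u v uP vP fu fv.
    have -> := fonly y u yT uP fu; have -> := fonly z v zT vP fv.
    by rewrite -!sy // !iP' ?ty //; move: h; clear; lia.
  have -> := fonly z u zT uP fu; have -> := fonly y v yT vP fv.
  by rewrite -!sy // !iP' ?ty //; move: h; clear; lia.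
Qed.

Inductive structured D S : Prop :=
  | StructuredStar c leg b of star_in D c leg S b
  | StructuredLadder P leg k b of ladder_in D P leg S k b & k = Wide -> b = true.

Lemma ladder_sub D P leg S k b S' : S' \subset S ->
  ladder_in D P leg S k b -> ladder_in D P leg S' k b.
Proof.
move=> /subsetP s [h1 h2 h3 h4]; split=> //.
- by move=> y /s; apply: h2.
- by move=> y z /s yS /s zS; apply: h3.
- by move=> y z /s yS /s zS; apply: h4.
Qed.

Lemma star_sub D c leg S b S' : S' \subset S -> star_in D c leg S b -> star_in D c leg S' b.
Proof.
move=> /subsetP s [h1 h2 h3]; split=> //.
- by move=> y /s; apply: h2.
- by move=> y z /s yS /s zS; apply: h3.
Qed.

Lemma structured_sub D S S' : S' \subset S -> structured D S -> structured D S'.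
Proof.
move=> s [c leg b h|P leg k b h hk]; first exact: (StructuredStar (star_sub s h)).
exact: (StructuredLadder (ladder_sub s h)).
Qed.

Lemma star_mono A D c leg S b : A \subset D -> star_in A c leg S b -> star_in D c leg S b.
Proof.
move=> /subsetP s [h1 h2 h3]; split=> //; first exact: s.
by move=> y /h2 [g1 g2 g3]; split=> // u /g1 /s.
Qed.

Lemma ladder_mono A D P leg S k b : A \subset D -> ladder_in A P leg S k b -> ladder_in D P leg S k b.
Proof.
move=> /subsetP s [[h0 h1] h2 h3 h4]; split=> //; first by split=> // u /h1 /s.
by move=> y /h2 [g1 g2 g3 g4 g5]; split=> // u /g1 /s.
Qed.

Lemma structured_mono A D S : A \subset D -> structured A S -> structured D S.
Proof.
move=> s [c leg b h|P leg k b h hk]; first exact: (StructuredStar (star_mono s h)).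
exact: (StructuredLadder (ladder_mono s h)).
Qed.

End Structure.

(* The bounds on the two kinds of degrees come from the star outcomes: a vertex
   of high degree is the centre of a star. *)
Lemma structure_theorem (x n : nat) : 0 < n -> exists N, forall (G : sgraph) (D1 D2 Y S : {set G}),
  ~ has_theta G -> ~ has_prism G -> ~ (exists2 K : {set G}, clique K & #|K| = x) ->
  separated D1 D2 Y -> {in Y &, forall y z, ~~ (y -- z)} ->
  connected D1 -> connected D2 ->
  (forall y, y \in Y -> exists2 a, a \in D1 & y -- a) ->
  (forall y, y \in Y -> exists2 a, a \in D2 & y -- a) ->
  S \subset Y -> N <= #|S| ->
  exists2 S' : {set G}, S' \subset S /\ #|S'| = n & structured D1 S'.
Proof.
move=> n0; have [Dg hDg] := ramsey x n.
(* Degrees into [S] will be at most [n] and degrees inside [A] at most [Dg]; these are the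
   parameters of [disjoint_intervals] and [spread_legs]. The factor 8 is spent in [preladder_kind],
   and in the next bound a further factor 2 separates the legs that become empty on rerouting from
   the others. *)
have [N1 hN1] := ramsey (3 * n).+1 (8 * n).
have [N2 hN2] := ramsey (7 * Dg).+1 (16 * n).
pose k := N1 + N2; exists (path_bound n Dg k).+1.
move=> G D1 D2 Y S nt np nK sD stY cD1 cD2 h1 h2 /subsetP SY big.
have tD : touches S D1 by apply/touchesP => y /SY; apply: h1.
have [A AD mA] := minimal_for_exists cD1 tD.
have [cA tA _] := mA.
have stS : {in S &, forall y z : G, ~~ (y -- z)} by move=> y z /SY yY /SY zY; apply: stY.
have dYD : [disjoint Y & D1] by case: sD => _ h _; rewrite disjoint_sym.
have dSA : [disjoint S & A].
  by apply: disjointWl (_ : S \subset Y) _; [apply/subsetP|apply: disjointWr AD dYD].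
have [y0 y0S] : exists y, y \in S by apply/card_gt0P; apply: leq_ltn_trans big.
have [r rA _] := touchesP _ _ tA y0 y0S.
(* A vertex that sees more than [n] vertices of [S] is the centre of a star with empty legs. *)
have [/exists_inP [a aA ha]|/exists_inPn hm] := boolP [exists a in A, n < #|nbr a :&: S|].
  have [S' sS' cS'] := subset_card (ltnW ha).
  have inS' y : y \in S' -> a -- y /\ y \in S by move/(subsetP sS'); rewrite !inE => /andP.
  exists S'; first by split=> //; apply/subsetP => y /inS' [].
  apply: (@StructuredStar _ _ _ a (fun=> [::]) true); split=> //.
  - exact: (subsetP AD).
  - move=> y /inS' [ay yS]; split=> //=; apply/(@ipath_consP _ a [:: y] isT); split.
    + by rewrite inE; apply/negP => /eqP e; move: ay; rewrite e sedge_irrefl.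
    + exact: ipath1.
    + by move=> v; rewrite inE => /eqP ->; rewrite ay /= eqxx.
  - move=> y z /inS' [_ yS] /inS' [_ zS] yz; apply: apart1 => v; rewrite inE => /eqP ->.
    by rewrite yz stS.
have {}hm a : a \in A -> #|nbr a :&: S| <= n by move=> aA; rewrite leqNgt hm.
have [/exists_inP [a aA ha]|/exists_inPn hd] := boolP [exists a in A, Dg < #|nbr a :&: A|].
  have [[K [sK cK hK]]|[K [sK cK hK]]] := hDg G (@sedge G) _ (@sedge_sym G) (ltnW ha).
    case: nK; exists K => //; apply/forall_inP => u uK; apply/forall_inP => w wK.
    by apply/implyP; apply: hK.
  have KA : K \subset A by apply: subset_trans sK (subsetIr _ _).
  have aK c : c \in K -> a -- c by move/(subsetP sK); rewrite !inE => /andP [].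
  have stK : {in K &, forall c d, ~~ (c -- d)}.
    move=> c d cK' dK; have [->|ne] := eqVneq c d; first by rewrite sedge_irrefl.
    exact: hK.
  have [S' [leg [sS' cS' hs]]] := star_of_stable_neighbours mA dSA stS aA KA aK stK.
  exists S'; first by rewrite cS'.
  by apply: structured_mono AD _; apply: (StructuredStar hs).
have {}hd a : a \in A -> #|nbr a :&: A| <= Dg by move=> aA; rewrite leqNgt hd.
have [P [d [geo hP]]] := path_pieces mA rA hm hd (ltnW big).
have [iP PA dP dl] := geo.
have PD : {subset P <= D1} by move=> p /PA; apply: (subsetP AD).
case: hP => [[T [sT cT hT]]|[KK [sKK cKK]]].
  have TS y : y \in T -> y \in S by apply: (subsetP sT).
  have TY : T \subset Y by apply/subsetP => y /TS /SY.
  have hTm p : p \in P -> #|nbr p :&: T| <= n.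
    by move=> /PA pA; apply: leq_trans (hm p pA); apply/subset_leq_card/setIS.
  have [||T' [sT' cT' bT']] := disjoint_intervals hN1 sD nt np cD2 TY stY _ iP PD hT hTm.
  - by move=> y /TS /SY; apply: h2.
  - by rewrite cT /k leq_addr.
  have T'T y : y \in T' -> y \in T by apply: (subsetP sT').
  have pre : preladder D1 P (fun=> [::]) T'.
    split=> //.
    - move=> y /T'T yT /=; split=> //.
      + split; first exact: ipath1.
        by apply/negP => /PA yA; have := disjointFr dSA (TS _ yT); rewrite yA.
      + exact: hT.
    - move=> y z /T'T /TS yS /T'T /TS zS yz; apply: apart1 => v; rewrite inE => /eqP ->.
      by rewrite yz stS.
  have [|kd [b [S' [sS' cS' hl]]]] := @preladder_kind _ _ _ _ _ n pre; first by rewrite cT'.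
  have S'S : S' \subset S by apply: subset_trans sS' (subset_trans sT' sT).
  exists S' => //; apply: (StructuredLadder hl) => _.
  have [y yS'] : exists y, y \in S' by apply/card_gt0P; rewrite cS'.
  by case: hl => _ /(_ y yS') [_ _ _ _ <-].
have [|T [leg [sT cT pre sp nl]]] := spread_legs hN2 mA dSA stS geo hd sKK.
  by rewrite cKK /k leq_addl.
have [|kd [b [S' [sS' cS' hl]]]] := @preladder_kind _ _ _ _ _ (2 * n) pre; first by rewrite cT; clear; lia.
have S'S : S' \subset S by apply: subset_trans sS' sT.
have eb : b = false.
  have [y yS'] : exists y, y \in S' by apply/card_gt0P; rewrite cS' muln_gt0.
  case: hl => _ /(_ y yS') [_ _ _ _ <-] _ _.
  by apply/negbTE/nl/(subsetP sS').
rewrite eb in hl.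
have sp' : spread d leg S'.
  by move=> y z yS zS; apply: sp; apply: (subsetP sS').
have nonwide : kd <> Wide -> exists2 S'' : {set G}, S'' \subset S /\ #|S''| = n & structured D1 S''.
  move=> nw; have [S'' s'' c''] := @subset_card _ S' n ltac:(rewrite cS'; clear; lia).
  exists S''; first by split=> //; apply: subset_trans s'' S'S.
  by apply: structured_mono AD _; apply: (StructuredLadder (ladder_sub s'' hl)) => /nw.
case: kd hl nonwide => hl nonwide; try by apply: nonwide.
have dS'A : [disjoint S' & A] by apply: disjointWl S'S dSA.
have [P' [leg' hr]] := reroute geo hl sp' dS'A.
have [|b' [S'' [s'' c'' hb]]] := @pigeonhole_bool _ (fun y => leg' y == [::]) S' n; first by rewrite cS'; clear; lia.
exists S''; first by split=> //; apply: subset_trans s'' S'S.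
by apply: structured_mono AD _; apply: (StructuredLadder (hr b' S'' s'' hb)).
Qed.

(** * Comparing the two sides *)

Section Arranged.
Variable G : sgraph.
Implicit Types (u v w x y z c e p q : G) (r s C R P : seq G) (A B D N Y K S X W T : {set G}).

(** Both lists are read starting from the edge that joins them. *)
Lemma ipath_glue R P : ipath R -> ipath P -> head_joined R P -> ipath (rev R ++ P).
Proof.
case: R => [|x R]; first by case. case: P => [|y P]; first by move=> _ [].
move=> hR hP j.
have hj u v : u \in x :: R -> v \in y :: P -> (u != v) && (u -- v == (u == x) && (v == y)).
  by move=> uR vP; apply: j.
rewrite rev_cons; apply: ipath_join2 => //.
- by rewrite -rev_cons; apply: ipath_rev.
- by have /andP [_ /eqP ->] := hj x y (mem_head _ _) (mem_head _ _); rewrite !eqxx.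
- move=> u v; rewrite mem_rev => uR vP; have uR' : u \in x :: R by rewrite inE uR orbT.
  have /andP [-> /eqP ->] := hj u v uR' vP; rewrite negb_and.
  have -> // : u != x; by apply: contraTneq uR => ->; case/andP: (ipath_uniq hR).
- apply: apart1 => v vP; have vP' : v \in y :: P by rewrite inE vP orbT.
  have /andP [-> /eqP ->] := hj x v (mem_head _ _) vP'; rewrite negb_and.
  have -> : v != y by apply: contraTneq vP => ->; case/andP: (ipath_uniq hP).
  by rewrite orbT.
Qed.

Lemma mem_rcons_head (l : seq G) y u : u \in rcons l y ->
  u = head y l \/ u \in behead (rcons l y).
Proof.
case: l => [|a l] /=; rewrite inE; first by move/eqP; left.
by case/orP => [/eqP|]; auto.
Qed.

Lemma before_nth P e f x0 i j : uniq P -> before P e f -> i < size P -> j < size P ->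
  e -- nth x0 P i -> f -- nth x0 P j -> i < j.
Proof.
move=> U h iP jP ei fj; have := h _ _ (mem_nth x0 iP) (mem_nth x0 jP) ei fj.
by rewrite !index_uniq.
Qed.

Lemma meets_neighbour k P e : meets k P e -> exists2 p, p \in P & e -- p.
Proof.
case: k => /=; first by case=> c []; exists c.
  by case=> u [w [[uP _] _ [eu _] _]]; exists u.
by case=> u [w [[uP _] _ _ [eu _]]]; exists u.
Qed.

(** Down one leg, along [P] from the last neighbour of the first head to the first neighbour of the
    second, and up the other leg. Neither head sees a further vertex of this stretch, so the path is
    induced. *)
Lemma ladder_spine D P leg S k b y z : ladder_in D P leg S k b -> y \in S -> z \in S -> y != z ->
  before P (head y (leg y)) (head z (leg z)) ->
  exists i j, [/\ i < j, j < size P,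
    head y (leg y) -- nth y P i /\ (forall v, v \in P -> head y (leg y) -- v -> index v P <= i),
    head z (leg z) -- nth y P j /\ (forall v, v \in P -> head z (leg z) -- v -> j <= index v P) &
    ipath (rev (rcons (leg y) y) ++ seg i j P ++ rcons (leg z) z)].
Proof.
case=> [[hP PD] hS apS beS] yS zS yz by_; have U := ipath_uniq hP.
have [sy [iy ny] ay my _] := hS y yS; have [sz [iz nz] az mz _] := hS z zS.
have [p pP yp] := meets_neighbour my; have [q qP zq] := meets_neighbour mz.
pose Z1 := [pred i | (i < size P) && (head y (leg y) -- nth y P i)].
pose Z2 := [pred i | (i < size P) && (head z (leg z) -- nth y P i)].
have e1 : exists i, Z1 i by exists (index p P); rewrite /= index_mem pP nth_index.
have e2 : exists i, Z2 i by exists (index q P); rewrite /= index_mem qP nth_index.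
have b1 i : Z1 i -> i <= size P by case/andP => /ltnW.
case: (ex_maxnP e1 b1) => i /andP [iP yi] maxi; case: (ex_minnP e2) => j /andP [jP zj] minj.
have ij : i < j by apply: (before_nth (x0 := y) U by_).
have maxi' v : v \in P -> head y (leg y) -- v -> index v P <= i.
  by move=> vP yv; apply: maxi; rewrite /= index_mem vP nth_index.
have minj' v : v \in P -> head z (leg z) -- v -> j <= index v P.
  by move=> vP yv; apply: minj; rewrite /= index_mem vP nth_index.
clear e1 e2 b1 maxi minj Z1 Z2.
exists i, j; split=> //.
have sn : seg i j P != [::] by rewrite -size_eq0 size_seg //; slia.
have hseg : ipath (seg i j P) by apply: ipath_seg => //; apply: ltnW.
have sP : {subset seg i j P <= P} := @seg_sub _ i j P.
have g1 : ipath (rev (rcons (leg y) y) ++ seg i j P).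
  apply: ipath_glue => // u v uL vS; have vP := sP v vS.
  have -> : head v (seg i j P) = nth y P i by rewrite head_seg ?(set_nth_default y) //; slia.
  have -> : head u (rcons (leg y) y) = head y (leg y) by case: (leg y).
  have {}uL : u = head y (leg y) \/ u != head y (leg y) /\ u \in behead (rcons (leg y) y).
    have [->|ne] := eqVneq u (head y (leg y)); first by left.
    by right; split=> //; case: (mem_rcons_head uL) ne => // ->; rewrite eqxx.
  case: uL => [->|[ne ub]].
    rewrite eqxx; apply/andP; split; first by apply: contraNneq ny => ->.
    apply/eqP; apply/idP/idP => [yv|/eqP -> //].
    move: vS; rewrite mem_seg // => /and3P [_ l1 _]; have l2 := maxi' v vP yv.
    have -> : i = index v P by slia.
    by rewrite nth_index //= eqxx.
  by have /andP [-> /negbTE ->] := ay u v ub vP; rewrite (negbTE ne).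
have g2 : ipath (rev (rcons (leg z) z) ++ rev (rev (rcons (leg y) y) ++ seg i j P)).
  apply: ipath_glue => //; first exact: ipath_rev.
  move=> u v uL; rewrite mem_rev mem_cat mem_rev => vQ.
  have -> : head v (rev (rev (rcons (leg y) y) ++ seg i j P)) = nth y P j.
    rewrite rev_cat -(last_seg y (ltnW ij) jP).
    by case/lastP: (seg i j P) sn => // t a _; rewrite rev_rcons last_rcons.
  have -> : head u (rcons (leg z) z) = head z (leg z) by case: (leg z).
  have jnP : nth y P j \in P by apply: mem_nth.
  case/orP: vQ => vQ.
    have /andP [n1 n2] := apS y z yS zS yz v u vQ uL.
    rewrite eq_sym n1 sedge_sym (negbTE n2) /= eq_sym eqbF_neg negb_and.
    have -> : v != nth y P j; last by rewrite orbT.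
    apply: contraTneq vQ => ->; apply/negP => h.
    case: (mem_rcons_head h) => h'; last by have := ay _ _ h' jnP; rewrite eqxx.
    by move: ny; rewrite -h' jnP.
  have vP := sP v vQ.
  have {}uL : u = head z (leg z) \/ u != head z (leg z) /\ u \in behead (rcons (leg z) z).
    have [->|ne] := eqVneq u (head z (leg z)); first by left.
    by right; split=> //; case: (mem_rcons_head uL) ne => // ->; rewrite eqxx.
  case: uL => [->|[ne ub]].
    rewrite eqxx; apply/andP; split; first by apply: contraNneq nz => ->.
    apply/eqP; apply/idP/idP => [yv|/eqP -> //].
    move: vQ; rewrite mem_seg // => /and3P [_ _ l1]; have l2 := minj' v vP yv.
    have -> : j = index v P by slia.
    by rewrite nth_index //= eqxx.
  by have /andP [-> /negbTE ->] := az u v ub vP; rewrite (negbTE ne).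
by have := ipath_rev g2; rewrite rev_cat !revK catA.
Qed.

Definition ordered P (leg : G -> seq G) s := forall x0 i j, i < j -> j < size s ->
  before P (head (nth x0 s i) (leg (nth x0 s i))) (head (nth x0 s j) (leg (nth x0 s j))).

(** The intervals on [P] are pairwise disjoint, so sorting by the first neighbour orders them
    completely. *)
Lemma order_list D P leg S k b : ladder_in D P leg S k b ->
  exists s, [/\ uniq s, s =i S & ordered P leg s].
Proof.
case=> [[hP _] hS _ beS].
pose key y := find (sedge (head y (leg y))) P.
pose s := sort (relpre key leq) (enum S).
have ms : s =i S by move=> y; rewrite mem_sort mem_enum.
exists s; split=> //; first by rewrite sort_uniq enum_uniq.
move=> x0 i j ij js; set y := nth x0 s i; set z := nth x0 s j.
have us : uniq s by rewrite sort_uniq enum_uniq.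
have yS : y \in S by rewrite -ms mem_nth // (ltn_trans ij js).
have zS : z \in S by rewrite -ms mem_nth.
have yz : y != z by rewrite nth_uniq ?(ltn_trans ij js) // ltn_eqF.
have srt : sorted (relpre key leq) s by apply: sort_sorted => a c; apply: leq_total.
have kk : key y <= key z.
  have := @sorted_leq_nth _ (relpre key leq) (fun a c d => @leq_trans _ _ _) (fun a => leqnn _) x0 s srt i j.
  by rewrite !inE (ltn_trans ij js) js => /(_ isT isT (ltnW ij)).
case: (beS y z yS zS yz) => // h.
have hk t : t \in S -> key t < size P /\ head t (leg t) -- nth x0 P (key t).
  move=> tS; have [_ _ _ /meets_neighbour [p pP tp] _] := hS t tS.
  have hh : has (sedge (head t (leg t))) P by apply/hasP; exists p.
  by rewrite -has_find; split=> //; apply: nth_find.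
have [y1 y2] := hk y yS; have [z1 z2] := hk z zS.
by have := before_nth (ipath_uniq hP) h z1 y1 z2 y2; rewrite ltnNge kk.
Qed.

Lemma index_rev u P : uniq P -> u \in P -> index u (rev P) = size P - (index u P).+1.
Proof.
move=> U uP; have h : index u P < size P by rewrite index_mem.
have e : u = nth u (rev P) (size P - (index u P).+1).
  rewrite nth_rev; last by slia.
  by rewrite -subSn // subSS subKn ?nth_index // ltnW.
by rewrite {1}e index_uniq ?rev_uniq // size_rev; slia.
Qed.

Lemma meets_eq_mem k P R e : P =i R -> meets k P e -> meets k R e.
Proof.
move=> m; case: k => /=.
- by case=> c [cP ec] h; exists c; rewrite -?m // => v; rewrite -m; apply: h.
- case=> u [w [[uP wP] uw eu h]]; exists u, w; rewrite -!m; split=> // v.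
  by rewrite -m; apply: h.
- by case=> u [w [[uP wP] uw nuw eu]]; exists u, w; rewrite -!m.
Qed.

Lemma before_rev P e f : uniq P -> before P e f -> before (rev P) f e.
Proof.
move=> U h u v; rewrite !mem_rev => uP vP fu ev; rewrite !index_rev //.
have := h v u vP uP ev fu; have : index u P < size P by rewrite index_mem.
by slia.
Qed.

Lemma ladder_rev D P leg S k b : ladder_in D P leg S k b -> ladder_in D (rev P) leg S k b.
Proof.
case=> [[hP PD] hS apS beS]; have U := ipath_uniq hP; split=> //.
- by split; [exact: ipath_rev|move=> u; rewrite mem_rev => /PD].
- move=> y /hS [h1 [h2 h3] h4 h5 h6]; split=> //; first by rewrite mem_rev.
    by apply: apart_sub h4 => // u; rewrite mem_rev.
  by apply: meets_eq_mem h5 => v; rewrite mem_rev.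
- by move=> y z yS zS yz; case: (beS y z yS zS yz) => /(before_rev U); auto.
Qed.

Definition beforeb P e f := [forall u in P, forall v in P, (e -- u) ==> (f -- v) ==> (index u P < index v P)].

Lemma beforeP P e f : reflect (before P e f) (beforeb P e f).
Proof.
apply: (iffP forall_inP) => h u.
  by move=> v uP vP eu fv; have /forall_inP /(_ v vP) := h u uP; rewrite eu fv.
by move=> uP; apply/forall_inP => v vP; apply/implyP => eu; apply/implyP; apply: h.
Qed.

(* [Q] is [P'] or its reversal. *)
Lemma common_order D D' P P' leg leg' S k k' b b' n M : ramsey_bound n n M -> M <= #|S| ->
  ladder_in D P leg S k b -> ladder_in D' P' leg' S k' b' ->
  exists s Q, [/\ uniq s, size s = n & {subset s <= S}] /\
    [/\ ladder_in D P leg [set:: s] k b, ordered P leg s,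
        ladder_in D' Q leg' [set:: s] k' b' & ordered Q leg' s].
Proof.
move=> hM big l1 l2.
pose h1 y := head y (leg y); pose h2 y := head y (leg' y).
(* The pairs ordered alike by both ladders. On a clique the two orders coincide; on a stable set
   they are opposite, and [P'] is reversed. *)
pose e : rel G := [rel y z | beforeb P (h1 y) (h1 z) && beforeb P' (h2 y) (h2 z) ||
                             beforeb P (h1 z) (h1 y) && beforeb P' (h2 z) (h2 y)].
have es : symmetric e by move=> y z; rewrite /e /= orbC.
have noboth D0 P0 leg0 k0 b0 : ladder_in D0 P0 leg0 S k0 b0 -> {in S &, forall y z, y != z ->
   before P0 (head y (leg0 y)) (head z (leg0 z)) -> ~ before P0 (head z (leg0 z)) (head y (leg0 y))}.
  case=> [[hP _] hS _ _] y z yS zS _ a1 a2.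
  have [_ _ _ /meets_neighbour [p pP yp] _] := hS y yS.
  have [_ _ _ /meets_neighbour [q qP zq] _] := hS z zS.
  by have := ltn_trans (a1 _ _ pP qP yp zq) (a2 _ _ qP pP zq yp); rewrite ltnn.
suff [K [Q [sK cK lQ hQ]]] : exists (K : {set G}) Q, [/\ K \subset S, #|K| = n, ladder_in D' Q leg' S k' b' &
    {in K &, forall y z, y != z -> before P (h1 y) (h1 z) -> before Q (h2 y) (h2 z)}].
  have lK1 := ladder_sub sK l1; have lK2 := ladder_sub sK lQ.
  have [s [us ms os]] := order_list lK1.
  have eK : [set:: s] = K by apply/setP => y; rewrite inE ms.
  exists s, Q; rewrite eK; split; split=> //.
  - by rewrite -cK -(card_uniqP us); apply: eq_card => y; rewrite ms.
  - by move=> y; rewrite ms => /(subsetP sK).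
  - move=> x0 i j ij js; apply: hQ; rewrite -?ms ?mem_nth ?(ltn_trans ij js) //; last exact: os.
    by rewrite nth_uniq ?(ltn_trans ij js) // ltn_eqF.
have tot1 := l1; case: tot1 => _ _ _ tot1; have tot2 := l2; case: tot2 => [[hP' _] _ _ tot2].
have [[K [sK cK hK]]|[K [sK cK hK]]] := hM G e S es big.
- exists K, P'; split=> // y z yK zK yz byz.
  have yS := subsetP sK _ yK; have zS := subsetP sK _ zK.
  have := hK y z yK zK yz => /orP [] /andP [] /beforeP // a1 /beforeP // a2.
  by case: (noboth _ _ _ _ _ l1 y z yS zS yz byz).
- exists K, (rev P'); split=> //; first exact: ladder_rev.
  move=> y z yK zK yz byz; have yS := subsetP sK _ yK; have zS := subsetP sK _ zK.
  apply: before_rev; first exact: ipath_uniq hP'.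
  case: (tot2 y z yS zS yz) => // a; have := hK y z yK zK yz; rewrite /e /=.
  by have /beforeP -> := byz; have /beforeP -> := a.
Qed.

Lemma mem_drop_index P v i : uniq P -> v \in drop i P -> i <= index v P.
Proof.
move=> U /(nthP v) [j]; rewrite size_drop nth_drop => hj <-.
by rewrite index_uniq //; slia.
Qed.

(** [P] is cut at the first and last neighbours of [e]. In the wide case they are not consecutive
    because some two neighbours of [e] are nonadjacent. *)
Lemma meets_attached k P e : ipath P -> e \notin P -> meets k P e -> attached_as k P e.
Proof.
move=> hP eP; have U := ipath_uniq hP.
have ap1 (X : seq G) : {subset X <= P} -> (forall v, v \in X -> ~~ (e -- v)) -> apart [:: e] X.
  move=> sX h; apply: apart1 => v vX; rewrite h // andbT; apply: contraNneq eP => ->; exact: sX.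
have tk i : {subset take i P <= P} by move=> v /mem_take.
have dr i : {subset drop i P <= P} by move=> v /mem_drop.
have cut x0 i : i < size P -> P = take i P ++ nth x0 P i :: drop i.+1 P.
  by move=> h; rewrite -drop_nth // cat_take_drop.
case: k => /=.
- case=> c [cP ec] only; have iP : index c P < size P by rewrite index_mem.
  have e0 := cut c _ iP; rewrite nth_index // in e0.
  exists (take (index c P) P), c, (drop (index c P).+1 P); split=> //; apply: ap1 => // v.
  + move=> vt; apply/negP => ev; have := index_ltn vt.
    by rewrite (only v) ?ltnn // (tk _ _ vt).
  + move=> vt; apply/negP => ev; have := mem_drop_index U vt.
    by rewrite (only v) ?ltnn // (dr _ _ vt).
- case=> u [w [[uP wP] uw [eu ew] only]].
  wlog lt : u w uP wP uw eu ew only / index w P = (index u P).+1.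
    move=> H; have := uw; rewrite (ipath_adj hP) // => /orP [] /eqP h; first exact: (H u w).
    apply: (H w u) => //; first by rewrite sedge_sym.
    by move=> v vP ev; case: (only v vP ev); auto.
  have iu : index u P < size P by rewrite index_mem.
  have iw : index w P < size P by rewrite index_mem.
  have e0 := cut u _ iu; rewrite -lt (drop_nth u iw) !nth_index // in e0.
  exists (take (index u P) P), u, w, (drop (index w P).+1 P); split=> //; apply: ap1 => // v.
  + move=> vt; apply/negP => ev; have := index_ltn vt.
    by case: (only v (tk _ _ vt) ev) => ->; rewrite ?lt; slia.
  + move=> vt; apply/negP => ev; have := mem_drop_index U vt.
    by case: (only v (dr _ _ vt) ev) => ->; rewrite ?lt; slia.
- case=> u [w [[uP wP] uw nuw [eu ew]]].
  pose Z := [pred i | (i < size P) && (e -- nth u P i)].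
  have eZ : exists i, Z i by exists (index u P); rewrite /= index_mem uP nth_index.
  have bZ i : Z i -> i <= size P by case/andP => /ltnW.
  case: (ex_minnP eZ) => a /andP [aP ea] mina; case: (ex_maxnP eZ bZ) => b /andP [bP eb] maxb.
  have mina' v : v \in P -> e -- v -> a <= index v P by move=> vP ev; apply: mina; rewrite /= index_mem vP nth_index.
  have maxb' v : v \in P -> e -- v -> index v P <= b by move=> vP ev; apply: maxb; rewrite /= index_mem vP nth_index.
  have ab : a.+1 < b.
    have u1 := mina' u uP eu; have u2 := maxb' u uP eu; have w1 := mina' w wP ew; have w2 := maxb' w wP ew.
    have ne : index u P != index w P by apply: contraNneq uw => h; rewrite -(nth_index u uP) h nth_index.
    by move: nuw; rewrite (ipath_adj hP) // => /norP [n1 n2]; move: u1 u2 w1 w2 ne n1 n2; clear; lia.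
  clear eZ bZ mina maxb Z.
  have e0 := cut u _ aP.
  have e1 : drop a.+1 P = take (b - a.+1) (drop a.+1 P) ++ nth u P b :: drop b.+1 P.
    by rewrite -drop_nth // -{2}(subnK (ltnW ab)) -drop_drop cat_take_drop.
  rewrite e1 in e0.
  exists (take a P), (nth u P a), (take (b - a.+1) (drop a.+1 P)), (nth u P b), (drop b.+1 P); split=> //.
  + by rewrite -size_eq0 size_take size_drop; case: ifP; slia.
  + apply: ap1 => // v vt; apply/negP => ev; have := index_ltn vt.
    by have := mina' v (tk _ _ vt) ev; slia.
  + apply: ap1 => // v vt; apply/negP => ev; have := mem_drop_index U vt.
    by have := maxb' v (dr _ _ vt) ev; slia.
Qed.

(** The rays of [y1] and [y3] form a path through the centre, which is its only vertex seen by the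
    ray of [y2]. *)
Lemma star_bridge D c leg S b y1 y2 y3 : star_in D c leg S b ->
  y1 \in S -> y2 \in S -> y3 \in S -> y1 != y2 -> y1 != y3 -> y2 != y3 ->
  exists2 M, bridge D Single y1 y2 y3 M (leg y2) & (leg y2 == [::]) = b.
Proof.
case=> cD hS ap y1S y2S y3S n12 n13 n23.
have [s1 p1 _] := hS y1 y1S; have [s2 p2 b2] := hS y2 y2S; have [s3 p3 _] := hS y3 y3S.
have a12 := ap y1 y2 y1S y2S n12; have a13 := ap y1 y3 y1S y3S n13; have a23 := ap y2 y3 y2S y3S n23.
exists (rev (leg y1) ++ c :: leg y3) => //.
have n0 : rcons (leg y2) y2 != [::] by case: (leg y2).
have [c2 ip2 h2] := (@ipath_consP _ c _ n0).1 p2.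
have hd2 : head c (rcons (leg y2) y2) = head y2 (leg y2) by case: (leg y2).
rewrite hd2 in h2.
have sub y : {subset leg y <= rcons (leg y) y} by move=> v h; rewrite mem_rcons inE h orbT.
have in1 y : y \in rcons (leg y) y by rewrite mem_rcons mem_head.
split=> //.
- have -> : y1 :: rcons (rev (leg y1) ++ c :: leg y3) y3 = (y1 :: rev (leg y1)) ++ c :: rcons (leg y3) y3.
    by rewrite rcons_cat rcons_cons.
  apply: ipath_join => //; first by rewrite -rev_rcons -rev_cons; apply: ipath_rev.
  by apply: apart_sub a13 => // v; rewrite inE mem_rev mem_rcons inE.
- split=> // v; rewrite mem_cat inE mem_rev => /or3P [/s1|/eqP ->|/s3] //.
- split=> //; apply: apart_catr (apart_sym (apart1 _)) _ => [v hv|]; last first.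
    by apply: apart_sub a23 => // v; rewrite inE => /eqP ->.
  exact: a12.
- move=> u v ub; rewrite mem_cat inE mem_rev; have u2 := mem_behead ub.
  case/or3P => [v1|/eqP ->|v3].
  + by have := a12 v u (sub _ _ v1) u2; rewrite eq_sym sedge_sym.
  + rewrite sedge_sym h2 //; apply/andP; split; first by apply: contraNneq c2 => <-.
    apply: contraTneq ub => ->; have := ipath_uniq ip2; case: (leg y2) => //= a l.
    by case/andP.
  + exact: a23 _ _ u2 (sub _ _ v3).
- have hin : head y2 (leg y2) \in rcons (leg y2) y2 by apply: head_mem_rcons.
  exists (rev (leg y1)), c, (leg y3); split=> //.
  + by rewrite sedge_sym h2.
  + apply: apart1 => v; rewrite mem_rev => v1.
    by have := a12 v _ (sub _ _ v1) hin; rewrite eq_sym sedge_sym.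
  + by apply: apart1 => v v3; apply: a23 => //; apply: sub.
Qed.

(** All neighbours on [P] of the middle leg lie inside the stretch kept by [ladder_spine], so its
    type does not change. *)
Lemma ladder_bridge D P leg S k b y1 y2 y3 : ladder_in D P leg S k b ->
  y1 \in S -> y2 \in S -> y3 \in S -> y1 != y2 -> y1 != y3 -> y2 != y3 ->
  before P (head y1 (leg y1)) (head y2 (leg y2)) ->
  before P (head y2 (leg y2)) (head y3 (leg y3)) ->
  exists2 M, bridge D k y1 y2 y3 M (leg y2) & (leg y2 == [::]) = b.
Proof.
move=> hl y1S y2S y3S n12 n13 n23 b12 b23; have [[hP PD] hS ap _] := hl.
have [s1 [p1 m1] g1 k1 _] := hS y1 y1S; have [s2 [p2 m2] g2 k2 b2] := hS y2 y2S; have [s3 [p3 m3] g3 k3 _] := hS y3 y3S.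
have a12 := ap y1 y2 y1S y2S n12; have a13 := ap y1 y3 y1S y3S n13; have a23 := ap y2 y3 y2S y3S n23.
have U := ipath_uniq hP.
have b13 : before P (head y1 (leg y1)) (head y3 (leg y3)).
  move=> u v uP vP yu zv; have [p pP yp] := meets_neighbour k2.
  exact: ltn_trans (b12 u p uP pP yu yp) (b23 p v pP vP yp zv).
have [i [j [ij jP [yi imax] [zj jmin] hsp]]] := ladder_spine hl y1S y3S n13 b13.
pose M := rev (leg y1) ++ seg i j P ++ leg y3.
have eM : rev (rcons (leg y1) y1) ++ seg i j P ++ rcons (leg y3) y3 = y1 :: rcons M y3.
  by rewrite rev_rcons /M -!rcons_cat.
rewrite eM in hsp.
exists M => //.
have sub y : {subset leg y <= rcons (leg y) y} by move=> v h; rewrite mem_rcons inE h orbT.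
have in1 y : y \in rcons (leg y) y by rewrite mem_rcons mem_head.
have inM v : v \in M -> [\/ v \in leg y1, v \in seg i j P | v \in leg y3].
  by rewrite /M !mem_cat mem_rev => /or3P.
have hin : head y2 (leg y2) \in rcons (leg y2) y2 by apply: head_mem_rcons.
have n0 : seg i j P != [::] by rewrite -size_eq0 size_seg //; slia.
have M0 : M != [::] by rewrite /M; case: (seg i j P) n0 => // a l _; case: (rev _).
split=> //.
- split=> // v /inM [/s1|/seg_sub /PD|/s3] //.
- split=> //; apply: apart_catr (apart_sym (apart1 _)) _ => [v hv|]; last first.
    by apply: apart_sub a23 => // v; rewrite inE => /eqP ->.
  exact: a12.
- move=> u v ub /inM; have u2 := mem_behead ub; case=> hv.
  + by have := a12 v u (sub _ _ hv) u2; rewrite eq_sym sedge_sym.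
  + by apply: g2 => //; apply: seg_sub hv.
  + exact: a23 _ _ u2 (sub _ _ hv).
- have hM : ipath M.
    have := hsp; rewrite -cat1s -cats1 => h; apply: (@ipath_catl _ M [:: y3]) => //.
    by apply: (ipath_catr _ h); case: (M) M0.
  have notM v : v \in leg y1 \/ v \in leg y3 -> (head y2 (leg y2) != v) && ~~ (head y2 (leg y2) -- v).
    case=> hv; last by apply: a23 => //; apply: sub.
    by have := a12 v _ (sub _ _ hv) hin; rewrite eq_sym sedge_sym.
  have segM v : v \in seg i j P -> v \in M by rewrite /M !mem_cat => ->; rewrite orbT.
  have nbr_seg v : v \in P -> head y2 (leg y2) -- v -> v \in seg i j P.
    move=> vP ev; rewrite mem_seg // vP /=; apply/andP; split; apply: ltnW.
      have := b12 _ _ (mem_nth y1 (ltn_trans ij jP)) vP yi ev.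
      by rewrite index_uniq ?(ltn_trans ij jP).
    have := b23 _ _ vP (mem_nth y1 jP) ev zj.
    by rewrite index_uniq.
  have back v : v \in M -> head y2 (leg y2) -- v -> v \in P.
    move=> /inM [hv|/seg_sub //|hv] ev.
      by have /andP [_] := notM v (or_introl hv); rewrite ev.
    by have /andP [_] := notM v (or_intror hv); rewrite ev.
  apply: meets_attached => //.
    apply/negP => /inM; case=> [hv|/seg_sub|hv].
    - by have := notM _ (or_introl hv); rewrite eqxx.
    - exact/negP.
    - by have := notM _ (or_intror hv); rewrite eqxx.
  case: k k2 {hl hS k1 k3} => /=.
  + case=> c [cP ec] only; exists c; first by split=> //; apply/segM/nbr_seg.
    by move=> v vM ev; apply: only => //; apply: back.
  + case=> u [w [[uP wP] uw [eu ew] only]]; exists u, w; split=> //.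
      by split; apply/segM/nbr_seg.
    by move=> v vM ev; apply: only => //; apply: back.
  + by case=> u [w [[uP wP] uw nuw [eu ew]]]; exists u, w; split=> //; split; apply/segM/nbr_seg.
Qed.

(* [None] stands for a star. *)
Inductive arranged D s : option attach -> bool -> Prop :=
  | ArrangedStar c leg b of star_in D c leg [set:: s] b : arranged D s None b
  | ArrangedLadder P leg k b of ladder_in D P leg [set:: s] k b & ordered P leg s
      & (k = Wide -> b = true) : arranged D s (Some k) b.

(** A star imposes no order and adopts that of the other side; Ramsey's theorem is used only for two
    ladders. *)
Lemma common_arrangement D D' S n M : ramsey_bound n n M -> M <= #|S| -> n <= #|S| ->
  structured D S -> structured D' S ->
  exists s k b k' b', [/\ uniq s, size s = n, {subset s <= S},
    arranged D s k b & arranged D' s k' b'].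
Proof.
move=> hM big nS st st'.
have listed S0 : S0 \subset S -> exists s : seq G, [/\ uniq s, s =i S0 & [set:: s] = S0].
  move=> _; exists (enum S0); split; [exact: enum_uniq|exact: mem_enum|].
  by apply/setP => v; rewrite inE mem_enum.
have [S0 sS0 cS0] := subset_card nS.
have szs (s : seq G) : uniq s -> s =i S0 -> size s = n.
  by move=> us ms; rewrite -cS0 -(card_uniqP us); apply: eq_card.
have sets (s : seq G) : s =i S0 -> [set:: s] = S0 by move=> ms; apply/setP => v; rewrite inE ms.
case: st => [c leg b h|P leg k b h hk]; case: st' => [c' leg' b' h'|P' leg' k' b' h' hk'].
- have [s [us ms es]] := listed S0 sS0; exists s, None, b, None, b'; split=> //.
  + exact: szs.
  + by move=> v; rewrite ms => /(subsetP sS0).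
  + by apply: (@ArrangedStar _ _ c leg); rewrite es; apply: star_sub h.
  + by apply: (@ArrangedStar _ _ c' leg'); rewrite es; apply: star_sub h'.
- have [s [us ms os]] := order_list (ladder_sub sS0 h').
  exists s, None, b, (Some k'), b'; split=> //.
  + exact: szs.
  + by move=> v; rewrite ms => /(subsetP sS0).
  + by apply: (@ArrangedStar _ _ c leg); rewrite sets //; apply: star_sub h.
  + by apply: (@ArrangedLadder _ _ P' leg') => //; rewrite sets //; apply: ladder_sub h'.
- have [s [us ms os]] := order_list (ladder_sub sS0 h).
  exists s, (Some k), b, None, b'; split=> //.
  + exact: szs.
  + by move=> v; rewrite ms => /(subsetP sS0).
  + by apply: (@ArrangedLadder _ _ P leg) => //; rewrite sets //; apply: ladder_sub h.
  + by apply: (@ArrangedStar _ _ c' leg'); rewrite sets //; apply: star_sub h'.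
have [s [Q [[us zs ss] [l1 o1 l2 o2]]]] := common_order hM big h h'.
exists s, (Some k), b, (Some k'), b'; split=> //.
- exact: (ArrangedLadder l1).
- exact: (ArrangedLadder l2).
Qed.

(** The first three entries of the common order are enough, and a star behaves like a ladder of type
    [Single]. *)
Lemma arranged_bridge D s k b x0 : uniq s -> 3 <= size s -> arranged D s k b ->
  exists M L, [/\ bridge D (odflt Single k) (nth x0 s 0) (nth x0 s 1) (nth x0 s 2) M L,
    (L == [::]) = b & (k = Some Wide -> L = [::])].
Proof.
move=> us zs; have ins i : i < 3 -> nth x0 s i \in [set:: s].
  by move=> h; rewrite inE mem_nth // (leq_trans h).
have nes i j : i < 3 -> j < 3 -> i != j -> nth x0 s i != nth x0 s j.
  by move=> hi hj; rewrite nth_uniq ?(leq_trans hi) ?(leq_trans hj).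
case=> [c leg b' h|P leg k' b' h o hk].
  have [M hM hL] := star_bridge h (ins 0 isT) (ins 1 isT) (ins 2 isT) (nes 0 1 isT isT isT) (nes 0 2 isT isT isT) (nes 1 2 isT isT isT).
  by exists M, (leg (nth x0 s 1)).
have [M hM hL] := ladder_bridge h (ins 0 isT) (ins 1 isT) (ins 2 isT) (nes 0 1 isT isT isT) (nes 0 2 isT isT isT) (nes 1 2 isT isT isT) (o x0 0 1 isT (ltnW zs)) (o x0 1 2 isT zs).
exists M, (leg (nth x0 s 1)); split=> //.
by case=> /hk e; apply/eqP; rewrite hL.
Qed.

Definition triangular (k : option attach) := if k is Some Triangle then true else false.

Lemma arranged_types D1 D2 Y s k b k' b' : separated D1 D2 Y ->
  ~ has_theta G -> ~ has_prism G -> (forall y, y \in Y -> ~ Hub y) ->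
  uniq s -> 3 <= size s -> {subset s <= Y} ->
  arranged D1 s k b -> arranged D2 s k' b' ->
  triangular k != triangular k' /\
  ~ (k = Some Triangle /\ b /\ k' = Some Wide) /\ ~ (k' = Some Triangle /\ b' /\ k = Some Wide).
Proof.
move=> sD nt np hub us zs sY a a'.
have [x0 _] : exists x0 : G, True by case: (s) zs => // x0; exists x0.
have [M [L [B hL wL]]] := arranged_bridge x0 us zs a.
have [M' [L' [B' hL' wL']]] := arranged_bridge x0 us zs a'.
have iY i : i < 3 -> nth x0 s i \in Y by move=> h; apply/sY/mem_nth; apply: leq_trans zs.
have sD' := separated_sym sD.
have hub2 := hub _ (iY 1 isT).
have hw k0 M0 L0 D0 D0' M0' : separated D0 D0' Y -> L0 = [::] ->
  bridge D0 k0 (nth x0 s 0) (nth x0 s 1) (nth x0 s 2) M0 L0 ->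
  bridge D0' Wide (nth x0 s 0) (nth x0 s 1) (nth x0 s 2) M0' [::] -> False.
  by move=> sD0 e B0 B0'; rewrite e in B0; apply: hub2; apply: (hub_wide sD0 B0 B0').
(* A single side against a wide one: a theta if the single side has a leg, a hub otherwise. *)
have sw M0 L0 D0 D0' M0' : separated D0 D0' Y ->
  bridge D0 Single (nth x0 s 0) (nth x0 s 1) (nth x0 s 2) M0 L0 ->
  bridge D0' Wide (nth x0 s 0) (nth x0 s 1) (nth x0 s 2) M0' [::] -> False.
  move=> sD0 B0 B0'; have [e|ne] := eqVneq L0 [::]; first exact: (hw _ _ _ _ _ _ sD0 e B0 B0').
  by apply: nt; apply: (theta_single_wide sD0 (iY 0 isT) (iY 1 isT) (iY 2 isT) ne B0 B0').
split; last first.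
  split.
  - case=> ek [hb ek']; rewrite ek ek' /= in B B'; rewrite wL' // in B'.
    by apply: (hw _ _ _ _ _ _ sD _ B B'); apply/eqP; rewrite hL.
  - case=> ek' [hb ek]; rewrite ek ek' /= in B B'; rewrite wL // in B.
    by apply: (hw _ _ _ _ _ _ sD' _ B' B); apply/eqP; rewrite hL'.
have nontri k0 : ~~ triangular k0 -> odflt Single k0 = Single \/ k0 = Some Wide.
  by case: k0 => [[]|] /=; auto.
apply/negP => /eqP et; case t: (triangular k) et => et.
  have ek : k = Some Triangle by case: (k) t => [[]|].
  have ek' : k' = Some Triangle by case: (k') et => [[]|].
  rewrite ek ek' /= in B B'.
  have [/norP [/negPn /eqP eL /negPn /eqP eL']|ne] := boolP (~~ ((L != [::]) || (L' != [::]))).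
    by rewrite eL eL' in B B'; apply: hub2; apply: (hub_triangles sD B B').
  by apply: np; apply: (prism_triangles sD (iY 0 isT) (iY 1 isT) (iY 2 isT) (negPn ne) B B').
have [e|e] := nontri k (negbT t); have [e'|e'] := nontri k' (negbT (esym et)).
- by rewrite e e' in B B'; apply: nt; apply: (theta_single_single sD B B').
- by rewrite e e' /= wL' // in B B'; apply: (sw _ _ _ _ _ sD B B').
- by rewrite e e' /= wL // in B B'; apply: (sw _ _ _ _ _ sD' B' B).
- by rewrite e e' /= wL // in B B'; rewrite wL' // in B'; apply: (hw _ _ _ _ _ _ sD _ B B').
Qed.

End Arranged.

(** * Combs, caterpillars and their line graphs *)

Section Trees.
Variable F : sgraph.
Implicit Types (u v x y z : F) (p q w : seq F).

(** Connected, since ranks decrease along parents until [r] is reached. In a cycle, a vertex of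
    largest rank would have its parent both as successor and as predecessor, which is impossible for
    three or more vertices. *)
Lemma tree_of_parent (par : F -> F) (rk : F -> nat) (r : F) :
  (forall u v, u -- v -> u = par v /\ rk u < rk v \/ v = par u /\ rk v < rk u) ->
  (forall v, v != r -> par v -- v /\ rk (par v) < rk v) -> is_tree F.
Proof.
move=> hadj hpar; split; first by apply/card_gt0P; exists r.
  have toroot n v : rk v <= n -> connect (@sedge F) v r.
    elim: n v => [|n IH] v hv; have [->|vr] := eqVneq v r; rewrite ?connect0 //.
      by have [_] := hpar v vr; move: hv; clear; lia.
    have [pv lt] := hpar v vr.
    apply: (@connect_trans _ _ (par v)); first by apply: connect1; rewrite sedge_sym.
    by apply: IH; move: hv lt; clear; lia.
  move=> u v; apply: connect_trans (toroot _ u (leqnn _)) _.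
  rewrite (sym_connect_sym (@sedge_sym F)); exact: toroot (leqnn _).
move=> c /andP [cc uc]; rewrite leqNgt; apply/negP => sc.
have [v0 v0c] : exists v, v \in c by case: (c) sc => // v l _; exists v; rewrite mem_head.
case: (@arg_maxnP _ v0 (mem c) rk v0c) => v vc maxv.
have nb u : u \in c -> u -- v -> u = par v.
  move=> uc' uv; case: (hadj u v uv) => [[]//|[_ lt]].
  by have := maxv u uc'; move: lt; clear; lia.
have e1 := nb (next c v); have e2 := nb (prev c v).
have vc' : v \in c by [].
rewrite mem_next vc' sedge_sym (next_cycle cc vc') in e1; rewrite mem_prev vc' (prev_cycle cc vc') in e2.
have e : next c v = prev c v by rewrite e1 // e2.
have [i c' rc] := rot_to vc'.
rewrite -(next_rot i uc) -(prev_rot i uc) rc in e.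
have uc' : uniq (v :: c') by rewrite -rc rot_uniq.
have sc' : 2 < size (v :: c') by rewrite -rc size_rot.
case: c' {rc} uc' sc' e => [|a [|b l]] // uc' _.
have vn : v \notin a :: b :: l by case/andP: uc'.
rewrite next_nth prev_nth mem_head /= eqxx => e.
have : index v [:: a, b & l] = size [:: a, b & l] by apply/eqP; rewrite eqn_leq index_size leqNgt index_mem.
rewrite /= => h; rewrite h in e; move: e => /= e.
move: uc' => /= /and4P [_ h2 _ _]; case/negP: h2.
by rewrite e; apply: mem_nth.
Qed.

Lemma three_neighbours w v a b c : ipath w -> v \in w -> a \in w -> b \in w -> c \in w ->
  v -- a -> v -- b -> v -- c -> a != b -> [|| c == a | c == b].
Proof.
move=> hw vw aw bw cw; rewrite !(ipath_adj hw) // => ha hb hc ab.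
have ne : index a w != index b w by apply: contraNneq ab => h; rewrite -(nth_index a aw) h nth_index.
have h : index c w = index a w \/ index c w = index b w by move: ha hb hc ne; clear; lia.
by case: h => h; apply/orP; [left|right]; apply/eqP; rewrite -(nth_index c cw) h nth_index.
Qed.

Section Comb.
(** The teeth are indexed by a separate type because in the applications their names are vertices of
    the ambient graph, while [F] is an induced subgraph of it or an auxiliary tree. *)
Variables (J : eqType) (j0 : J) (ys : seq J) (w : seq F) (leg : J -> seq F) (a : J -> nat).
Hypotheses (hw : ipath w) (cover : forall v, v \in w \/ exists2 j, j \in ys & v \in leg j).
Hypotheses (j0ys : j0 \in ys).
Hypothesis hleg : forall j, j \in ys -> ipath (leg j) /\ forall u, u \in leg j -> u \notin w.
Hypothesis apl : {in ys &, forall i j, i != j -> apart (leg i) (leg j)}.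
Hypothesis ha : forall j, j \in ys -> 0 < a j /\ (a j).+1 < size w.
Hypothesis inja : {in ys &, injective a}.
Hypothesis hadj : forall j u v, j \in ys -> u \in w -> v \in leg j ->
  u -- v = (index u w == a j) && (v == head v (leg j)).

Let Uw : uniq w := ipath_uniq hw.

Definition owner v := nth j0 ys (find (fun j => v \in leg j) ys).

(** The comb is rooted at the first vertex of [w], which is its own parent. The ranks below increase
    away from the root, all legs ranking above [w]. *)
Definition parent v := if v \in w then nth v w (index v w).-1 else
  if index v (leg (owner v)) is m.+1 then nth v (leg (owner v)) m else nth v w (a (owner v)).

Definition rank v := if v \in w then index v w else size w + index v (leg (owner v)).

Lemma ownerE j v : j \in ys -> v \in leg j -> owner v = j.
Proof.
move=> jys vj; have hh : has (fun j => v \in leg j) ys by apply/hasP; exists j.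
have h1 := nth_find j0 hh; have h2 : owner v \in ys by rewrite mem_nth // -has_find.
apply/eqP; apply: contraTT isT => ne; have := apl h2 jys ne h1 vj.
by rewrite eqxx.
Qed.

Lemma comb_adj u v : u -- v -> u = parent v /\ rank u < rank v \/ v = parent u /\ rank v < rank u.
Proof.
have lw j t : j \in ys -> t \in leg j -> (t \in w) = false.
  by move=> jys tj; apply/negbTE; apply: (hleg jys).2.
have wl u' v' j : j \in ys -> u' \in w -> v' \in leg j -> u' -- v' -> u' = parent v' /\ rank u' < rank v'.
  move=> jys uw vj; rewrite (hadj jys uw vj) => /andP [/eqP ei /eqP ev].
  have -> : rank u' < rank v'.
    rewrite /rank uw (lw j) // (leq_trans _ (leq_addr _ _)) // index_mem //.
  rewrite /parent (lw j) // (ownerE jys vj).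
  have -> : index v' (leg j) = 0 by rewrite ev; case: (leg j) vj => //= c l _; rewrite eqxx.
  by rewrite -ei (set_nth_default u') ?index_mem // nth_index.
move=> uv; case: (cover u) => [uw|[i iys ui]]; case: (cover v) => [vw|[j jys vj]].
- move: (uv); rewrite (ipath_adj hw) // => /orP [] /eqP h; [left|right].
    by rewrite /parent /rank vw uw h /= (set_nth_default u) ?index_mem ?nth_index.
  by rewrite /parent /rank vw uw h /= (set_nth_default v) ?index_mem ?nth_index.
- by left; apply: (wl _ _ j).
- by right; apply: (wl _ _ i) => //; rewrite sedge_sym.
have [ij|ij] := eqVneq i j; last by have /andP [_] := apl iys jys ij ui vj; rewrite uv.
rewrite -ij in vj; have [hi _] := hleg iys.
move: (uv); rewrite (ipath_adj hi) // => /orP [] /eqP h; [left|right].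
  rewrite /parent /rank !(lw i) // !(ownerE iys) // h ltn_add2l ltnSn.
  by rewrite (set_nth_default u) ?index_mem ?nth_index.
rewrite /parent /rank !(lw i) // !(ownerE iys) // h ltn_add2l ltnSn.
by rewrite (set_nth_default v) ?index_mem ?nth_index.
Qed.

Lemma parent_head j v : j \in ys -> v \in leg j -> v = head v (leg j) -> parent v = nth v w (a j).
Proof.
move=> jys vj ev; rewrite /parent (negbTE ((hleg jys).2 _ vj)) (ownerE jys vj).
have -> // : index v (leg j) = 0.
by rewrite ev; case: (leg j) vj => //= b l _; rewrite eqxx.
Qed.

Lemma size_w : 2 < size w.
Proof. by have [h1 h2] := ha j0ys; apply: leq_trans h2; rewrite !ltnS. Qed.

Lemma parent_edge v : index v w != 0 -> parent v -- v /\ rank (parent v) < rank v.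
Proof.
move=> v0; suff e : parent v -- v.
  split=> //; case: (comb_adj e) => [[_ //]|[ev lt]]; exfalso.
  have [vw|vw] := boolP (v \in w).
    have h : (index v w).-1 < size w by apply: (@leq_ltn_trans (index v w)); rewrite ?leq_pred ?index_mem.
    move: lt; rewrite /rank vw /parent vw mem_nth // index_uniq //.
    by move: v0; clear; lia.
  case: (cover v) => [vw'|[j jys vj]]; first by rewrite vw' in vw.
  move: lt; rewrite /rank (negbTE vw) (ownerE jys vj) /parent (negbTE vw) (ownerE jys vj).
  have [h1 h2] := ha jys; have aw : a j < size w by exact: ltnW.
  case E: (index v (leg j)) => [|m]; first by rewrite mem_nth // index_uniq //; move: aw; clear; lia.
  have ms : m < size (leg j) by rewrite -index_mem E in vj; exact: ltnW.
  have nw := (hleg jys).2 _ (mem_nth v ms).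
  by rewrite (negbTE nw) (ownerE jys (mem_nth v ms)) index_uniq ?(ipath_uniq (hleg jys).1) //; clear; lia.
case: (cover v) => [vw|[j jys vj]].
  have iv : index v w < size w by rewrite index_mem.
  have h : (index v w).-1 < size w by apply: leq_ltn_trans iv; exact: leq_pred.
  by rewrite /parent vw (ipath_adj hw) ?mem_nth // index_uniq // prednK ?lt0n // eqxx.
have nvw := (hleg jys).2 _ vj; rewrite /parent (negbTE nvw) (ownerE jys vj).
have [h1 h2] := ha jys; have aw : a j < size w by exact: ltnW.
case E: (index v (leg j)) => [|m].
  rewrite (hadj jys) ?mem_nth // index_uniq // eqxx /=.
  by case: (leg j) vj E => //= b l _; case: eqVneq.
have ms : m < size (leg j) by rewrite -index_mem E in vj; exact: ltnW.
by rewrite (ipath_adj (hleg jys).1) ?mem_nth // index_uniq ?(ipath_uniq (hleg jys).1) // E eqxx.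
Qed.

(** Needed for the line graph, where these are two edges with the same upper end: the only such
    pairs are the first vertex of a tooth and the successor on [w] of its base. *)
Lemma siblings u v : index u w != 0 -> index v w != 0 -> u != v -> parent u = parent v ->
  exists2 j, j \in ys & (u = head u (leg j) /\ v \in w /\ index v w = (a j).+1) \/
                        (v = head v (leg j) /\ u \in w /\ index u w = (a j).+1).
Proof.
move=> u0 v0 uv.
have pw t : t \in w -> index t w != 0 -> parent t \in w /\ index (parent t) w = (index t w).-1.
  move=> tw t0; have h : (index t w).-1 < size w by apply: (@leq_ltn_trans (index t w)); rewrite ?leq_pred ?index_mem.
  by rewrite /parent tw mem_nth // index_uniq.
have pl t j : j \in ys -> t \in leg j -> (t = head t (leg j) /\ parent t \in w /\ index (parent t) w = a j) \/
     (parent t \in leg j /\ index t (leg j) = (index (parent t) (leg j)).+1).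
  move=> jys tj; have nw := (hleg jys).2 _ tj; rewrite /parent (negbTE nw) (ownerE jys tj).
  have [h1 h2] := ha jys; have aw : a j < size w by exact: ltnW.
  case E: (index t (leg j)) => [|m]; [left|right].
    rewrite mem_nth // index_uniq //; split=> //.
    by case: (leg j) tj E => //= b l _; case: eqVneq.
  have ms : m < size (leg j) by rewrite -index_mem E in tj; exact: ltnW.
  by rewrite mem_nth // index_uniq ?(ipath_uniq (hleg jys).1).
case: (cover u) => [uw|[i iys ui]]; case: (cover v) => [vw|[j jys vj]] e.
- have [_ e1] := pw u uw u0; have [_ e2] := pw v vw v0.
  case/eqP: uv; rewrite -(nth_index u uw) -[RHS](nth_index u vw); congr nth.
  by rewrite -(prednK (n := index u w)) ?lt0n // -e1 e e2 prednK ?lt0n.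
- have [p1 e1] := pw u uw u0; case: (pl v j jys vj) => [[ev [pv e2]]|[pv _]].
    exists j => //; right; split=> //; split=> //.
    by rewrite -e2 -e e1 prednK ?lt0n.
  by have := (hleg jys).2 _ pv; rewrite -e p1.
- have [p1 e1] := pw v vw v0; case: (pl u i iys ui) => [[ev [pv e2]]|[pv _]].
    exists i => //; left; split=> //; split=> //.
    by rewrite -e2 e e1 prednK ?lt0n.
  by have := (hleg iys).2 _ pv; rewrite e p1.
- case: (pl u i iys ui) => [[eu [pu e1]]|[pu e1]]; case: (pl v j jys vj) => [[ev [pv e2]]|[pv e2]].
  + have ij : i = j by apply: inja => //; rewrite -e1 -e2 e.
    by case/eqP: uv; rewrite eu ev ij; case: (leg j) vj.
  + by have := (hleg jys).2 _ pv; rewrite -e pu.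
  + by have := (hleg iys).2 _ pu; rewrite e pv.
  + have ij : i = j by rewrite -(ownerE iys pu) -(ownerE jys pv) e.
    case/eqP: uv; rewrite -ij in vj e2; rewrite -(nth_index u ui) -[RHS](nth_index u vj); congr nth.
    by rewrite e1 e2 e.
Qed.

Lemma comb_tree : is_tree F.
Proof.
have w0 : 0 < size w by apply: leq_trans size_w.
have [x0 _] : exists x0 : F, True by case: (w) w0 => // x0; exists x0.
apply: (@tree_of_parent parent rank (nth x0 w 0)); first exact: comb_adj.
move=> v vr; apply: parent_edge; apply: contraNneq vr => h.
by rewrite -h nth_index // -index_mem h.
Qed.

Lemma card3_le (T : finType) (b c d : T) : #|[set b; c; d]| <= 3.
Proof.
apply: leq_trans (leq_card_setU _ _) _; rewrite cards1 addn1 ltnS.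
by rewrite cards2; case: (_ == _).
Qed.

Lemma comb_degree v : #|nbr v| <= 3 /\ (2 < #|nbr v| -> v \in w).
Proof.
case: (cover v) => [vw|[j jys vj]].
  split=> //; pose l := if [seq j <- ys | a j == index v w] is j :: _ then head v (leg j) else v.
  apply: leq_trans (card3_le (nth v w (index v w).-1) (nth v w (index v w).+1) l).
  apply/subset_leq_card/subsetP => u; rewrite !inE => vu.
  case: (cover u) => [uw|[i iys ui]].
    move: vu; rewrite (ipath_adj hw) // => /orP [] /eqP h.
      by rewrite -h nth_index // eqxx !orbT.
    by rewrite h /= nth_index // eqxx.
  move: vu; rewrite (hadj iys) // => /andP [/eqP e1 /eqP e2].
  have il : i \in [seq j <- ys | a j == index v w] by rewrite mem_filter e1 eqxx.
  rewrite /l; case E: [seq j <- ys | a j == index v w] il => [//|k t] il.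
  have : k \in [seq j <- ys | a j == index v w] by rewrite E mem_head.
  rewrite mem_filter => /andP [/eqP ek kys].
  have -> : k = i by apply: inja => //; rewrite ek.
  by rewrite e2; case: (leg i) ui => //= b t' _; rewrite eqxx orbT.
have nvw := (hleg jys).2 _ vj.
have le2 : #|nbr v| <= 2.
  apply: (@leq_trans #|[set parent v; nth v (leg j) (index v (leg j)).+1]|); last first.
    by rewrite cards2; case: (_ == _).
  apply/subset_leq_card/subsetP => u; rewrite !inE sedge_sym => uv.
  case: (comb_adj uv) => [[-> _]|[ev _]]; first by rewrite eqxx.
  case: (cover u) => [uw|[i iys ui]].
    case: (comb_adj uv) => [[-> _]|[_ lt]]; first by rewrite eqxx.
    move: lt; rewrite /rank (negbTE nvw) uw => lt.
    have : index u w < size w by rewrite index_mem.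
    by move: lt; clear; lia.
  have [ij|ij] := eqVneq i j; last by have /andP [_] := apl iys jys ij ui vj; rewrite uv.
  rewrite ij in ui; move: uv; rewrite sedge_sym (ipath_adj (hleg jys).1) // => /orP [] /eqP h.
    by rewrite -h nth_index // eqxx orbT.
  by rewrite /parent (negbTE nvw) (ownerE jys vj) h nth_index // eqxx.
by split; [apply: leq_trans le2 _|move=> h; rewrite ltnNge le2 in h].
Qed.

Lemma comb_caterpillar : caterpillar F /\ spine w.
Proof.
have bp : branch_path w by split=> // v; apply: (comb_degree v).2.
have [x0 _] : exists x0 : F, True by have := size_w; case: (w) => // x0; exists x0.
split.
  split; [exact: comb_tree| |by exists w].
  apply/eqP; rewrite eqn_leq; apply/andP; split.
    by apply/bigmax_leqP => v _; apply: (comb_degree v).1.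
  have [h1 h2] := ha j0ys; have aw : a j0 < size w by exact: ltnW.
  have [hl lw] := hleg j0ys.
  have [e0 [l0 el]] : exists e0 l0, leg j0 = e0 :: l0 by case: hl; case: (leg j0) => // e0 l0; exists e0, l0.
  have el0 : e0 \in leg j0 by rewrite el mem_head.
  apply: leq_trans (leq_bigmax (nth x0 w (a j0))).
  have pred_lt : (a j0).-1 < size w by apply: leq_ltn_trans aw; exact: leq_pred.
  apply: (@leq_trans #|[set nth x0 w (a j0).-1; nth x0 w (a j0).+1; e0]|); last first.
    apply/subset_leq_card/subsetP => u; rewrite !inE => /orP [/orP []|] /eqP ->.
    - by rewrite (ipath_adj hw) ?mem_nth // !index_uniq // prednK // eqxx orbT.
    - by rewrite (ipath_adj hw) ?mem_nth // !index_uniq // eqxx.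
    - by rewrite (hadj j0ys) ?mem_nth // index_uniq // el /= !eqxx.
  rewrite -setUA cardsU1 cards2 !inE negb_or nth_uniq //.
  have n1 i : i < size w -> nth x0 w i != e0.
    by move=> iw; apply: contraTneq el0 => <-; apply/negP => /lw; rewrite mem_nth.
  by rewrite !n1 //; have -> : (a j0).-1 == (a j0).+1 = false by clear; lia.
(* A larger path containing [w] would have an edge from some [z] on [w] to a tooth; but [z] is an
   inner vertex of [w], which already has two neighbours there. *)
split=> // q [hq bq] wq v vq; apply: contraT => vw.
have w0 : 0 < size w by apply: leq_trans size_w.
have x0w : nth x0 w 0 \in w by apply: mem_nth.
have cq : connected [set:: q].
  apply: (@connected_root _ _ (nth x0 w 0)); first by rewrite inE wq.
  by move=> u; rewrite inE => uq; apply: (ipath_connected hq) => //; [exact: wq|move=> t tq _; rewrite inE].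
have m1 : nth x0 w 0 \in [set:: q] by rewrite inE wq.
have m2 : nth x0 w 0 \in [set:: w] by rewrite inE.
have m3 : v \in [set:: q] by rewrite inE.
have m4 : v \notin [set:: w] by rewrite inE.
have [z [t [zq zw tq tw zt]]] := connected_cross cq m1 m2 m3 m4.
rewrite !inE in zq zw tq tw.
case: (cover t) => [tw'|[j jys tj]]; first by rewrite tw' in tw.
move: (zt); rewrite (hadj jys zw tj) => /andP [/eqP ez _].
have [h1 h2] := ha jys; have aw : a j < size w by exact: ltnW.
have pred_lt : (a j).-1 < size w by apply: leq_ltn_trans aw; exact: leq_pred.
have b1 : nth x0 w (a j).-1 \in w by rewrite mem_nth.
have b2 : nth x0 w (a j).+1 \in w by rewrite mem_nth.
have ne : nth x0 w (a j).-1 != nth x0 w (a j).+1 by rewrite nth_uniq //; clear; lia.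
have := three_neighbours hq zq (wq _ b1) (wq _ b2) tq _ _ zt ne.
rewrite !(ipath_adj hw) // !index_uniq // ez prednK // !eqxx orbT => /(_ isT isT).
by case/orP => /eqP et; rewrite et ?b1 ?b2 in tw.
Qed.

End Comb.

End Trees.

Lemma ipath_map (F G : sgraph) (f : F -> G) (p : seq F) : injective f ->
  {in p &, forall u v, f u -- f v = u -- v} -> ipath (map f p) <-> ipath p.
Proof.
move=> inj hf; case: (eqVneq p [::]) => [->|p0]; first by split=> -[].
have [x0 _] : exists x0 : F, True by case: (p) p0 => // x0; exists x0.
have n0 : map f p != [::] by case: (p) p0.
split=> -[_ U h]; split=> //.
- by rewrite map_inj_uniq in U.
- move=> x i j ij js; have is_ := ltn_trans ij js.
  by rewrite -hf ?mem_nth // -!(nth_map x (f x0) f) // h ?size_map.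
- by rewrite map_inj_uniq.
- move=> x i j ij; rewrite size_map => js; have is_ := ltn_trans ij js.
  by rewrite !(nth_map x0) // hf ?mem_nth // h.
Qed.

(** * Lists of vertices read inside an induced subgraph *)

Section Lift.
Variables (G : sgraph) (H : {set G}).
Implicit Types (p : seq G) (u v : induced H).

Definition restr p : seq (induced H) := pmap insub p.

Lemma map_restr p : {subset p <= H} -> map val (restr p) = p.
Proof.
elim: p => //= x p IH s; rewrite /restr /= insubT /=; first by apply: s; rewrite mem_head.
by move=> xH; rewrite /= -/(restr p) IH // => u up; apply: s; rewrite inE up orbT.
Qed.

Lemma mem_restr p u : (u \in restr p) = (val u \in p).
Proof. by rewrite mem_pmap_sub. Qed.

Lemma ipath_restr p : {subset p <= H} -> ipath p -> ipath (restr p).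
Proof.
move=> s hp.
have [h _] := @ipath_map (induced H) G (@induced_val G H) (restr p) val_inj (fun _ _ _ _ => erefl).
by apply: h; have -> : map (@induced_val G H) (restr p) = p := map_restr s.
Qed.

Lemma index_restr p u : {subset p <= H} -> index u (restr p) = index (val u) p.
Proof. by move=> s; rewrite -{2}(map_restr s) index_map //; apply: val_inj. Qed.

Lemma size_restr p : {subset p <= H} -> size (restr p) = size p.
Proof. by move=> s; rewrite -{2}(map_restr s) size_map. Qed.

Lemma head_restr p u x : {subset p <= H} -> p != [::] -> val (head u (restr p)) = head x p.
Proof. by move=> s; rewrite -{1 3}(map_restr s); case: (restr p). Qed.

Lemma nth_restr p u x i : {subset p <= H} -> i < size p -> val (nth u (restr p) i) = nth x p i.
Proof. by move=> s h; rewrite -{2}(map_restr s) (nth_map u) // size_restr. Qed.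

End Lift.

(** * Combs as induced subgraphs, and their simplicial vertices *)

Section Combs.
Variable G : sgraph.
Implicit Types (u v x y z c e p q : G) (r s w ys : seq G) (H X : {set G}).

(* [t] tells whether the head of a leg sees two consecutive vertices of [w] or one. *)
Definition comb (t : bool) w ys (leg : G -> seq G) (a : G -> nat) :=
  [/\ ipath w, ys != [::] /\ uniq ys,
      forall y, y \in ys ->
        [/\ leg y != [::], ipath (rcons (leg y) y), apart (behead (rcons (leg y) y)) w,
            head y (leg y) \notin w &
            [/\ 0 < a y, a y + t + 1 < size w &
                forall u, u \in w -> head y (leg y) -- u =
                  (index u w == a y) || t && (index u w == (a y).+1)]],
      {in ys &, forall y z, y != z -> apart (rcons (leg y) y) (rcons (leg z) z)} &
      forall x0 i j, i < j -> j < size ys -> a (nth x0 ys i) + t < a (nth x0 ys j)].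

Definition comb_set w ys (leg : G -> seq G) : {set G} :=
  [set v | (v \in w) || has (fun y => v \in leg y) ys].

Section Facts.
Variables (t : bool) (w ys : seq G) (leg : G -> seq G) (a : G -> nat).
Hypothesis hc : comb t w ys leg a.
Let H := comb_set w ys leg.

Lemma comb_setP v : reflect (v \in w \/ exists2 y, y \in ys & v \in leg y) (v \in H).
Proof.
rewrite inE; apply: (iffP orP) => -[h|]; auto.
  by case/hasP => y yys h; right; exists y.
by case=> y yys h; right; apply/hasP; exists y.
Qed.

Lemma w_sub : {subset w <= H}.
Proof. by move=> u uw; apply/comb_setP; left. Qed.

Lemma leg_sub y : y \in ys -> {subset leg y <= H}.
Proof. by move=> yys u ul; apply/comb_setP; right; exists y. Qed.

Lemma sub_rcons y : {subset leg y <= rcons (leg y) y}.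
Proof. by move=> v h; rewrite mem_rcons inE h orbT. Qed.

Lemma leg_ipath y : y \in ys -> ipath (leg y).
Proof. by case: hc => _ _ h _ _ /h [n0 ip _ _ _]; apply: (@ipath_catl _ _ [:: y]); rewrite // cats1. Qed.

Lemma leg_notin y u : y \in ys -> u \in rcons (leg y) y -> u \notin w.
Proof.
case: hc => _ _ h _ _ /h [n0 ip ap nh _] /mem_rcons_head [->//|ub].
by apply/negP => uw; have := ap u u ub uw; rewrite eqxx.
Qed.

Lemma leg_w y u v : y \in ys -> u \in w -> v \in rcons (leg y) y ->
  u -- v = (v == head y (leg y)) && ((index u w == a y) || t && (index u w == (a y).+1)).
Proof.
case: (hc) => _ _ h _ _ yys uw vl; have [n0 ip ap nh [_ _ ha]] := h y yys.
have [->|ne] := eqVneq v (head y (leg y)); first by rewrite sedge_sym ha.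
case: (mem_rcons_head vl) => [e|vb]; first by rewrite e eqxx in ne.
by have /andP [_ /negbTE] := ap v u vb uw; rewrite sedge_sym.
Qed.

Lemma head_leg y v : y \in ys -> head v (leg y) = head y (leg y).
Proof. by case: hc => _ _ h _ _ /h [+ _ _ _ _]; case: (leg y). Qed.

Lemma head_in y : y \in ys -> head y (leg y) \in leg y.
Proof. by case: hc => _ _ h _ _ /h [+ _ _ _ _]; case: (leg y) => // e l _; rewrite mem_head. Qed.

Lemma last_in y : y \in ys -> last y (leg y) \in leg y.
Proof. by case: hc => _ _ h _ _ /h [+ _ _ _ _]; case: (leg y) => // e l _; rewrite /= mem_last. Qed.

Lemma a_inj : {in ys &, injective a}.
Proof.
case: hc => _ [_ U] _ _ mono y z yys zys e; apply/eqP; apply: contraT => ne.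
have iy : index y ys < size ys by rewrite index_mem.
have iz : index z ys < size ys by rewrite index_mem.
have nidx : index y ys != index z ys by apply: contraNneq ne => h; rewrite -(nth_index y yys) h nth_index.
have [lt|lt|h] := ltngtP (index y ys) (index z ys); last by rewrite h eqxx in nidx.
- by have := mono y _ _ lt iz; rewrite !nth_index // e; clear; slia.
- by have := mono y _ _ lt iy; rewrite !nth_index // e; clear; slia.
Qed.

Lemma leg_y y v : y \in ys -> v \in leg y -> y -- v = (v == last y (leg y)).
Proof.
case: (hc) => _ _ h _ _ yys vl; have [n0 ip _ _ _] := h y yys.
move: n0 ip vl; case/lastP: (leg y) => // l e _ ip; rewrite last_rcons.
have := ipath_rev ip; rewrite !rev_rcons => ip'.
have [_ _ h'] := (@ipath_consP _ y (e :: rev l) isT).1 ip'.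
by rewrite mem_rcons => vl; rewrite h' // inE mem_rev -in_cons.
Qed.

Lemma in_leg_uniq y z v : y \in ys -> z \in ys -> v \in rcons (leg y) y -> v \in rcons (leg z) z -> y = z.
Proof.
case: hc => _ _ _ ap _ yys zys vy vz; apply/eqP; apply: contraT => ne.
by have := ap y z yys zys ne v v vy vz; rewrite eqxx.
Qed.

(** The ends of [w] and of the legs; on the comb these are the simplicial vertices. *)
Definition tip v := [|| v == head v w, v == last v w | has (fun y => v == last y (leg y)) ys].

Lemma size_comb : 2 < size w.
Proof.
case: (hc) => _ [n0 _] h _ _.
have [y yys] : exists y, y \in ys by case: (ys) n0 => // y l; exists y; rewrite mem_head.
by have [_ _ _ _ [a0 a1 _]] := h y yys; move: a0 a1; clear; slia.
Qed.

Lemma tip_index v : v \in w -> tip v = (index v w == 0) || (index v w == (size w).-1).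
Proof.
move=> vw; have U : uniq w by case: hc => /ipath_uniq.
have s0 : 0 < size w by apply: leq_trans size_comb.
have s1 : (size w).-1 < size w by move: s0; clear; slia.
rewrite /tip -nth0 -nth_last !eq_nth_index //.
have -> : has (fun y => v == last y (leg y)) ys = false; last by rewrite orbF.
apply/negbTE/hasPn => y yys; apply: contraTneq vw => ->.
by apply: (leg_notin yys); apply/sub_rcons/last_in.
Qed.

Lemma tip_leg v y : y \in ys -> v \in leg y -> tip v = (v == last y (leg y)).
Proof.
move=> yys vl; have U : uniq w by case: hc => /ipath_uniq.
have s0 : 0 < size w by apply: leq_trans size_comb.
have nw : v \notin w by apply: (leg_notin yys); apply: sub_rcons.
have n1 i : i < size w -> v == nth v w i = false.
  by move=> iw; apply: contraNF nw => /eqP ->; apply: mem_nth.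
rewrite /tip -nth0 -nth_last !n1 //=; last by move: s0; clear; slia.
apply/hasP/eqP => [[z zys /eqP e]|e]; last by exists y => //; apply/eqP.
have vz : v \in leg z by rewrite e last_in.
by rewrite (in_leg_uniq yys zys (sub_rcons vl) (sub_rcons vz)).
Qed.

Lemma clique_nbr v : (forall u u', u \in H -> u' \in H -> v -- u -> v -- u' -> u != u' -> u -- u') ->
  clique (nbr v :&: H).
Proof.
move=> h; apply/forall_inP => u; rewrite !inE => /andP [vu uH]; apply/forall_inP => u'.
by rewrite !inE => /andP [vu' uH']; apply/implyP; apply: h; rewrite ?inE.
Qed.

Lemma not_clique_nbr v u u' : u \in H -> u' \in H -> v -- u -> v -- u' -> u != u' -> ~~ (u -- u') ->
  ~~ clique (nbr v :&: H).
Proof.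
move=> uH uH' vu vu' ne nuu; apply/negP => /forall_inP /(_ u); rewrite in_setI uH inE vu => /(_ isT).
by move/forall_inP => /(_ u'); rewrite in_setI uH' inE vu' => /(_ isT); rewrite ne (negbTE nuu).
Qed.

(** Any other vertex has two nonadjacent neighbours, its predecessor and successor on [w] or on its
    leg; for the head of a leg the predecessor is the vertex of [w] at position [a y]. The
    neighbours of a tip are a single vertex, or the two consecutive vertices of [w] below a
    triangular leg of one vertex. *)
Lemma tip_simplicial v : v \in H -> clique (nbr v :&: H) = tip v.
Proof.
case: (hc) => hw [n0 U] hleg ap mono vH; have Uw := ipath_uniq hw; have s2 := size_comb.
have wadj i j : i < size w -> j < size w -> nth v w i -- nth v w j = (j == i.+1) || (i == j.+1).
  by move=> h1 h2; rewrite (ipath_adj hw) ?mem_nth // !index_uniq.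
case/comb_setP: (vH) => [vw|[y yys vl]].
  have iv : index v w < size w by rewrite index_mem.
  rewrite tip_index //; apply/idP/idP => [cl|tp].
    apply: contraTT cl => /norP [v0 v1].
    have l1 : (index v w).-1 < size w by move: iv; clear; slia.
    have l2 : (index v w).+1 < size w by move: iv v1; clear; slia.
    have ev := nth_index v vw.
    apply: (@not_clique_nbr v (nth v w (index v w).-1) (nth v w (index v w).+1)).
    - by apply/w_sub/mem_nth.
    - by apply/w_sub/mem_nth.
    - by rewrite -{1}ev wadj //; move: v0; clear; slia.
    - by rewrite -{1}ev wadj //; clear; slia.
    - by rewrite nth_uniq //; clear; slia.
    - by rewrite wadj //; move: v0; clear; slia.
  apply: clique_nbr => u u' uH uH' vu vu'.
  have only z : z \in H -> v -- z -> z \in w.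
    case/comb_setP => // -[y yys zl] vz; move: vz; rewrite (leg_w yys vw (sub_rcons zl)) => /andP [_].
    have [_ _ _ _ [a0 a1 _]] := hleg y yys.
    by move: a0 a1 tp; case: (t); clear; slia.
  have uw := only u uH vu; have uw' := only u' uH' vu'.
  move: vu vu'; rewrite !(ipath_adj hw) //.
  have iu : index u w < size w by rewrite index_mem.
  have iu' : index u' w < size w by rewrite index_mem.
  move=> h1 h2 ne; have : index u w != index u' w.
    by apply: contraNneq ne => h; rewrite -(nth_index u uw) h nth_index.
  by move: h1 h2 tp iu iu'; clear; slia.
have hl := leg_ipath yys; have Ul := ipath_uniq hl; have iv : index v (leg y) < size (leg y) by rewrite index_mem.
have nvw := leg_notin yys (sub_rcons vl).
have [n1 ipr apw nhw [a0 a1 _]] := hleg y yys.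
have ladj i j : i < size (leg y) -> j < size (leg y) -> nth v (leg y) i -- nth v (leg y) j = (j == i.+1) || (i == j.+1).
  by move=> h1 h2; rewrite (ipath_adj hl) ?mem_nth // !index_uniq.
have elast : last y (leg y) = nth v (leg y) (size (leg y)).-1.
  by rewrite nth_last; case: (leg y) n1.
have ehead : head y (leg y) = nth v (leg y) 0 by rewrite nth0 head_leg.
have ev := nth_index v vl.
rewrite (tip_leg yys vl); apply/idP/idP => [cl|/eqP tp].
  apply: contraTT cl => ne.
  have l2 : (index v (leg y)).+1 < size (leg y).
    have : index v (leg y) != (size (leg y)).-1 by apply: contraNneq ne => h; rewrite elast -h ev.
    by move: iv; clear; slia.
  have [i0|i0] := eqVneq (index v (leg y)) 0.
    have aw : a y < size w by move: a1; clear; slia.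
    have evh : v = head y (leg y) by rewrite ehead -i0 ev.
    have n2 : nth v (leg y) (index v (leg y)).+1 \in rcons (leg y) y by apply/sub_rcons/mem_nth.
    have n3 : nth v w (a y) \in w by apply: mem_nth.
    apply: (@not_clique_nbr v (nth v w (a y)) (nth v (leg y) (index v (leg y)).+1)).
    - exact: w_sub.
    - by apply: (leg_sub yys); apply: mem_nth.
    - by rewrite sedge_sym (leg_w yys n3 (sub_rcons vl)) -evh eqxx index_uniq // eqxx.
    - by rewrite -{1}ev ladj //; clear; slia.
    - by apply: contraTneq n3 => ->; apply: (leg_notin yys).
    - have sl : 0 < size (leg y) by move: iv; clear; slia.
      by rewrite (leg_w yys n3 n2) ehead nth_uniq.
  have l1 : (index v (leg y)).-1 < size (leg y) by move: iv; clear; slia.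
  apply: (@not_clique_nbr v (nth v (leg y) (index v (leg y)).-1) (nth v (leg y) (index v (leg y)).+1)).
  - by apply: (leg_sub yys); apply: mem_nth.
  - by apply: (leg_sub yys); apply: mem_nth.
  - by rewrite -{1}ev ladj //; move: i0; clear; slia.
  - by rewrite -{1}ev ladj //; clear; slia.
  - by rewrite nth_uniq //; clear; slia.
  - by rewrite ladj //; move: i0; clear; slia.
have ivl : index v (leg y) = (size (leg y)).-1.
  by rewrite tp elast index_uniq //; move: iv; clear; slia.
apply: clique_nbr => u u' uH uH' vu vu' ne.
have only z : z \in H -> v -- z -> z \in w \/ z \in leg y.
  case/comb_setP => [|[x xys zl]]; [by left|right].
  have [<-//|xy] := eqVneq x y; have := ap x y xys yys xy z v (sub_rcons zl) (sub_rcons vl).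
  by rewrite sedge_sym H0 andbF.
have inw z : z \in w -> v -- z -> [/\ v = head y (leg y), (size (leg y)).-1 = 0 & (index z w == a y) || t && (index z w == (a y).+1)].
  move=> zw; rewrite sedge_sym (leg_w yys zw (sub_rcons vl)) => /andP [/eqP e h]; split=> //.
  by rewrite -ivl e ehead index_uniq //; case: (leg y) n1.
have inl z : z \in leg y -> v -- z -> index z (leg y) = (size (leg y)).-2 /\ 1 < size (leg y).
  move=> zl; have iz : index z (leg y) < size (leg y) by rewrite index_mem.
  by rewrite (ipath_adj hl) // ivl; move: iz; clear; slia.
case: (only u uH vu) => hu; case: (only u' uH' vu') => hu'.
- have [_ _ h1] := inw u hu vu; have [_ _ h2] := inw u' hu' vu'.
  rewrite (ipath_adj hw) //; have : index u w != index u' w.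
    by apply: contraNneq ne => h; rewrite -(nth_index u hu) h nth_index.
  by move: h1 h2; case: (t); clear; slia.
- by have [_ s1 _] := inw u hu vu; have [_ s3] := inl u' hu' vu'; move: s1 s3; clear; slia.
- by have [_ s1 _] := inw u' hu' vu'; have [_ s3] := inl u hu vu; move: s1 s3; clear; slia.
- have [h1 _] := inl u hu vu; have [h2 _] := inl u' hu' vu'.
  by case/eqP: ne; rewrite -(nth_index u hu) h1 -h2 nth_index.
Qed.

Variables (y1 yk : G).
Let X := [set:: y1 :: rcons ys yk].
Hypothesis hy1 : forall v, v \in H -> (y1 != v) && (y1 -- v == (v == head v w)).
Hypothesis hyk : forall v, v \in H -> (yk != v) && (yk -- v == (v == last v w)).

Lemma hys y v : y \in ys -> v \in H -> (y != v) && (y -- v == (v == last y (leg y))).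
Proof.
case: (hc) => _ _ hleg ap _ yys; have [n0 ip apw _ _] := hleg y yys.
have yr : y \in rcons (leg y) y by rewrite mem_rcons mem_head.
have yb : y \in behead (rcons (leg y) y) by case: (leg y) n0 => // e l _; rewrite /= mem_rcons mem_head.
have lastw u : u \in w -> u == last y (leg y) = false.
  move=> uw; apply: contraTF uw => /eqP ->; apply: (leg_notin yys); apply/sub_rcons/last_in => //.
case/comb_setP => [vw|[z zys vl]].
  by have /andP [-> /negbTE ->] := apw y v yb vw; rewrite lastw.
have [zy|zy] := eqVneq z y.
  rewrite zy in vl; rewrite leg_y // eqxx andbT.
  apply: contraTneq vl => <-; have := ipath_uniq ip; rewrite rcons_uniq.
  by case/andP.
have yz : y != z by rewrite eq_sym.
have /andP [-> /negbTE ->] := ap y z yys zys yz y v yr (sub_rcons vl).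
apply/eqP/esym; apply: contraTF vl => /eqP ->; apply/negP => h.
by case/eqP: zy; apply/esym; apply: (in_leg_uniq yys zys (sub_rcons (last_in yys)) (sub_rcons h)).
Qed.

Lemma comb_attached : attached H X.
Proof.
have [x0 x0w] : exists x0, x0 \in w by have := size_comb; case: (w) => // x0 l _; exists x0; rewrite mem_head.
have s0 : 0 < size w by apply: leq_trans size_comb.
have XE y : y \in X -> exists2 l, l \in H & forall v, v \in H -> (y != v) && (y -- v == (v == l)).
  rewrite inE inE mem_rcons inE => /or3P [/eqP ->|/eqP ->|yys].
  - exists (head x0 w); first by rewrite -nth0; apply/w_sub/mem_nth.
    by move=> v vH; have := hy1 vH; case: (w) x0w.
  - exists (last x0 w); first by rewrite -nth_last; apply/w_sub/mem_nth; move: s0; clear; slia.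
    by move=> v vH; have := hyk vH; case: (w) x0w.
  - by exists (last y (leg y)); [apply: (leg_sub yys); apply: last_in|move=> v; apply: hys].
have XH y : y \in X -> y \notin H.
  by move=> /XE [l _ h]; apply/negP => /h; rewrite eqxx.
split.
- by apply/pred0P => v /=; apply/negP => /andP [/XH /negbTE ->].
- move=> y /XE [l lH h]; apply/eqP/cards1P; exists l; apply/setP => v; rewrite in_setI in_set1 inE.
  have [vH|vH] := boolP (v \in H); rewrite ?andbT ?andbF.
    by case/andP: (h v vH) => _ /eqP.
  by apply/esym; apply: contraNF vH => /eqP ->.
apply/setP => v; rewrite !in_setI.
have [vH|vH] := boolP (v \in H); last by rewrite [RHS]inE (negbTE vH).
rewrite [RHS]inE vH tip_simplicial // [LHS]/= inE.
have -> : v \notin X by apply: contraL vH; apply: XH.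
apply/exists_inP/idP => /= [[y yX yv]|].
  move: yX; rewrite inE inE mem_rcons inE => /or3P [/eqP e|/eqP e|yys].
  - by rewrite e in yv; have /andP [_ /eqP] := hy1 vH; rewrite yv /tip => <-.
  - by rewrite e in yv; have /andP [_ /eqP] := hyk vH; rewrite yv /tip => <-; rewrite orbT.
  - have /andP [_ /eqP] := hys yys vH; rewrite yv => /esym e; rewrite /tip.
    by apply/or3P/Or33/hasP; exists y.
case/or3P => [h|h|/hasP [y yys h]].
- exists y1; first by rewrite inE mem_head.
  by have /andP [_ /eqP ->] := hy1 vH.
- exists yk; first by rewrite inE inE mem_rcons mem_head orbT.
  by have /andP [_ /eqP ->] := hyk vH.
- exists y; first by rewrite inE inE mem_rcons inE yys !orbT.
  by have /andP [_ /eqP ->] := hys yys vH.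
Qed.

(** The heads of the legs serve as the vertices x_i. A leg is a component of what remains without
    [w], being connected and anticomplete to the other legs. *)
Lemma comb_order : uniq (y1 :: rcons ys yk) -> connectifier_order H X w (y1 :: rcons ys yk).
Proof.
case: (hc) => hw [n0 U] hleg ap mono Us.
have Uw := ipath_uniq hw.
pose e y := head y (leg y).
have ein y : y \in ys -> e y \in leg y by apply: head_in.
have HP v : (v \in H :\: [set:: w]) = has (fun y => v \in leg y) ys.
  rewrite in_setD inE; apply/andP/hasP => [[vw /comb_setP [vw'|[y yys vl]]]|[y yys vl]].
  - by rewrite vw' in vw.
  - by exists y.
  - by split; [apply: (leg_notin yys); apply: sub_rcons|apply: (leg_sub yys)].
have [x0 x0w] : exists x0, x0 \in w by have := size_comb; case: (w) => // x0 l _; exists x0; rewrite mem_head.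
have s0 : 0 < size w by apply: leq_trans size_comb.
exists y1, yk, ys, (map e ys); split.
- by split; rewrite ?size_map.
- by split=> // v; rewrite [RHS]inE.
- split.
    rewrite map_inj_in_uniq // => y z yys zys eyz.
    apply: (in_leg_uniq yys zys (sub_rcons (ein y yys))); rewrite eyz; exact: (sub_rcons (ein z zys)).
  move=> v; rewrite HP; apply/mapP/andP => [[y yys ->]|[/hasP [y yys vl] /exists_inP [u uw vu]]].
    have [_ _ _ _ [a0 a1 _]] := hleg y yys; split; first by apply/hasP; exists y => //; apply: ein.
    have aw : a y < size w by move: a1; clear; slia.
    apply/exists_inP; exists (nth x0 w (a y)); first exact: mem_nth.
    by rewrite sedge_sym (leg_w yys (mem_nth _ aw) (sub_rcons (ein y yys))) eqxx index_uniq ?eqxx.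
  by exists y => //; move: vu; rewrite sedge_sym (leg_w yys uw (sub_rcons vl)) => /andP [/eqP].
- move=> z0 i j ij; rewrite size_map => js u v uw vw.
  have is_ := ltn_trans ij js.
  have iy : nth x0 ys i \in ys by apply: mem_nth.
  have jy : nth x0 ys j \in ys by apply: mem_nth.
  rewrite !(nth_map x0) // => g1 g2; rewrite sedge_sym in g1; rewrite sedge_sym in g2.
  rewrite (leg_w iy uw (sub_rcons (ein _ iy))) in g1; rewrite (leg_w jy vw (sub_rcons (ein _ jy))) in g2.
  case/andP: g1 => _ h1; case/andP: g2 => _ h2; have := mono x0 i j ij js.
  by move: h1 h2; case: (t); clear; slia.
- have m1 : head y1 w \in H by rewrite -nth0; apply/w_sub/mem_nth.
  have m2 : last yk w \in H by rewrite -nth_last; apply/w_sub/mem_nth; move: s0; clear; slia.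
  have e1 : head y1 w = head (head y1 w) w by case: (w) x0w.
  have e2 : last yk w = last (last yk w) w by case: (w) x0w.
  have e3 : head yk w = head y1 w by case: (w) x0w.
  split.
    split; first by have /andP [_ /eqP h] := hy1 m1; rewrite h -e1.
    by have /andP [_ /eqP h] := hyk m2; rewrite h -e2.
  move=> z0 i; rewrite size_map => is_; pose y := nth z0 ys i.
  have yys : y \in ys by apply: mem_nth.
  have hl := leg_ipath yys.
  have eA : e y \in H :\: [set:: w] by rewrite HP; apply/hasP; exists y => //; apply: ein.
  exists [set:: leg y]; split.
  + exists (e y) => //; apply/setP => v; rewrite !inE.
    apply/idP/idP => [vl|].
      have vA : forall u, u \in leg y -> u \in H :\: [set:: w].
        by move=> u ul; rewrite HP; apply/hasP; exists y.
      by apply: (ipath_connected hl) => //; [apply: ein|move=> u ul _; apply: vA].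
    case/connectP => p; elim/last_ind: p v => [|p u IH] v /=; first by move=> _ ->; apply: ein.
    rewrite rcons_path last_rcons => /andP [hp /and3P [lA uA lu]] ->.
    have ll := IH _ hp erefl.
    move: uA; rewrite HP => /hasP [z zys uz].
    have [<-//|zy] := eqVneq z y.
    by have := ap z y zys yys zy u _ (sub_rcons uz) (sub_rcons ll); rewrite sedge_sym lu andbF.
  + by rewrite (nth_map z0) // inE; apply: ein.
  + exists (last y (leg y)); first by rewrite inE last_in.
    rewrite -/y leg_y ?last_in ?eqxx //.
Qed.

End Facts.

End Combs.

(** * Combs as caterpillars and as line graphs of caterpillars *)

Section Connectifiers.
Variable G : sgraph.
Implicit Types (u v x y z c e p q : G) (r s : seq G) (X : {set G}).
Variables (w ys : seq G) (leg : G -> seq G) (a : G -> nat).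
Let H := comb_set w ys leg.

Lemma apart_restr (p q : seq G) : {subset p <= H} -> {subset q <= H} -> apart p q -> apart (restr H p) (restr H q).
Proof. by move=> sp sq ap u v; rewrite !mem_restr => up vq; have := ap _ _ up vq. Qed.

Lemma comb_caterpillar_spine : comb false w ys leg a ->
  caterpillar (induced H) /\ spiky_spine H w.
Proof.
move=> hc; have [hw [n0 U] hleg ap mono] := hc.
have [y0 y0ys] : exists y, y \in ys by case: (ys) n0 => // y l; exists y; rewrite mem_head.
have sw := @w_sub _ w ys leg : {subset w <= H}.
have sl y (yys : y \in ys) := @leg_sub _ w ys leg y yys : {subset leg y <= H}.
have [||||||||cat sp] := @comb_caterpillar (induced H) G y0 ys (restr H w) (fun y => restr H (leg y)) a.
- exact: ipath_restr.
- move=> v; have /comb_setP [vw|[y yys vl]] := valP v; [left|right; exists y => //]; by rewrite mem_restr.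
- by [].
- move=> y yys; split; first by apply: ipath_restr; [exact: sl|exact: (leg_ipath hc)].
  by move=> u; rewrite !mem_restr => ul; apply: (leg_notin hc yys); apply: sub_rcons.
- move=> y z yys zys yz; apply: apart_restr; [exact: sl|exact: sl|].
  by apply: apart_sub (ap y z yys zys yz); apply: sub_rcons.
- move=> y yys; have [_ _ _ _ [a0 a1 _]] := hleg y yys; rewrite size_restr //.
  by split=> //; move: a1; clear; lia.
- exact: (a_inj hc).
- move=> y u v yys; rewrite !mem_restr => uw vl.
  rewrite -[u -- v]/(val u -- val v) (leg_w hc yys uw (sub_rcons vl)) orbF andbC index_restr //; congr (_ && _).
  have [n1 _ _ _ _] := hleg y yys.
  by rewrite -(inj_eq val_inj) (@head_restr _ _ _ _ y) //; exact: sl.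
split=> //; exists (restr H w) => //.
by rewrite -{1}(map_restr sw).
Qed.

(* The edges of the tree [C] below are the vertices of [H]: deleting from [H] the
   edge between a tooth and the second of its two neighbours in [w] leaves a tree,
   which is rooted by a new vertex joined to the beginning of [w], and [v] stands
   for the edge from [v] to its parent. *)
Definition cut_edge u v := has (fun y =>
  (u == head y (leg y)) && (index v w == (a y).+1) ||
  (v == head y (leg y)) && (index u w == (a y).+1)) ys.

Definition cut_rel (b c : option (induced H)) := match b, c with
  | Some u, Some v => (val u -- val v) && ~~ cut_edge (val u) (val v)
  | None, Some v => index (val v) w == 0
  | Some v, None => index (val v) w == 0
  | None, None => false
  end.

Lemma cut_sym : symmetric cut_rel.
Proof.
case=> [u|] [v|] //=; rewrite sedge_sym; congr (_ && ~~ _).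
by apply: eq_has => y; rewrite orbC.
Qed.

Lemma cut_irrefl : irreflexive cut_rel.
Proof. by case=> [u|] //=; rewrite sedge_irrefl. Qed.

Definition cut_graph : sgraph := SGraph cut_sym cut_irrefl.

(** Two edges of the tree meet if one of [u], [v] is the parent of the other, or if the two have the
    same parent. The first case gives the edges of [H] that were kept; by [siblings] the second
    gives exactly those that were cut. Hence edges meet precisely when the vertices they stand for
    are adjacent. *)
Lemma comb_line_caterpillar : comb true w ys leg a ->
  (exists (C : sgraph) (f : line_graph C -> induced H), caterpillar_line_iso f) /\
  triangular_spine H w.
Proof.
move=> hc; have [hw [n0 U] hleg ap mono] := hc.
have [y0 y0ys] : exists y, y \in ys by case: (ys) n0 => // y l; exists y; rewrite mem_head.
have sw := @w_sub _ w ys leg : {subset w <= H}.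
have sl y (yys : y \in ys) := @leg_sub _ w ys leg y yys : {subset leg y <= H}.
pose w' : seq cut_graph := None :: map Some (restr H w).
pose leg' y : seq cut_graph := map Some (restr H (leg y)).
(* The root [None] in front of [w] shifts all positions by one. *)
pose a' y := (a y).+1.
have s2 := size_comb hc.
have insw' (v : induced H) : ((Some v : cut_graph) \in w') = (val v \in w).
  by rewrite inE /= mem_map ?mem_restr // => ? ? [].
have inl' (v : induced H) y : ((Some v : cut_graph) \in leg' y) = (val v \in leg y).
  by rewrite mem_map ?mem_restr // => ? ? [].
have nol' y : (None : cut_graph) \notin leg' y by apply/negP => /mapP [].
have idx' (v : induced H) : index (Some v : cut_graph) w' = (index (val v) w).+1.
  by rewrite /w' /= index_map ?index_restr // => ? ? [].
have nocut_w u v : u \in w -> v \in w -> cut_edge u v = false.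
  move=> uw vw; apply/hasPn => y yys; have nh := leg_notin hc yys (sub_rcons (head_in hc yys)).
  by rewrite negb_or !negb_and; apply/andP; split; apply/orP; left; [apply: contraNneq nh => <-|apply: contraNneq nh => <-].
have nocut_l u v y : y \in ys -> u \in leg y -> v \in leg y -> cut_edge u v = false.
  move=> yys ul vl; have uw := leg_notin hc yys (sub_rcons ul); have vw := leg_notin hc yys (sub_rcons vl).
  apply/hasPn => z zys; have [_ _ _ _ [_ a1 _]] := hleg z zys.
  have out x : x \notin w -> index x w == (a z).+1 = false.
    by rewrite -index_mem -leqNgt => h; move: h a1; clear; slia.
  by rewrite !out // !andbF.
have hw' : ipath w'.
  have n1 : map Some (restr H w) != [::] :> seq cut_graph.
    by rewrite -size_eq0 size_map size_restr // -lt0n; apply: leq_trans s2.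
  apply/ipath_consP => //; split.
  - by apply/negP => /mapP [].
  - apply/(@ipath_map (induced H) cut_graph Some) => [? ? [] //|u v|]; last exact: ipath_restr.
    rewrite !mem_restr => uw vw; rewrite -[LHS]/((val u -- val v) && ~~ cut_edge (val u) (val v)).
    by rewrite nocut_w // andbT.
  - case=> [v|] /mapP [u ul] // [->]; rewrite mem_restr in ul.
    rewrite -[LHS]/(index (val u) w == 0).
    have ew : val u = nth (val u) w (index (val u) w) by rewrite nth_index.
    have s0 : 0 < size w by apply: leq_trans s2.
    have -> : head (None : cut_graph) (map Some (restr H w)) = Some (nth u (restr H w) 0).
      by move: n1; case: (restr H w).
    rewrite -[RHS]/(u == nth u (restr H w) 0) -(inj_eq val_inj) (nth_restr _ (val u)) //.
    by rewrite eq_nth_index ?(ipath_uniq hw).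
have cover' (v : cut_graph) : v \in w' \/ exists2 y, y \in ys & v \in leg' y.
  case: v => [v|]; last by left; rewrite inE.
  have /comb_setP [vw|[y yys vl]] := valP v; [left|right; exists y => //]; by rewrite ?insw' ?inl'.
have hleg' y : y \in ys -> ipath (leg' y) /\ forall u : cut_graph, u \in leg' y -> u \notin w'.
  move=> yys; split; last first.
    case=> [u|]; last by rewrite (negbTE (nol' y)).
    by rewrite inl' insw' => ul; apply: (leg_notin hc yys); apply: sub_rcons.
  apply/(@ipath_map (induced H) cut_graph Some) => [? ? [] //|u v|]; last first.
    by apply: ipath_restr; [exact: sl|exact: (leg_ipath hc)].
  rewrite !mem_restr => ul vl; rewrite -[LHS]/((val u -- val v) && ~~ cut_edge (val u) (val v)).
  by rewrite (nocut_l _ _ y) // andbT.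
have apl' : {in ys &, forall y z, y != z -> apart (leg' y) (leg' z)}.
  move=> y z yys zys yz [u|] [v|]; rewrite ?(negbTE (nol' _)) // !inl' => ul vl.
  have /andP [h1 /negbTE h2] := ap y z yys zys yz _ _ (sub_rcons ul) (sub_rcons vl).
  rewrite -[X in _ && ~~ X]/((val u -- val v) && _) h2 andbT.
  by apply: contraNneq h1 => -[->].
have sw' : size w' = (size w).+1 by rewrite /= size_map size_restr.
have ha' y : y \in ys -> 0 < a' y /\ (a' y).+1 < size w'.
  move=> yys; have [_ _ _ _ [a0 a1 _]] := hleg y yys; rewrite sw' /a'.
  by split=> //; move: a1; clear; slia.
have inja' : {in ys &, injective a'} by move=> y z yys zys [] /(a_inj hc yys zys).
have head' y (v : induced H) : y \in ys -> ((Some v : cut_graph) == head (Some v : cut_graph) (leg' y)) = (val v == head y (leg y)).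
  move=> yys; have [n1 _ _ _ _] := hleg y yys.
  have -> : head (Some v : cut_graph) (leg' y) = Some (head v (restr H (leg y))) by rewrite /leg'; case: (restr _ _).
  rewrite -[LHS]/(v == head v (restr H (leg y))) -(inj_eq val_inj) (@head_restr _ _ _ _ y) //; exact: sl.
(* After the cut a tooth sees only the first of its two neighbours on [w], as a comb requires. *)
have hadj' y (u v : cut_graph) : y \in ys -> u \in w' -> v \in leg' y ->
    u -- v = (index u w' == a' y) && (v == head v (leg' y)).
  move=> yys; case: v => [v|]; last by rewrite (negbTE (nol' y)).
  rewrite inl' head' // => uw vl; have nv := leg_notin hc yys (sub_rcons vl).
  have [_ _ _ _ [a0 a1 _]] := hleg y yys.
  case: u uw => [u|] uw.
    rewrite insw' in uw; rewrite idx' /a' eqSS.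
    rewrite -[LHS]/((val u -- val v) && ~~ cut_edge (val u) (val v)).
    rewrite (leg_w hc yys uw (sub_rcons vl)) /=.
    have [ev|] := eqVneq (val v) (head y (leg y)); rewrite /= ?andbF // andbT.
    have -> : cut_edge (val u) (val v) = (index (val u) w == (a y).+1).
      apply/hasP/idP => [[z zys]|h]; last by exists y; rewrite // ev eqxx h orbT.
      have nu : (val u == head z (leg z)) = false.
        by apply: contraTF uw => /eqP ->; apply: (leg_notin hc zys); apply/sub_rcons/(head_in hc).
      rewrite nu /= => /andP [/eqP ez]; have vz : val v \in leg z by have := head_in hc zys; rewrite -ez.
      by rewrite (in_leg_uniq hc yys zys (sub_rcons vl) (sub_rcons vz)).
    by rewrite -[val u]/(sval u); move: (index _ w) => i; clear; lia.
  rewrite -[LHS]/(index (val v) w == 0) /a' [RHS]/=; apply/negbTE; rewrite -lt0n.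
  apply: (@leq_trans (size w)); first exact: ltnW (ltnW s2).
  by rewrite leqNgt index_mem.
have [cat sp] := comb_caterpillar hw' cover' y0ys hleg' apl' ha' inja' hadj'.
pose par (v : induced H) : cut_graph := parent y0 ys w' leg' a' (Some v).
have i0 (v : induced H) : index (Some v : cut_graph) w' != 0 by rewrite idx'.
have pe (v : induced H) := parent_edge y0 hw' cover' hleg' apl' ha' hadj' (i0 v).
have pedge (v : induced H) : [set (Some v : cut_graph); par v] \in edges cut_graph.
  rewrite inE; apply/existsP; exists (Some v : cut_graph); apply/existsP; exists (par v).
  by rewrite eqxx andbT sedge_sym (pe v).1.
(* The edge from [v] to its parent. Each edge arises from its lower end, which is never the root. *)
pose g (v : induced H) : line_graph cut_graph := exist (fun E : {set cut_graph} => E \in edges cut_graph) _ (pedge v).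
have Esub (E E' : line_graph cut_graph) : sval E = sval E' -> E = E' by apply: val_inj.
have ginj : injective g.
  move=> u v /(congr1 sval) /= e; apply/eqP; apply: contraT => uv.
  have h1 : (Some u : cut_graph) \in [set (Some v : cut_graph); par v] by rewrite -e !inE eqxx.
  have h2 : (Some v : cut_graph) \in [set (Some u : cut_graph); par u] by rewrite e !inE eqxx.
  case/set2P: h1 => [[euv]|h1]; first by rewrite euv eqxx in uv.
  case/set2P: h2 => [[euv]|h2]; first by rewrite euv eqxx in uv.
  have [_ l1] := pe u; have [_ l2] := pe v.
  rewrite -/(par u) -h2 in l1; rewrite -/(par v) -h1 in l2.
  by move: l1 l2; clear; lia.
have ex (E : line_graph cut_graph) : exists v : induced H, g v = E.
  have := svalP E; rewrite inE => /existsP [u /existsP [v /andP [uv /eqP eE]]].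
  have nz (x y : cut_graph) : x = parent y0 ys w' leg' a' y -> rank y0 ys w' leg' x < rank y0 ys w' leg' y ->
      sval E = [set x; y] -> exists v0 : induced H, g v0 = E.
    move=> ex; case: y ex => [y|] ex lt ee; last by [].
    by exists y; apply: Esub => /=; rewrite ee setUC ex.
  case: (comb_adj y0 hw' cover' hleg' apl' hadj' uv) => [[e lt]|[e lt]]; first exact: (nz u v).
  by apply: (nz v u) => //; rewrite setUC.
have [f gf] := fin_all_exists ex.
have fg : cancel g f by move=> v; apply: ginj; rewrite gf.
have fbij : bijective f by exists g.
have gadj (u v : induced H) : g u -- g v = u -- v.
  rewrite -[LHS]/((g u != g v) && ([set (Some u : cut_graph); par u] :&: [set (Some v : cut_graph); par v] != set0)).
  have adjp (x y : induced H) : (Some x : cut_graph) = par y -> x -- y.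
    move=> e; have [h _] := pe y; rewrite -/(par y) -e in h.
    by move: h => /andP [].
  apply/andP/idP => [[ne /set0Pn [c]]|uv].
    rewrite !inE => /andP [/orP [] /eqP -> /orP [] /eqP e].
    - by case: e ne => ->; rewrite eqxx.
    - exact: adjp.
    - by rewrite sedge_sym; apply: adjp.
    - have uv' : (Some u : cut_graph) != Some v by apply: contraNneq ne => -[->].
      have [j jys] := siblings hw' cover' hleg' apl' ha' inja' (i0 u) (i0 v) uv' e.
      have key (x y : induced H) : (Some x : cut_graph) = head (Some x : cut_graph) (leg' j) -> val y \in w -> index (Some y : cut_graph) w' = (a' j).+1 -> val x -- val y.
        move=> ex' yw; rewrite idx' /a' => -[iy].
        have /eqP e2 : val x == head j (leg j) by rewrite -head' // -ex'.
        have xl : val x \in leg j by rewrite e2 (head_in hc).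
        by rewrite sedge_sym (leg_w hc jys yw (sub_rcons xl)) e2 eqxx iy eqxx orbT.
      case=> [[h1 [h2 h3]]|[h1 [h2 h3]]]; first by apply: key => //; rewrite -insw'.
      by rewrite sedge_sym; apply: key => //; rewrite -insw'.
  have nuv : u != v by apply: edge_neq.
  split; first by rewrite (inj_eq ginj).
  have cutcase (x y : induced H) z : z \in ys -> val x == head z (leg z) -> index (val y) w == (a z).+1 ->
      par x = par y.
    move=> zys /eqP ex' /eqP iy.
    have yw : val y \in w by have [_ _ _ _ [_ a1 _]] := hleg z zys; rewrite -index_mem iy; move: a1; clear; slia.
    have xl : (Some x : cut_graph) \in leg' z by rewrite inl' ex' (head_in hc).
    have exh : (Some x : cut_graph) = head (Some x : cut_graph) (leg' z) by apply/eqP; rewrite head' // ex'.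
    rewrite /par (parent_head y0 a' hleg' apl' zys xl exh) /parent insw' yw idx' iy /=.
    by apply: set_nth_default; apply: ltnW; exact: (ha' z zys).2.
  have [cut|ncut] := boolP (cut_edge (val u) (val v)).
    apply/set0Pn; exists (par u); rewrite !inE eqxx orbT /=.
    case/hasP: cut => z zys /orP [] /andP [h1 h2].
      by rewrite (cutcase u v z) // eqxx orbT.
    by rewrite (cutcase v u z) // eqxx orbT.
  have cuv : (Some u : cut_graph) -- (Some v : cut_graph).
    by apply/andP; split; [exact: uv|exact: ncut].
  case: (comb_adj y0 hw' cover' hleg' apl' hadj' cuv) => [[e _]|[e _]]; apply/set0Pn.
    by exists (Some u : cut_graph); apply/setIP; split; [exact: set21|rewrite /par -e; exact: set22].
  by exists (Some v : cut_graph); apply/setIP; split; [rewrite /par -e; exact: set22|exact: set21].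
have iso : caterpillar_line_iso f.
  split=> //; split=> // E E'.
  by rewrite -{2}(gf E) -{2}(gf E') gadj.
split; first by exists cut_graph, f.
exists cut_graph, f, w'; split=> // v; split.
  move=> vw; pose v' : induced H := exist (fun v : G => v \in H) v (sw v vw).
  exists (g v'); last by rewrite fg.
  apply/subsetP => b; rewrite -[ends_of _]/([set (Some v' : cut_graph); par v']) => /set2P [] ->.
    by rewrite insw'.
  rewrite /par /parent insw' vw; apply: mem_nth.
  by rewrite idx' sw' [_.-1]/= ltnS ltnW // index_mem.
case=> E sE ->; have := gf E => e; rewrite -insw'; apply: (subsetP sE).
have -> : ends_of E = [set (Some (f E) : cut_graph); par (f E)] by rewrite -[in LHS]e.
exact: set21.
Qed.

End Connectifiers.

Lemma infix2 (T : eqType) (p : seq T) (x y : T) : uniq p ->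
  infix [:: x; y] p = [&& x \in p, y \in p & index y p == (index x p).+1].
Proof.
move=> U; apply/infixP/and3P => [[s1 [s2 e]]|[xp yp /eqP e]].
  have xin : x \in p by rewrite e mem_cat mem_head orbT.
  have yin : y \in p by rewrite e mem_cat !inE eqxx !orbT.
  split=> //; move: U; rewrite e cat_uniq => /and3P [_ /hasPn h /andP [n3 _]].
  have n1 : x \notin s1 by apply: h; rewrite mem_head.
  have n2 : y \notin s1 by apply: h; rewrite !inE eqxx orbT.
  have n4 : x != y by apply: contraNneq n3 => ->; rewrite mem_head.
  by rewrite !index_cat (negbTE n1) (negbTE n2) /= !inE !eqxx orbT (negbTE n4) /=; clear; lia.
exists (take (index x p) p), (drop (index y p).+1 p).
have ix : index x p < size p by rewrite index_mem.
have iy : index y p < size p by rewrite index_mem.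
rewrite -{1}(cat_take_drop (index x p) p); congr (_ ++ _).
by rewrite (drop_nth x ix) -e (drop_nth x iy) !nth_index.
Qed.

(** * Subdivided stars *)

Section Stars.
Variable G : sgraph.
Implicit Types (u v x y z c e : G) (p r s : seq G) (H X D : {set G}).
Variables (D : {set G}) (c : G) (leg : G -> seq G) (s : seq G).
Hypotheses (Us : uniq s) (s3 : 3 <= size s) (sD : forall y, y \in s -> y \notin D).
Let X := [set:: s].

Lemma star_single : star_in D c leg X true -> stellar_connectifier [set c] X.
Proof.
case=> cD hS ap.
have cy y : y \in s -> y -- c.
  move=> ys; have [_ hp e] := hS y ltac:(by rewrite inE).
  move/eqP: e hp => -> /= /(@ipath_consP _ c [:: y] isT) [_ _ h].
  by rewrite sedge_sym h ?mem_head //= eqxx.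
have [y0 y0s] : exists y, y \in s by case: (s) s3 => // y l; exists y; rewrite mem_head.
have cs : c \notin s by apply/negP => /sD; rewrite cD.
split; first by right; rewrite cards1.
split.
- by rewrite disjoint_sym disjoints1 inE.
- move=> y; rewrite inE => ys; apply/eqP/cards1P; exists c; apply/setP => v; rewrite !inE.
  by case: eqVneq => [->|]; rewrite ?andbF // andbT cy.
apply/setP => v; rewrite !inE; case: eqVneq => [->|] //=.
rewrite cs; apply/esym/idP; have -> : [exists u in [set:: s], u -- c].
  by apply/exists_inP; exists y0; rewrite ?inE ?cy.
apply/eqP/eqP; apply/forall_inP => u; rewrite !inE => /andP [cu /eqP e].
by move: cu; rewrite e sedge_irrefl.
Qed.

Definition star_set : {set G} := [set v | (v == c) || has (fun y => v \in leg y) s].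
Let H := star_set.
Hypothesis hs : star_in D c leg X false.

Lemma star_setP v : reflect (v = c \/ exists2 y, y \in s & v \in leg y) (v \in H).
Proof.
rewrite inE; apply: (iffP orP) => -[h|]; auto.
- by left; apply/eqP.
- by case/hasP => y ys h; right; exists y.
- by left; apply/eqP.
- by case=> y ys h; right; apply/hasP; exists y.
Qed.

Lemma star_leg y : y \in s ->
  [/\ {subset leg y <= D}, ipath (c :: rcons (leg y) y), leg y != [::] & ipath (c :: leg y)].
Proof.
move=> ys; case: hs => cD h ap; have [h1 h2 h3] := h y ltac:(by rewrite inE).
split=> //; first by apply/negbT.
by apply: (@ipath_catl _ (c :: leg y) [:: y]); rewrite // /= cats1.
Qed.

Lemma star_apart y z : y \in s -> z \in s -> y != z -> apart (rcons (leg y) y) (rcons (leg z) z).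
Proof. by case: hs => _ _ ap ys zs; apply: ap; rewrite inE. Qed.

Lemma in_star_leg y z v : y \in s -> z \in s -> v \in leg y -> v \in leg z -> y = z.
Proof.
move=> ys zs vy vz; apply/eqP; apply: contraT => ne.
by have := star_apart ys zs ne (sub_rcons vy) (sub_rcons vz); rewrite eqxx.
Qed.

Lemma centre_notin y : y \in s -> c \notin rcons (leg y) y.
Proof. by case/star_leg => _ /ipath_uniq /andP []. Qed.

Lemma star_H_sub : H \subset D.
Proof.
apply/subsetP => v /star_setP [->|[y ys vl]]; first by case: hs.
by have [h _ _ _] := star_leg ys; apply: h.
Qed.

Lemma star_sub_H y : y \in s -> {subset c :: leg y <= H}.
Proof.
move=> ys v; rewrite inE => /orP [/eqP ->|vl]; apply/star_setP; first by left.
by right; exists y.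
Qed.

Lemma star_edge u v : u \in H -> v \in H -> u -- v ->
  exists y, [/\ y \in s, u \in c :: leg y & v \in c :: leg y].
Proof.
case/star_setP => [->|[y ys ul]]; case/star_setP => [->|[z zs vl]] uv.
- by rewrite sedge_irrefl in uv.
- by exists z; rewrite !inE eqxx vl orbT.
- by exists y; rewrite !inE eqxx ul orbT.
exists y; rewrite !inE ul orbT; split=> //.
have [->|ne] := eqVneq y z; first by rewrite vl orbT.
by have := star_apart ys zs ne (sub_rcons ul) (sub_rcons vl); rewrite uv andbF.
Qed.

(** The i-th leaf goes to the last vertex of the i-th leg, and the rest of the leg consists of
    subdivision vertices. *)
Lemma star_subdivided : subdivided_star (induced H).
Proof.
have [y0 y0s] : exists y, y \in s by case: (s) s3 => // y l; exists y; rewrite mem_head.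
exists (size s) => //.
have cH : c \in H by apply/star_setP; left.
pose c0 : induced H := exist (fun v : G => v \in H) c cH.
pose y_ (i : 'I_(size s)) := nth y0 s i.
have ys i : y_ i \in s by apply: mem_nth.
have yinj i j : y_ i = y_ j -> i = j by move/eqP; rewrite nth_uniq // => /eqP /val_inj.
have sH y : y \in s -> {subset leg y <= H} by move=> yin v vl; apply: (star_sub_H yin); rewrite inE vl orbT.
pose f (o : star (size s)) : induced H := if o is Some i then last c0 (restr H (leg (y_ i))) else c0.
pose int i : seq (induced H) := take (size (leg (y_ i))).-1 (restr H (leg (y_ i))).
pose P (a b : star (size s)) : seq (induced H) := match a, b with
  | None, Some i => int i | Some i, None => rev (int i) | _, _ => [::] end.
have legE i : restr H (leg (y_ i)) = rcons (int i) (f (Some i)).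
  have [_ _ n1 _] := star_leg (ys i); have sz : 0 < size (leg (y_ i)) by rewrite lt0n size_eq0.
  have szr := size_restr (sH _ (ys i)).
  rewrite /int /f -{1}(take_size (restr H (leg (y_ i)))) szr -{1}(prednK sz) (take_nth c0) ?szr ?prednK //.
  by congr rcons; rewrite -nth_last szr.
have rc i : restr H (c :: leg (y_ i)) = c0 :: restr H (leg (y_ i)).
  by rewrite /restr /= insubT.
have QE i : f None :: rcons (int i) (f (Some i)) = restr H (c :: leg (y_ i)) by rewrite rc legE.
have QR i : f (Some i) :: rcons (rev (int i)) (f None) = rev (restr H (c :: leg (y_ i))).
  by rewrite -QE rev_cons rev_rcons rcons_cons.
have ipQ i : ipath (restr H (c :: leg (y_ i))).
  by apply: ipath_restr; [exact: star_sub_H|have [] := star_leg (ys i)].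
have inl i (v : induced H) : v \in int i -> val v \in leg (y_ i).
  by move=> vi; rewrite -mem_restr legE mem_rcons inE vi orbT.
have fl i : val (f (Some i)) \in leg (y_ i) by rewrite -mem_restr legE mem_rcons mem_head.
have ncl y v : y \in s -> v \in leg y -> v != c.
  by move=> yin vl; apply: contraTneq (sub_rcons vl) => ->; apply: centre_notin.
have fint i (o : star (size s)) : f o \notin int i.
  apply/negP => /[dup] h /inl; case: o h => [j|] h hl.
    have e := yinj i j (in_star_leg (ys i) (ys j) hl (fl j)).
    have := ipath_uniq (ipQ i); rewrite -QE /= rcons_uniq => /and3P [_ + _].
    by rewrite e in h *; rewrite h.
  by have := ncl _ _ (ys i) hl; rewrite eqxx.
exists f, P; split.
- split.
    have cf j : f (Some j) != c0.
      by apply: contraTneq (fl j) => ->; apply/negP => /(ncl _ _ (ys j)); rewrite eqxx.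
    case=> [i|] [j|] // e; last by have := cf j; rewrite -e eqxx.
      by congr Some; apply: yinj; apply: (in_star_leg (ys i) (ys j) (fl i)); rewrite e fl.
    by have := cf i; rewrite e eqxx.
  by case=> [i|] [j|] //=; rewrite revK.
- case=> [i|] [j|] // _; rewrite [P _ _]/=.
    split; last by move=> o; rewrite mem_rev.
    by rewrite QR rev_uniq; apply: ipath_uniq.
  by split; [rewrite QE; apply: ipath_uniq|move=> o; apply: fint].
- have dis i j : i != j -> [disjoint int i & int j].
    move=> ij; apply/pred0P => v /=; apply/negP => /andP [/inl vi /inl vj].
    by case/eqP: ij; apply: yinj; apply: (in_star_leg (ys i) (ys j) vi vj).
  have dr (p q : seq (induced H)) : [disjoint p & q] -> [disjoint rev p & q].
    by move/pred0P => h; apply/pred0P => v; have := h v; rewrite /= mem_rev.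
  have dr2 (p q : seq (induced H)) : [disjoint p & q] -> [disjoint p & rev q].
    by move=> h; rewrite disjoint_sym dr // disjoint_sym.
  case=> [i|] [j|] // [i'|] [j'|] // _ _ ne; rewrite [P _ _]/= [P _ _ in X in disjoint _ X]/=.
  + by apply/dr/dr2/dis; apply: contraNneq ne => ->.
  + by apply/dr/dis; apply: contraNneq ne => ->; rewrite setUC.
  + by apply/dr2/dis; apply: contraNneq ne => ->; rewrite setUC.
  + by apply/dis; apply: contraNneq ne => ->.
- move=> v; have /star_setP [e|[y yin vl]] := valP v.
    by left; exists None; apply: val_inj.
  have iy : index y s < size s by rewrite index_mem.
  have ey : y_ (Ordinal iy) = y by rewrite /y_ /= nth_index.
  have : v \in restr H (leg (y_ (Ordinal iy))) by rewrite mem_restr ey.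
  rewrite legE mem_rcons inE => /orP [/eqP ->|vi]; first by left; exists (Some (Ordinal iy)).
  by right; exists None, (Some (Ordinal iy)).
move=> v z; split=> [vz|[a [b [ab]]]].
  have [y [yin vy zy]] := star_edge (valP v) (valP z) vz.
  have iy : index y s < size s by rewrite index_mem.
  have ey : y_ (Ordinal iy) = y by rewrite /y_ /= nth_index.
  rewrite -ey in vy zy; have U := ipath_uniq (ipQ (Ordinal iy)).
  rewrite -mem_restr in vy; rewrite -mem_restr in zy.
  move: (vz); rewrite (ipath_adj (ipQ (Ordinal iy))) // => /orP [] h.
    by exists None, (Some (Ordinal iy)); split=> //; rewrite [P _ _]/= QE infix2 // vy zy h.
  exists (Some (Ordinal iy)), None; split=> //; rewrite [P _ _]/=.
  rewrite QR.
  by rewrite -[[:: v; z]]/(rev [:: z; v]) infix_rev infix2 // vy zy h.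
case: a b ab => [i|] [j|] // _; rewrite [P _ _]/=.
  rewrite QR.
  rewrite -[[:: v; z]]/(rev [:: z; v]) infix_rev infix2 ?(ipath_uniq (ipQ i)) // => /and3P [h1 h2 h3].
  by rewrite (ipath_adj (ipQ i)) // h3 orbT.
rewrite QE infix2 ?(ipath_uniq (ipQ j)) // => /and3P [h1 h2 h3].
by rewrite (ipath_adj (ipQ j)) // h3.
Qed.

Lemma star_last y v : y \in s -> v \in H -> y -- v = (v == last y (leg y)).
Proof.
move=> ys; have [_ hp n1 hl] := star_leg ys.
have yr : y \in rcons (leg y) y by rewrite mem_rcons mem_head.
have lin : last y (leg y) \in leg y by case: (leg y) n1 => // e l _; rewrite /= mem_last.
case/star_setP => [->|[z zs vl]].
  have -> : (c == last y (leg y)) = false.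
    by apply: contraNF (centre_notin ys) => /eqP ->; apply: sub_rcons.
  have hq := ipath_apart (p := [:: c]) (x := head y (leg y)) (q := behead (rcons (leg y) y)).
  have e : [:: c] ++ head y (leg y) :: behead (rcons (leg y) y) = c :: rcons (leg y) y by case: (leg y) n1.
  rewrite e in hq; have yb : y \in behead (rcons (leg y) y) by case: (leg y) n1 => // b l _; rewrite /= mem_rcons mem_head.
  by have /andP [_ /negbTE] := hq hp c y (mem_head _ _) yb; rewrite sedge_sym.
have [zy|zy] := eqVneq z y.
  rewrite zy in vl.
  have := ipath_rev hp; rewrite rev_cons rev_rcons rcons_cons => hq.
  have n0 : rcons (rev (leg y)) c != [::] by case: (rev _).
  have [_ _ h'] := (ipath_consP y n0).1 hq; rewrite h'; last by rewrite mem_rcons inE mem_rev vl orbT.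
  by case/lastP: (leg y) n1 => // l b _; rewrite rev_rcons last_rcons.
have yz : y != z by rewrite eq_sym.
have /andP [_ /negbTE ->] := star_apart ys zs yz yr (sub_rcons vl).
apply/esym; apply: contraNF zy => /eqP e; rewrite e in vl.
by rewrite (in_star_leg zs ys vl lin).
Qed.

(** The centre has nonadjacent neighbours on two legs, and a vertex of a leg other than its end has
    a nonadjacent predecessor and successor. Only the end of a leg has a single neighbour. *)
Lemma star_tip v : v \in H -> clique (nbr v :&: H) = has (fun y => v == last y (leg y)) s.
Proof.
move=> vH; have [y0 [y1 [y0s y1s n01]]] : exists y0 y1, [/\ y0 \in s, y1 \in s & y0 != y1].
  case: (s) s3 Us => [|a [|b l]] //= _; rewrite inE negb_or => /andP [/andP [ab _] _].
  by exists a, b; rewrite !inE !eqxx orbT.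
have lin y : y \in s -> last y (leg y) \in leg y by case/star_leg => _ _; case: (leg y) => // b l _ _; rewrite /= mem_last.
have hdin y : y \in s -> head y (leg y) \in leg y by case/star_leg => _ _; case: (leg y) => // b l _ _; rewrite mem_head.
have nclq u u' : u \in H -> u' \in H -> v -- u -> v -- u' -> u != u' -> ~~ (u -- u') -> clique (nbr v :&: H) = false.
  move=> uH uH' vu vu' ne nuu; apply/negbTE/negP => /forall_inP /(_ u); rewrite in_setI uH inE vu => /(_ isT).
  by move/forall_inP => /(_ u'); rewrite in_setI uH' inE vu' => /(_ isT); rewrite ne (negbTE nuu).
case/star_setP: (vH) => [ev|[y ys vl]].
  have -> : has (fun y => v == last y (leg y)) s = false.
    apply/negbTE/hasPn => y ys; rewrite ev; apply: contraNneq (centre_notin ys) => ->.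
    exact/sub_rcons/lin.
  have ch y : y \in s -> c -- head y (leg y).
    move=> ys; have [_ _ n1 hl] := star_leg ys; have [_ _ h] := (ipath_consP c n1).1 hl.
    by rewrite h ?hdin //; case: (leg y) n1 => //= b l _; rewrite eqxx.
  have /andP [h1 h2] := star_apart y0s y1s n01 (sub_rcons (hdin _ y0s)) (sub_rcons (hdin _ y1s)).
  apply: (nclq (head y0 (leg y0)) (head y1 (leg y1))) => //.
  - by apply: (star_sub_H y0s); rewrite inE hdin ?orbT.
  - by apply: (star_sub_H y1s); rewrite inE hdin ?orbT.
  - by rewrite ev ch.
  - by rewrite ev ch.
have [_ hp n1 hl] := star_leg ys; have U := ipath_uniq hl.
have vc : v \in c :: leg y by rewrite inE vl orbT.
have cv : c != v by apply: contraTneq (sub_rcons vl) => <-; apply: centre_notin.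
have iv : index v (c :: leg y) < size (c :: leg y) by rewrite index_mem.
have ipos : 0 < index v (c :: leg y) by rewrite /= (negbTE cv).
have elast : last y (leg y) = nth v (c :: leg y) (size (leg y)).
  by rewrite -[size (leg y)]/((size (c :: leg y)).-1) nth_last /=; case: (leg y) n1.
have ladj i j : i < size (c :: leg y) -> j < size (c :: leg y) ->
    nth v (c :: leg y) i -- nth v (c :: leg y) j = (j == i.+1) || (i == j.+1).
  by move=> h1 h2; rewrite (ipath_adj hl) ?mem_nth // !index_uniq.
have ev := nth_index v vc.
have -> : has (fun y => v == last y (leg y)) s = (v == last y (leg y)).
  apply/hasP/idP => [[z zs /eqP e]|h]; last by exists y.
  have vz : v \in leg z by rewrite e lin.
  by rewrite (in_star_leg ys zs vl vz) -e.
have [tp|ne] := eqVneq v (last y (leg y)); last first.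
  have l2 : (index v (c :: leg y)).+1 < size (c :: leg y).
    have : index v (c :: leg y) != size (leg y) by apply: contraNneq ne => h; rewrite elast -h ev.
    by move: iv; rewrite [size (_ :: _)]/=; clear; slia.
  have l1 : (index v (c :: leg y)).-1 < size (c :: leg y) by move: iv; clear; slia.
  apply: (nclq (nth v (c :: leg y) (index v (c :: leg y)).-1) (nth v (c :: leg y) (index v (c :: leg y)).+1)).
  - by apply: (star_sub_H ys); apply: mem_nth.
  - by apply: (star_sub_H ys); apply: mem_nth.
  - by rewrite -{1}ev ladj //; move: ipos; clear; slia.
  - by rewrite -{1}ev ladj //; clear; slia.
  - by rewrite nth_uniq //; clear; slia.
  - by rewrite ladj //; move: ipos; clear; slia.
have ivl : index v (c :: leg y) = size (leg y).
  by rewrite tp elast index_uniq.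
have only u : u \in H -> v -- u -> u = nth v (c :: leg y) (size (leg y)).-1.
  move=> uH vu; have [z [zs vz uz]] := star_edge vH uH vu.
  have zy : z = y.
    move: vz; rewrite inE eq_sym (negbTE cv) /= => vz.
    exact: (in_star_leg zs ys vz vl).
  rewrite zy in uz; have iu : index u (c :: leg y) < size (c :: leg y) by rewrite index_mem.
  rewrite -(nth_index v uz); congr nth.
  by move: vu; rewrite (ipath_adj hl) // ivl; move: iu; rewrite [size (_ :: _)]/=; clear; slia.
apply/forall_inP => u; rewrite in_setI inE => /andP [vu uH].
apply/forall_inP => u'; rewrite in_setI inE => /andP [vu' uH'].
by rewrite (only u uH vu) (only u' uH' vu') eqxx.
Qed.

Lemma star_connectifier : stellar_connectifier H X.
Proof.
split; first by left; apply: star_subdivided.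
have sH y : y \in s -> y \notin H.
  by move=> ys; apply: contra (sD ys); apply/subsetP/star_H_sub.
have lH y : y \in s -> last y (leg y) \in H.
  move=> ys; have [_ _ n1 _] := star_leg ys; apply: (star_sub_H ys).
  by case: (leg y) n1 => // b l _; rewrite inE /= mem_last orbT.
split.
- by apply/pred0P => v /=; apply/negP; rewrite inE => /andP [/sH /negbTE ->].
- move=> y; rewrite inE => ys; apply/eqP/cards1P; exists (last y (leg y)); apply/setP => v.
  rewrite in_setI in_set1 [v \in nbr y]inE; have [vH|vH] := boolP (v \in H); first by rewrite andbT star_last.
  by rewrite andbF; apply/esym; apply: contraNF vH => /eqP ->; apply: lH.
apply/setP => v; rewrite in_setI; have [vH|vH] := boolP (v \in H); last by rewrite [RHS]inE (negbTE vH).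
rewrite [RHS]inE vH star_tip // [LHS]/= inE.
have -> : v \notin X by rewrite inE; apply: contraL vH; apply: sH.
apply/exists_inP/hasP => /= [[y]|[y ys h]].
  by rewrite inE => ys; rewrite star_last // => h; exists y.
by exists y; rewrite ?inE // star_last.
Qed.

End Stars.

(** * Alignments and combs from ladders *)

Section Outputs.
Variable G : sgraph.
Implicit Types (u v x y z c e p q : G) (P r s w ys : seq G) (H X D S : {set G}).

Lemma inner_nth s y : y \in inner s -> exists i, [/\ 0 < i, i.+1 < size s & forall x0, y = nth x0 s i].
Proof.
rewrite /inner => /(nthP y) [j]; rewrite size_behead size_take => hj <-.
have hs : j.+2 < size s by move: hj; case: ifP; clear; slia.
exists j.+1; split=> // x0; rewrite nth_behead nth_take; last by move: hs; clear; slia.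
by apply: set_nth_default; apply: ltnW.
Qed.

Lemma before_trans P e f h : (exists2 p, p \in P & f -- p) -> before P e f -> before P f h -> before P e h.
Proof. by move=> [p pP fp] b1 b2 u v uP vP eu hv; apply: ltn_trans (b1 u p uP pP eu fp) (b2 p v pP vP fp hv). Qed.

Lemma between_extremes P e f h x0 i j v : uniq P -> i < j -> j < size P ->
  before P e f -> before P f h -> e -- nth x0 P i -> h -- nth x0 P j ->
  v \in P -> f -- v -> i < index v P < j.
Proof.
move=> U ij jP b1 b2 ei hj vP fv.
have iP := ltn_trans ij jP.
have h1 := b1 _ _ (mem_nth x0 iP) vP ei fv; have h2 := b2 _ _ vP (mem_nth x0 jP) fv hj.
by rewrite !index_uniq // in h1 h2; rewrite h1 h2.
Qed.

(** [P] is cut to the stretch from the last neighbour of the first vertex of [s] to the first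
    neighbour of the last one. These two keep one neighbour each, and the vertices between them keep
    all of theirs, so their type is preserved. *)
Lemma ladder_alignment D P leg s k : uniq s -> 3 <= size s -> (forall y, y \in s -> y \notin D) ->
  ladder_in D P leg [set:: s] k true -> ordered P leg s ->
  exists P', [/\ alignment P' s, {subset P' <= D}, {subset P' <= P},
    forall y, y \in inner s -> forall v, v \in P -> y -- v -> v \in P' &
    forall y, y \in s -> y \notin inner s -> #|nbr_in y P'| = 1].
Proof.
move=> Us s3 sD hl ord; have [[hP PD] hS ap be] := hl.
have U := ipath_uniq hP.
have hS' y : y \in s -> [/\ leg y = [::], y \notin P & meets k P y].
  move=> ys; have [_ [_ h1] _ h2 /eqP h3] := hS y ltac:(by rewrite inE).
  by rewrite h3 /= in h1 h2.
have ord' x0 i j : i < j -> j < size s -> before P (nth x0 s i) (nth x0 s j).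
  move=> ij js; have := ord x0 i j ij js.
  have [-> _ _] := hS' _ (mem_nth x0 js); by have [-> _ _] := hS' _ (mem_nth x0 (ltn_trans ij js)).
have [x0 _] : exists x0 : G, True by case: (s) s3 => // x0; exists x0.
have s0 : 0 < size s by apply: leq_trans s3.
pose n := (size s).-1; have ns : n < size s by rewrite /n prednK.
pose y1 := nth x0 s 0; pose yk := nth x0 s n.
have y1s : y1 \in s by apply: mem_nth.
have yks : yk \in s by apply: mem_nth.
have n0 : 0 < n by rewrite /n; move: s3; clear; slia.
have nyk : y1 != yk by rewrite nth_uniq //; move: n0; clear; slia.
have m1 : y1 \in [set:: s] by rewrite inE.
have mk : yk \in [set:: s] by rewrite inE.
have b1k : before P (head y1 (leg y1)) (head yk (leg yk)) by apply: ord.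
have [i [j [ij jP [yi imax] [zj jmin] hsp]]] := ladder_spine hl m1 mk nyk b1k.
have [e1 nP1 _] := hS' y1 y1s; have [ek nPk _] := hS' yk yks.
rewrite e1 /= in yi imax; rewrite ek /= in zj jmin.
have iP : i < size P by apply: ltn_trans jP.
pose P' := seg i j P.
have hP' : ipath P' by apply: ipath_seg => //; exact: ltnW.
have P'P : {subset P' <= P} by apply: seg_sub.
have nbs y : y \in s -> exists2 p, p \in P & y -- p by case/hS' => _ _ /meets_neighbour.
have strict m v : 0 < m -> m < n -> v \in P -> nth x0 s m -- v -> i < index v P < j.
  move=> m0 mn; apply: (between_extremes (x0 := y1) U ij jP (ord' x0 0 m m0 (ltn_trans mn ns)) (ord' x0 m n mn ns)) => //.
have inP' v : v \in P -> i <= index v P <= j -> v \in P' by move=> vP h; rewrite mem_seg // vP.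
have sP' : size P' = j.+1 - i by rewrite size_seg.
have idx v : v \in P' -> index v P' = index v P - i by apply: index_seg.
have rng v : v \in P' -> i <= index v P <= j by rewrite mem_seg // => /and3P [_ -> ->].
have before' e f : before P e f -> before P' e f.
  move=> b u v uP vP eu fv; have := b u v (P'P _ uP) (P'P _ vP) eu fv; rewrite !idx //.
  by have := rng u uP; clear; slia.
have hd : nth y1 P i \in P' by apply: inP'; rewrite ?mem_nth // index_uniq // leqnn ltnW.
have ls : nth y1 P j \in P' by apply: inP'; rewrite ?mem_nth // index_uniq // leqnn ltnW.
have nb1 : nbr_in y1 P' = [set nth y1 P i].
  apply/setP => v; rewrite !inE; apply/andP/eqP => [[yv vP]|->]; last by [].
  have h1 := imax v (P'P _ vP) yv; have h2 := rng v vP.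
  have -> : i = index v P by move: h1 h2; clear; slia.
  by rewrite nth_index // P'P.
have nbk : nbr_in yk P' = [set nth y1 P j].
  apply/setP => v; rewrite !inE; apply/andP/eqP => [[yv vP]|->]; last by [].
  have h1 := jmin v (P'P _ vP) yv; have h2 := rng v vP.
  have -> : j = index v P by move: h1 h2; clear; slia.
  by rewrite nth_index // P'P.
exists P'; split.
- split.
  + by split.
  + split=> //; rewrite disjoint_sym; apply/pred0P => v /=; apply/negP => /andP [/P'P /PD vD /sD].
    by rewrite vD.
  + move=> y ys; have [m ms ey] : exists2 m, m < size s & y = nth x0 s m.
      by exists (index y s); rewrite ?index_mem ?nth_index.
    have [m0|m0] := eqVneq m 0.
      by rewrite ey m0 -/y1 nb1; apply/set0Pn; exists (nth y1 P i); rewrite inE.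
    have [mn|mn] := eqVneq m n.
      by rewrite ey mn -/yk nbk; apply/set0Pn; exists (nth y1 P j); rewrite inE.
    have [p pP yp] := nbs y ys; apply/set0Pn; exists p; rewrite !inE yp /=.
    have m0' : 0 < m by rewrite lt0n.
    have mn' : m < n by move: ms mn; rewrite /n; clear; slia.
    have h := strict m p m0' mn' pP; rewrite -ey in h; have {}h := h yp.
    by apply: inP' => //; move: h; clear; slia.
  (* For m < k this is the 1-based position on [P'] of the first neighbour of the m-th vertex; the
     value at k has to be the length of [P']. *)
  move=> z0 xx qq; pose J m := if m < size s then (find (sedge (nth x0 s m.-1)) P').+1 else size P'.
  have xE m : m < size s -> nth z0 s m = nth x0 s m by move=> ms; apply: set_nth_default.
  have P'0 : P' != [::] by case: hP'.
  have q1 : qq 1 = nth y1 P i.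
    by rewrite /qq /= nth_seg ?addn0; [apply: set_nth_default|exact: ltnW].
  have qn : qq (size P') = nth y1 P j.
    rewrite /qq nth_seg; last by rewrite sP'; move: ij; clear; slia.
    have -> : i + (size P').-1 = j by rewrite sP'; move: ij; clear; slia.
    exact: set_nth_default.
  have has' m : 0 < m < n -> exists2 p, p \in P' & nth x0 s m -- p.
    move=> /andP [m0 mn]; have ms : m < size s by apply: ltn_trans ns.
    have [p pP yp] := nbs _ (mem_nth x0 ms).
    by exists p => //; apply: inP' => //; have := strict m p m0 mn pP yp; clear; slia.
  have findP m : 0 < m < n -> exists p, [/\ p \in P', nth x0 s m -- p & find (sedge (nth x0 s m)) P' = index p P'].
    move=> hm; have [p pP yp] := has' m hm.
    have hh : has (sedge (nth x0 s m)) P' by apply/hasP; exists p.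
    have fs : find (sedge (nth x0 s m)) P' < size P' by rewrite -has_find.
    exists (nth x0 P' (find (sedge (nth x0 s m)) P')); split; first exact: mem_nth.
      by apply: nth_find.
    by rewrite index_uniq // (ipath_uniq hP').
  have lastidx : index (nth y1 P j) P' = (size P').-1.
    by rewrite idx // index_uniq // sP'; move: ij; clear; slia.
  have headidx : index (nth y1 P i) P' = 0 by rewrite idx // index_uniq // subnn.
  have upper m v : 0 < m < n -> v \in P' -> nth x0 s m -- v -> (index v P').+1 < J m.+2.
    move=> hm vP yv; have m1s : m.+1 < size s by move: hm ns; clear; slia.
    rewrite /J; case: ifP => hk.
      have hm' : 0 < m.+1 < n by move: hk; rewrite /n; clear; slia.
      have [p [pP yp ->]] := findP m.+1 hm'.
      by rewrite ltnS; apply: (before' _ _ (ord' x0 m m.+1 (ltnSn m) m1s)).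
    have en : m.+1 = n by move: hk hm; rewrite /n; clear; slia.
    have := before' _ _ (ord' x0 m n (ltac:(by rewrite -en)) ns) v (nth y1 P j) vP ls yv zj.
    by rewrite lastidx; clear; slia.
  have lower m v : 0 < m < n -> v \in P' -> nth x0 s m -- v -> J m.+1 <= (index v P').+1.
    move=> hm vP yv; have ms : m.+1 < size s by move: hm ns; clear; slia.
    rewrite /J ms /= ltnS leqNgt; apply/negP => lt.
    by have := before_find x0 lt; rewrite nth_index // yv.
  split.
  + by rewrite /xx /= xE // q1 nb1.
  + by rewrite /xx -/n xE // -/yk nbk qn.
  exists J; split.
  + have hm : 0 < 1 < n by rewrite /n; move: s3; clear; slia.
    have [p [pP yp ef]] := findP 1 hm.
    have s1 : 1 < size s by apply: leq_trans s3.
    have b := before' _ _ (ord' x0 0 1 isT s1) _ _ hd pP yi yp.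
    by rewrite /J s3 /= ef; move: b; rewrite headidx; clear; slia.
  + case=> [|[|m]] // hm; have hm' : 0 < m.+1 < n by move: hm; rewrite /n; clear; slia.
    have [p [pP yp ef]] := findP m.+1 hm'.
    exact: leq_ltn_trans (lower _ _ hm' pP yp) (upper _ _ hm' pP yp).
  + by rewrite /J ltnn.
  + case=> [|[|m]] // u hm; have hm' : 0 < m.+1 < n by move: hm; rewrite /n; clear; slia.
    have ms : m.+1 < size s by move: hm; clear; slia.
    rewrite /xx /= xE // !inE => /andP [yu uP].
    by rewrite lower // upper.
- by move=> v /P'P /PD.
- exact: P'P.
- move=> y /inner_nth [m [m0 ms ey]] v vP yv; rewrite (ey x0) in yv.
  apply: inP' => //; have := strict m v m0 _ vP yv; rewrite /n => h.
  have {}h := h ltac:(by move: ms; clear; slia); by move: h; clear; slia.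
- move=> y ys ny; have [m ms ey] : exists2 m, m < size s & y = nth x0 s m.
    by exists (index y s); rewrite ?index_mem ?nth_index.
  have [m0|m0] := eqVneq m 0; first by rewrite ey m0 -/y1 nb1 cards1.
  have [mn|mn] := eqVneq m n; first by rewrite ey mn -/yk nbk cards1.
  case/negP: ny; rewrite ey /inner -[m](prednK (n := m)) ?lt0n // -nth_behead.
  have ss : m < (size s).-1 by move: ms mn; rewrite /n; clear; slia.
  rewrite -[in X in nth _ _ X]/(m.-1) nth_behead prednK ?lt0n // -(nth_take x0 ss) -[m](prednK (n := m)) ?lt0n // -nth_behead.
  by rewrite mem_nth // size_behead size_take; move: ss m0; case: ifP; clear; slia.
Qed.

(* [w] runs backwards along the leg of [y1], then along [P], then along the leg of [yk]. *)
Lemma ladder_comb D P leg y1 ys yk k : uniq (y1 :: rcons ys yk) -> ys != [::] -> k <> Wide ->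
  (forall y, y \in y1 :: rcons ys yk -> y \notin D) ->
  ladder_in D P leg [set:: y1 :: rcons ys yk] k false -> ordered P leg (y1 :: rcons ys yk) ->
  exists w a, let H := comb_set w ys leg in
    [/\ comb (if k is Triangle then true else false) w ys leg a, H \subset D,
      forall v, v \in H -> (y1 != v) && (y1 -- v == (v == head v w)) &
      forall v, v \in H -> (yk != v) && (yk -- v == (v == last v w))].
Proof.
set s := y1 :: rcons ys yk => Us ys0 nk sD hl ord; have [[hP PD] hS ap be] := hl.
have U := ipath_uniq hP.
have y1s : y1 \in [set:: s] by rewrite inE mem_head.
have yks : yk \in [set:: s] by rewrite inE inE mem_rcons mem_head orbT.
have yss y : y \in ys -> y \in [set:: s] by move=> h; rewrite inE inE mem_rcons inE h !orbT.
have [Us1 Us2] : y1 \notin rcons ys yk /\ uniq (rcons ys yk) by apply/andP.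
have n1k : y1 != yk by apply: contraNneq Us1 => ->; rewrite mem_rcons mem_head.
have n1y y : y \in ys -> y1 != y by move=> h; apply: contraNneq Us1 => ->; rewrite mem_rcons inE h orbT.
have [Us3 Uys] : yk \notin ys /\ uniq ys by apply/andP; rewrite -rcons_uniq.
have nky y : y \in ys -> yk != y by move=> h; apply: contraNneq Us3 => ->.
have sz : size s = (size ys).+2 by rewrite /= size_rcons.
have nth_s x0 i : i < size ys -> nth x0 s i.+1 = nth x0 ys i by move=> h; rewrite /= nth_rcons h.
have nth_k x0 : nth x0 s (size ys).+1 = yk by rewrite /= nth_rcons ltnn eqxx.
pose e y := head y (leg y).
have b1 y : y \in ys -> before P (e y1) (e y).
  move=> h; have iy : index y ys < size ys by rewrite index_mem.
  have := ord y 0 (index y ys).+1 isT; rewrite sz ltnS nth_s // nth_index //; apply.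
  exact: ltnW.
have bk y : y \in ys -> before P (e y) (e yk).
  move=> h; have iy : index y ys < size ys by rewrite index_mem.
  have := ord y (index y ys).+1 (size ys).+1; rewrite sz nth_s // nth_index // nth_k; apply=> //.
have nbs y : y \in [set:: s] -> exists2 p, p \in P & e y -- p by case/hS => _ _ _ /meets_neighbour.
have [y0 y0s] : exists y, y \in ys by case: (ys) ys0 => // y l; exists y; rewrite mem_head.
have b1k : before P (e y1) (e yk) by apply: before_trans (nbs _ (yss _ y0s)) (b1 _ y0s) (bk _ y0s).
have [i [j [ij jP [yi imax] [zj jmin] hsp]]] := ladder_spine hl y1s yks n1k b1k.
have iP : i < size P by apply: ltn_trans jP.
pose w := rev (leg y1) ++ seg i j P ++ leg yk.
have ew : rev (rcons (leg y1) y1) ++ seg i j P ++ rcons (leg yk) yk = y1 :: rcons w yk.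
  by rewrite rev_rcons /w -!rcons_cat.
rewrite ew in hsp.
have [s1 [ip1 np1] a1 m1 l1] := hS y1 y1s; have [sk [ipk npk] ak mk lk] := hS yk yks.
have sseg : size (seg i j P) = j.+1 - i by rewrite size_seg.
have w0 : w != [::] by rewrite /w -size_eq0 !size_cat sseg; move: ij; clear; slia.
have hw : ipath w.
  have := hsp; rewrite -cat1s -cats1 => h; apply: (@ipath_catl _ w [:: yk]) => //.
  by apply: (ipath_catr _ h); case: (w) w0.
have Uw := ipath_uniq hw.
have segP : {subset seg i j P <= P} by apply: seg_sub.
have wD : {subset w <= D}.
  by move=> v; rewrite /w !mem_cat mem_rev => /or3P [/s1|/segP /PD|/sk].
have inw v : v \in w -> [\/ v \in leg y1, v \in seg i j P | v \in leg yk].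
  by rewrite /w !mem_cat mem_rev => /or3P.
have segw v : v \in seg i j P -> v \in w by rewrite /w !mem_cat => ->; rewrite orbT.
have apy y z : y \in [set:: s] -> z \in [set:: s] -> y != z -> apart (rcons (leg y) y) (rcons (leg z) z) by apply: ap.
have ein y : e y \in rcons (leg y) y by apply: head_mem_rcons.
have strict y v : y \in ys -> v \in P -> e y -- v -> i < index v P < j.
  by move=> yin vP ev; apply: (between_extremes (x0 := y1) U ij jP (b1 _ yin) (bk _ yin)).
have nseg y v : y \in ys -> v \in P -> e y -- v -> v \in seg i j P.
  by move=> yin vP ev; have := strict y v yin vP ev; rewrite mem_seg // vP; clear; slia.
have nw y v : y \in ys -> v \in w -> e y -- v -> v \in seg i j P.
  move=> yin /inw [h|//|h] ev.
    have := apy y1 y y1s (yss _ yin) (n1y _ yin) v (e y) (sub_rcons h) (ein y).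
    by rewrite sedge_sym ev andbF.
  have := apy yk y yks (yss _ yin) (nky _ yin) v (e y) (sub_rcons h) (ein y).
  by rewrite sedge_sym ev andbF.
have idxw v : v \in seg i j P -> index v w = size (leg y1) + (index v P - i).
  move=> vs; rewrite /w index_cat size_rev mem_rev.
  have -> : (v \in leg y1) = false.
    apply/negbTE/negP => h; move: Uw; rewrite /w cat_uniq => /and3P [_ /hasPn hh _].
    by have := hh v; rewrite mem_cat vs /= mem_rev h => /(_ isT).
  by rewrite index_cat vs index_seg.
have headw : head y1 w \in leg y1.
  have n1 : leg y1 != [::] by rewrite l1.
  rewrite /w; case/lastP: (leg y1) n1 => // l b _; rewrite rev_rcons /= mem_rcons mem_head //.
have lastw : last y1 w \in leg yk.
  have n1 : leg yk != [::] by rewrite lk.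
  rewrite /w !last_cat; case/lastP: (leg yk) n1 => // l b _; rewrite last_rcons mem_rcons mem_head //.
have apw y : y \in ys -> apart (behead (rcons (leg y) y)) w.
  move=> yin u v ub; have [_ _ a2 _ _] := hS y (yss _ yin); have u2 := mem_behead ub.
  case/inw => hv.
  - by have := apy y1 y y1s (yss _ yin) (n1y _ yin) v u (sub_rcons hv) u2; rewrite eq_sym sedge_sym.
  - by apply: a2 => //; apply: segP.
  - by have := apy yk y yks (yss _ yin) (nky _ yin) v u (sub_rcons hv) u2; rewrite eq_sym sedge_sym.
have enw y : y \in ys -> e y \notin w.
  move=> yin; apply/negP => /inw [hv|hv|hv].
  - by have := apy y1 y y1s (yss _ yin) (n1y _ yin) _ _ (sub_rcons hv) (ein y); rewrite eqxx.
  - by have [_ [_ h] _ _ _] := hS y (yss _ yin); move/negP: h; apply; apply: segP.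
  - by have := apy yk y yks (yss _ yin) (nky _ yin) _ _ (sub_rcons hv) (ein y); rewrite eqxx.
pose t := if k is Triangle then true else false.
pose a y := find (sedge (e y)) w.
(* The head of a leg sees only that part of [w] which lies on [P], so its type on [P] is also its
   type on [w]. *)
have aE y : y \in ys -> a y + t < size w /\ forall u, u \in w -> e y -- u = (index u w == a y) || t && (index u w == (a y).+1).
  move=> yin; have [_ _ _ my _] := hS y (yss _ yin).
  have [p pP ep] := meets_neighbour my.
  have hh : has (sedge (e y)) w by apply/hasP; exists p => //; apply/segw/(nseg y).
  have aw : a y < size w by rewrite /a -has_find.
  have fa : e y -- nth y1 w (a y) by apply: nth_find.
  have fin : nth y1 w (a y) \in w by apply: mem_nth.
  have fseg := nw y _ yin fin fa; have fP := segP _ fseg.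
  have minf u : u \in w -> e y -- u -> a y <= index u w.
    move=> uw eu; rewrite leqNgt; apply/negP => lt; have := before_find y1 lt.
    by rewrite nth_index // eu.
  have eidx u : u \in w -> index u w = a y -> u = nth y1 w (a y) by move=> uw <-; rewrite nth_index.
  have [ek|ek] : k = Single \/ k = Triangle by case: (k) nk; auto.
    rewrite ek /= in my; rewrite /t ek addn0; split=> // u uw; rewrite orbF; apply/idP/eqP => [eu|/(eidx u uw) -> //].
    case: my => c _ only.
    have -> : u = nth y1 w (a y).
      by rewrite (only u (segP _ (nw y u yin uw eu)) eu) (only _ fP fa).
    by rewrite index_uniq.
  rewrite ek /= in my; rewrite /t ek.
  case: my => u1 [u2 [[u1P u2P] u12 [e1 e2] only]].
  wlog e1' : u1 u2 u1P u2P u12 e1 e2 only / nth y1 w (a y) = u1.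
    move=> H; case: (only _ fP fa) => h; first exact: (H u1 u2).
    apply: (H u2 u1) => //; first by rewrite sedge_sym.
    by move=> v vP ev; case: (only v vP ev); auto.
  have u1w : u1 \in w by rewrite -e1'.
  have u2w : u2 \in w by apply/segw/(nseg y).
  have i1 : index u1 w = a y by rewrite -e1' index_uniq.
  have i2 : index u2 w = (a y).+1.
    move: u12; rewrite (ipath_adj hw) // i1; have := minf u2 u2w e2.
    by clear; slia.
  have i2s : index u2 w < size w by rewrite index_mem.
  rewrite addn1 -i2; split=> // u uw; apply/idP/orP => [eu|].
    by case: (only u (segP _ (nw y u yin uw eu)) eu) => ->; [left; rewrite i1|right; rewrite eqxx].
  case=> /eqP h; first by rewrite -(nth_index y1 uw) h.
  by rewrite -(nth_index u2 uw) h nth_index.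
exists w, a => /=.
have Hsub : comb_set w ys leg \subset D.
  apply/subsetP => v; rewrite inE => /orP [/wD //|/hasP [y yin vl]].
  by have [h _ _ _ _] := hS y (yss _ yin); apply: h.
have sw0 : 0 < size w by rewrite lt0n size_eq0.
have swl : (size w).-1 < size w by rewrite prednK.
have notD y v : y \in s -> v \in D -> y != v by move=> ys' vD; apply: contraNneq (sD y ys') => ->.
split=> //.
- split=> //.
  + move=> y yin; have [_ [ipy _] _ _ ly] := hS y (yss _ yin); have [h1 h2] := aE y yin.
    split=> //; first by rewrite ly.
      exact: apw.
      exact: enw.
    have noedge v : v \in leg y1 \/ v \in leg yk -> e y -- v = false.
      case=> h.
        have := apy y1 y y1s (yss _ yin) (n1y _ yin) v (e y) (sub_rcons h) (ein y).
        by rewrite sedge_sym => /andP [_ /negbTE].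
      have := apy yk y yks (yss _ yin) (nky _ yin) v (e y) (sub_rcons h) (ein y).
      by rewrite sedge_sym => /andP [_ /negbTE].
    split=> //.
      (* A tooth is not attached at an end of [w]: the ends lie on the nonempty legs of [y1] and
         [yk], which it does not see. *)
      rewrite lt0n; apply/negP => /eqP a0.
      have hw0 : nth y1 w 0 \in w by apply: mem_nth.
      have := h2 _ hw0; rewrite noedge; last by left; rewrite nth0.
      by rewrite index_uniq // a0.
    have ne : a y + t != (size w).-1.
      apply/negP => /eqP al; have hwl : nth y1 w (size w).-1 \in w by apply: mem_nth.
      have := h2 _ hwl; rewrite noedge; last by right; rewrite nth_last.
      by rewrite index_uniq // -al; case: (t); clear; slia.
    by move: h1 ne sw0; rewrite -/t; clear; slia.
  + by move=> y z yin zin; apply: apy; apply: yss.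
  + move=> x0 m n mn ns; have ms := ltn_trans mn ns.
    have ym : nth x0 ys m \in ys by apply: mem_nth.
    have yn : nth x0 ys n \in ys by apply: mem_nth.
    have b : before P (e (nth x0 ys m)) (e (nth x0 ys n)).
      have := ord x0 m.+1 n.+1; rewrite !nth_s // sz; apply=> //.
      by rewrite ltnS; exact: ltnW.
    have [h1 h2] := aE _ ym; have [h3 h4] := aE _ yn; rewrite -/t.
    have at_in : nth x0 w (a (nth x0 ys m) + t) \in w by apply: mem_nth.
    have anw : a (nth x0 ys n) < size w by apply: leq_ltn_trans h3; rewrite leq_addr.
    have an_in : nth x0 w (a (nth x0 ys n)) \in w by apply: mem_nth.
    have ea : e (nth x0 ys m) -- nth x0 w (a (nth x0 ys m) + t).
      by rewrite h2 // index_uniq //; case: (t); clear; slia.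
    have eb : e (nth x0 ys n) -- nth x0 w (a (nth x0 ys n)).
      by rewrite h4 // index_uniq // eqxx.
    have sa := nw _ _ ym at_in ea; have sb := nw _ _ yn an_in eb.
    have := b _ _ (segP _ sa) (segP _ sb) ea eb.
    have := idxw _ sa; have := idxw _ sb; rewrite !index_uniq // => Ea Eb.
    move: sa sb; rewrite !mem_seg // => /and3P [_ q1 q2] /and3P [_ q3 q4].
    by move: Ea Eb q1 q3; clear; slia.
- move=> v vH; rewrite (notD y1) ?mem_head ?(subsetP Hsub) //=; apply/eqP.
  have n0 : rcons w yk != [::] by case: (w).
  have [_ _ h] := (ipath_consP y1 n0).1 hsp.
  move: vH; rewrite inE => /orP [vw|/hasP [y yin vl]].
    by rewrite h ?mem_rcons ?inE ?vw ?orbT //; case: (w) vw.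
  have /andP [_ /negbTE ->] := apy y1 y y1s (yss _ yin) (n1y _ yin) y1 v ltac:(by rewrite mem_rcons mem_head) (sub_rcons vl).
  have hin : head v w \in leg y1 by move: headw; case: (w) w0.
  apply/esym; apply: contraTF vl => /eqP ->; apply/negP => h'.
  by have := apy y1 y y1s (yss _ yin) (n1y _ yin) _ _ (sub_rcons hin) (sub_rcons h'); rewrite eqxx.
- have yks' : yk \in s by rewrite inE mem_rcons mem_head orbT.
  move=> v vH; rewrite (notD yk) ?(subsetP Hsub) //=; apply/eqP.
  have n0 : rev (y1 :: w) != [::] by rewrite -size_eq0 size_rev.
  have hr : ipath (yk :: rev (y1 :: w)).
    by have := ipath_rev hsp; rewrite -rcons_cons rev_rcons.
  have [_ _ h] := (ipath_consP yk n0).1 hr.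
  move: vH; rewrite inE => /orP [vw|/hasP [y yin vl]].
    rewrite h; last by rewrite mem_rev inE vw orbT.
    rewrite rev_cons; case/lastP: (w) w0 => // l b _.
    by rewrite rev_rcons rcons_cons last_rcons.
  have /andP [_ /negbTE ->] := apy yk y yks (yss _ yin) (nky _ yin) yk v ltac:(by rewrite mem_rcons mem_head) (sub_rcons vl).
  have hin : last v w \in leg yk by move: lastw; case: (w) w0.
  apply/esym; apply: contraTF vl => /eqP ->; apply/negP => h'.
  by have := apy yk y yks (yss _ yin) (nky _ yin) _ _ (sub_rcons hin) (sub_rcons h'); rewrite eqxx.
Qed.

End Outputs.

(** * From arranged pairs to connectifiers and alignments *)

Section Final.
Variable G : sgraph.
Implicit Types (u v x y z c e p q : G) (P r s w ys : seq G) (H X D S Y : {set G}).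

(** Separates the outcomes: for a connectifier each vertex of [X] has one neighbour, while the inner
    vertices of a triangular or wide alignment have at least two. This is needed because a
    triangular alignment facing a wide one must be excluded however the two sides were obtained. *)
Definition sparse H X := forall y, y \in X -> #|nbr y :&: H| <= 1.

Definition realises (k : option attach) (b : bool) H X := match k with
  | None => stellar_connectifier H X
  | Some Single => spiky_connectifier H X \/ spiky_alignment H X
  | Some Triangle => if b then triangular_alignment H X else triangular_connectifier H X
  | Some Wide => wide_alignment H X
  end.

Lemma inner_exists s X : 3 <= #|X| -> X = [set:: s] -> exists2 y, y \in inner s & y \in X.
Proof.
move=> X3 eX; have s3 : 3 <= size s.
  by apply: leq_trans (card_size s); rewrite -(eq_card (fun v => in_set (mem s) v)) -/[set:: s] -eX.
case: s s3 eX => [|y0 [|y [|z l]]] // _ ->.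
by exists y; rewrite ?inE ?eqxx ?orbT // /inner /= mem_head.
Qed.

Lemma sparse_not_triangular H X : 3 <= #|X| -> sparse H X -> ~ triangular_alignment H X.
Proof.
move=> X3 sp [P [s [[_ eH eX] h]]]; have [y yi yX] := inner_exists X3 eX.
have [u [w [e uw]]] := h y yi; have := sp y yX.
by rewrite eH [_ :&: _]e cards2 edge_neq.
Qed.

Lemma sparse_not_wide H X : 3 <= #|X| -> sparse H X -> ~ wide_alignment H X.
Proof.
move=> X3 sp [P [s [[_ eH eX] h]]]; have [y yi yX] := inner_exists X3 eX.
have [u [w [uy wy uw _]]] := h y yi; have := sp y yX.
by rewrite eH leqNgt => /negP; apply; apply/card_gt1P; exists u, w.
Qed.

Lemma attached_sparse H X : attached H X -> sparse H X.
Proof. by case=> _ h _ y yX; rewrite h. Qed.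

(** The last clause records that only triangular and wide ladders with empty legs can give a vertex
    of [s] several neighbours in [H]. *)
Lemma arranged_realised D s k b : uniq s -> 3 <= size s -> (forall y, y \in s -> y \notin D) ->
  arranged D s k b ->
  exists H, [/\ H \subset D, realises k b H [set:: s], k = None \/ gives_order H [set:: s] s &
    (b /\ (k = Some Triangle \/ k = Some Wide)) \/ sparse H [set:: s]].
Proof.
move=> Us s3 sD [c leg [] hs|P leg t [] hl ord kW].
- have st := star_single s3 sD hs; exists [set c]; split; auto.
    by rewrite sub1set; case: hs.
  by right; apply: attached_sparse; case: st.
- have st := star_connectifier Us s3 sD hs; exists (star_set c leg s); split; auto.
    exact: star_H_sub hs.
  by right; apply: attached_sparse; case: st.
- have [P' [al P'D P'P inn ext]] := ladder_alignment Us s3 sD hl ord.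
  have alo : alignment_on [set:: P'] [set:: s] P' s by split.
  have nb y : y \in inner s -> meets t P y /\ forall v, (v \in nbr_in y P') = (v \in P) && (y -- v).
    move=> yi; have ys : y \in s by apply: (mem_take (n0 := (size s).-1)); apply: mem_behead.
    split; first by case: hl => _ h _ _; have [_ _ _ m /eqP e] := h y ltac:(by rewrite inE); rewrite e in m.
    move=> v; rewrite !inE andbC; apply/andP/andP => -[h1 h2]; split=> //; first exact: P'P.
    exact: inn h2.
  exists [set:: P']; split.
  + by apply/subsetP => v; rewrite inE => /P'D.
  + case: t hl kW nb => hl kW nb /=.
    * right; exists P', s; split=> // y yi; have [[c [cP yc] only] nbE] := nb y yi.
      suff -> : nbr_in y P' = [set c] by rewrite cards1.
      apply/setP => v; rewrite nbE inE; apply/andP/eqP => [[vP yv]|->] //.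
      exact: only.
    * exists P', s; split=> // y yi; have [[u [w [[uP wP] uw [yu yw] only]]] nbE] := nb y yi.
      exists u, w; split=> //; apply/setP => v; rewrite nbE !inE; apply/andP/orP => [[vP yv]|[] /eqP ->] //.
      by case: (only v vP yv) => ->; auto.
    * exists P', s; split=> // y yi; have [[u [w [[uP wP] uw nuw [yu yw]]]] nbE] := nb y yi.
      by exists u, w; rewrite !nbE uP wP.
  + by right; apply: Or33; exists P'.
  + case: t hl kW nb => hl kW nb; auto; right=> y; rewrite inE => ys.
    have [yi|ni] := boolP (y \in inner s); last by rewrite -/(nbr_in y P') ext.
    have [[c [cP yc] only] nbE] := nb y yi.
    rewrite -(cards1 c); apply: subset_leq_card; apply/subsetP => v.
    by rewrite -/(nbr_in y P') nbE inE => /andP [vP yv]; rewrite (only v).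
- case: s Us s3 sD hl ord => // y1 l; case/lastP: l => // ys yk Us s3 sD hl ord.
  have ys0 : ys != [::] by case: (ys) s3.
  have nk : t <> Wide by move=> /kW.
  have [w [a [hc HD hy1 hyk]]] := ladder_comb Us ys0 nk sD hl ord.
  have at_ := comb_attached hc hy1 hyk; have od := comb_order hc hy1 hyk Us.
  exists (comb_set w ys leg); split=> //; last by right; apply: attached_sparse.
    case: t hc nk {hl kW} => //= hc _.
      by left; split=> //; case: (comb_caterpillar_spine hc).
    by split=> //; case: (comb_line_caterpillar hc).
  right; case: t hc nk {hl kW} => //= hc _.
    have [ca sp] := comb_caterpillar_spine hc.
    by apply: Or31; split=> //; exists w.
  have [ca sp] := comb_line_caterpillar hc.
  by apply: Or32; split=> //; exists w.
Qed.

(** A common vertex of two components, or an edge between them, would make them equal. *)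
Lemma component_separated D1 D2 Y : is_component (~: Y) D1 -> is_component (~: Y) D2 -> D1 != D2 ->
  separated D1 D2 Y.
Proof.
case=> u1 u1Y ->; case=> u2 u2Y ->; rewrite -/(component (~: Y) u1) -/(component (~: Y) u2) => ne.
have sub u : u \in ~: Y -> [disjoint component (~: Y) u & Y].
  by move=> uY; rewrite disjoints_subset component_sub.
split; try exact: sub.
move=> u v uD vD; rewrite -negb_or; apply/negP => h; case/eqP: ne.
rewrite -(component_eq uD) -(component_eq vD); case/orP: h => [/eqP ->|uv] //.
apply/esym/component_eq; apply: (component_closed (w := u)) => //.
- exact: (subsetP (component_sub u1Y)).
- exact: component_self.
- exact: (subsetP (component_sub u2Y)).
Qed.

Lemma is_component_connected Y D : is_component (~: Y) D -> connected D.
Proof. by case=> u uY ->; apply: component_connected. Qed.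

End Final.

(** Makes the case of x at most 2 vacuous, after which three vertices of Y are available for
    comparison. *)
Lemma small_cliques (G : sgraph) (x : nat) : x <= 2 -> (exists u v : G, u -- v) ->
  0 < x -> exists2 K : {set G}, clique K & #|K| = x.
Proof.
move=> x2 [u [v uv]]; case: x x2 => [|[|[|x]]] // _ _.
- exists [set u]; last exact: cards1.
  by apply/forall_inP => w /set1P ->; apply/forall_inP => z /set1P ->; rewrite eqxx.
- exists [set u; v]; last by rewrite cards2 edge_neq.
  apply/forall_inP => w hw; apply/forall_inP => z hz; apply/implyP.
  by case/set2P: hw => ->; case/set2P: hz => ->; rewrite ?eqxx // sedge_sym.
Qed.

(** Stated with the triangular side first; it is applied with the sides exchanged if the triangular
    one is found in the second component. *)
Lemma realised_pair (G : sgraph) (D1 D2 Y X : {set G}) (s : seq G) k b k' b' :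
  X = [set:: s] -> separated D1 D2 Y -> {subset s <= Y} -> uniq s -> 3 <= size s ->
  arranged D1 s k b -> arranged D2 s k' b' ->
  triangular k -> ~~ triangular k' -> ~ (k = Some Triangle /\ b /\ k' = Some Wide) ->
  exists H1 H2 : {set G}, [/\ H1 \subset D1, H2 \subset D2,
    triangular_connectifier H1 X \/ triangular_alignment H1 X,
    [\/ stellar_connectifier H2 X, spiky_connectifier H2 X,
        spiky_alignment H2 X | wide_alignment H2 X] &
    (triangular_alignment H1 X -> ~ wide_alignment H2 X) /\
    (~ stellar_connectifier H1 X -> ~ stellar_connectifier H2 X ->
      exists s : seq G, gives_order H1 X s /\ gives_order H2 X s)].
Proof.
move=> eX [_ d1 d2] sY Us s3 ar1 ar2 tk tk' nw.
have ek : k = Some Triangle by case: (k) tk => // -[].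
rewrite {}ek {tk} in ar1 nw.
have notin (D : {set G}) : [disjoint D & Y] -> forall y, y \in s -> y \notin D.
  by move=> d y /sY yY; apply/negbT/(disjointFl d).
have X3 : 3 <= #|X| by rewrite eX cardsE (card_uniqP Us).
have [H1 [h1 r1 g1 sp1]] := arranged_realised Us s3 (notin _ d1) ar1.
have [H2 [h2 r2 g2 sp2]] := arranged_realised Us s3 (notin _ d2) ar2.
rewrite -eX in r1 g1 sp1 r2 g2 sp2; exists H1, H2; split=> //.
- by move: r1 => /=; case: (b); auto.
- move: r2 tk'; case: (k') => [[]|] //=; last by move=> *; apply: Or41.
    by case=> *; [apply: Or42|apply: Or43].
  by move=> *; apply: Or44.
split=> [ta wa|ns1 ns2].
- case: sp1 => [[b1 _]|sp]; last by case: (sparse_not_triangular X3 sp ta).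
  case: sp2 => [[_ [ek'|ek']]|sp]; last by case: (sparse_not_wide X3 sp wa).
    by rewrite ek' in tk'.
  exact: nw.
- exists s; split; first by case: g1.
  by case: g2 => // ek'; case: ns2; move: r2; rewrite ek'.
Qed.

Theorem theorem5p6 (x : nat) (hx : 1 <= x) :
  exists tau : nat, 1 <= tau /\
  forall (G : sgraph) (D1 D2 Y : {set G}),
    class_Cx G x ->
    [set: G] = D1 :|: D2 :|: Y ->
    stable Y -> #|Y| = tau ->
    is_component (~: Y) D1 -> is_component (~: Y) D2 -> D1 != D2 ->
    nbrs D1 = Y -> nbrs D2 = Y ->
    (forall y : G, y \in Y -> ~ Hub y) ->
  exists X H1 H2 : {set G},
    [/\ X \subset Y /\ #|X| = x,
        (H1 \subset D1 /\ H2 \subset D2) \/ (H1 \subset D2 /\ H2 \subset D1),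
        triangular_connectifier H1 X \/ triangular_alignment H1 X,
        [\/ stellar_connectifier H2 X, spiky_connectifier H2 X,
            spiky_alignment H2 X | wide_alignment H2 X] &
        (triangular_alignment H1 X -> ~ wide_alignment H2 X) /\
        (~ stellar_connectifier H1 X -> ~ stellar_connectifier H2 X ->
           exists s : seq G, gives_order H1 X s /\ gives_order H2 X s)].
Proof.
(* [M] is for matching the two orders. The bounds are composed backwards: the set kept after the
   first component must be large enough for the second, and the set kept after that for Ramsey's
   theorem. *)
have [M hM] := ramsey x x.
pose n2 := maxn 1 (maxn x M).
have [N2 hN2] := @structure_theorem x n2 (leq_maxl 1 _).
have [N1 hN1] := @structure_theorem x (maxn 1 N2) (leq_maxl 1 _).
exists (maxn 1 N1); split; first by rewrite leq_max.
move=> G D1 D2 Y [[_ nth npr _] ncl] _ st cY comp1 comp2 neq nb1 nb2 hub.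
have touch D : nbrs D = Y -> forall y, y \in Y -> exists2 a, a \in D & y -- a.
  by move=> <- y; rewrite inE => /andP [_ /exists_inP [a aD ay]]; exists a; rewrite // sedge_sym.
have [small|x3] := leqP x 2.
  have [y yY] : exists y, y \in Y by apply/card_gt0P; rewrite cY leq_max.
  have [a _ ya] := touch _ nb1 y yY.
  by case: ncl; apply: small_cliques => //; exists y, a.
have stab : {in Y &, forall y z, ~~ (y -- z)}.
  by move=> y z yY zY; move/forall_inP/(_ y yY)/forall_inP: st; apply.
have sep := component_separated comp1 comp2 neq; have sep' := separated_sym sep.
have cn1 := is_component_connected comp1; have cn2 := is_component_connected comp2.
have t1 := touch _ nb1; have t2 := touch _ nb2.
have [|S1 [sS1 cS1] st1] := hN1 G D1 D2 Y Y nth npr ncl sep stab cn1 cn2 t1 t2 (subxx _).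
  by rewrite cY leq_maxr.
have [|S2 [sS2 cS2] st2] := hN2 G D2 D1 Y S1 nth npr ncl sep' stab cn2 cn1 t2 t1 sS1.
  by rewrite cS1 leq_maxr.
have [||s [k [b [k' [b' [Us ss sub ar1 ar2]]]]]] := common_arrangement hM _ _ (structured_sub sS2 st1) st2.
- by rewrite cS2 /n2 !leq_max leqnn !orbT.
- by rewrite cS2 /n2 !leq_max leqnn !orbT.
have s3 : 3 <= size s by rewrite ss.
have sY : {subset s <= Y} by move=> y /sub /(subsetP sS2) /(subsetP sS1).
have [tri [nw1 nw2]] := arranged_types sep nth npr hub Us s3 sY ar1 ar2.
have [X eX] : exists X : {set G}, X = [set:: s] by exists [set:: s].
have XY : X \subset Y /\ #|X| = x.
  rewrite eX.
  split; first by apply/subsetP => y; rewrite inE => /sY.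
  by rewrite cardsE (card_uniqP Us).
have [tk|tk] := boolP (triangular k).
  have tk' : ~~ triangular k' by move: tri; rewrite tk; case: (triangular k').
  have [H1 [H2 [h1 h2 h3 h4 h5]]] := realised_pair eX sep sY Us s3 ar1 ar2 tk tk' nw1.
  by exists X, H1, H2; split=> //; left.
have tk' : triangular k' by move: tri; rewrite (negbTE tk); case: (triangular k').
have [H1 [H2 [h1 h2 h3 h4 h5]]] := realised_pair eX sep' sY Us s3 ar2 ar1 tk' tk nw2.
by exists X, H1, H2; split=> //; right.
Qed.
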